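(* Let $L(\mathbf{A};1)=\sum_{a\in A_+} a(t,y)/a(\theta,\eta)$, which converges in $\mathbb{T}[y]$. Then, as elements of $\mathbb{T}[y]$, \[ L(\mathbf{A};1) = -\frac{\delta^{(1)}\,\pi_\rho}{f\,\omega_\rho}, \] where $\delta^{(1)}=t-\alpha^q$ and $\pi_\rho=-\mathrm{Res}_\Xi(\omega_\rho\lambda)$.
   Context: Let $q$ be a power of a prime and $E/\mathbb{F}_q$ the elliptic curve $y^2+a_1ty+a_3y=t^3+a_2t^2+a_4t+a_6$ ($a_i\in\mathbb{F}_q$) with point at infinity $\infty$; $\mathbf{A}=\mathbb{F}_q[t,y]$. Let $\theta,\eta$ satisfy the same equation, $A=\mathbb{F}_q[\theta,\eta]$, $K=\mathbb{F}_q(\theta,\eta)$, and for $a\in A$ write $a(t,y)$ for the same polynomial in $t,y$. Let $\deg=-\mathrm{ord}_\infty$ on $K$ ($\deg\theta=2$, $\deg\eta=3$), $K_\infty$ the completion at $\infty$, $\mathfrak{M}_\infty$ its maximal ideal, $\mathbb{C}_\infty$ the completion of an algebraic closure of $K_\infty$. The sign of nonzero $a\in A$ is its leading coefficient with respect to the $\mathbb{F}_q$-basis $\{\theta^i,\theta^j\eta\}$; $A_+$ is the set of elements of sign $1$. For nonzero $g\in L[t,y]$ ($L\supseteq\mathbb{F}_q$ a field), $\widetilde{\mathrm{sgn}}(g)$ is its leading coefficient with respect to the monomials $t^i,t^jy$, extended multiplicatively to $L(t,y)^\times$. Frobenius twisting $g\mapsto g^{(k)}$ raises the coefficients (in $t,y$,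 or in $t^n$ for power series) to the $q^k$-th power; $X^{(k)}$ is the $q^k$-Frobenius image of a point $X$. Let $\Xi=(\theta,\eta)$, $\lambda=dt/(2y+a_1t+a_3)$, $V=(\alpha,\beta)$ the unique point of the formal group $\widehat{E}(\mathfrak{M}_\infty)$ with $V-V^{(1)}=\Xi$, $H=K(\alpha,\beta)$, $m=(\eta-\beta^q)/(\theta-\alpha^q)$, $\nu=y-\eta-m(t-\theta)$, $\delta=t-\alpha$, and $f=\nu/\delta$ (the unique function with $\widetilde{\mathrm{sgn}}(f)=1$ and divisor $(V^{(1)})-(V)+(\Xi)-(\infty)$). Let $\mathbb{T}$ be the Tate algebra of series $\sum c_nt^n$ over $\mathbb{C}_\infty$ with $|c_n|\to 0$, and $\mathbb{T}[y]=\mathbb{T}\oplus\mathbb{T}y$ with $y$ subject to the Weierstrass equation. Fix a $(q-1)$-st root of $\xi=-(m+\beta/\alpha)$ and let $\omega_\rho=\xi^{1/(q-1)}\prod_{i\ge0}\xi^{q^i}/f^{(i)}\in\mathbb{T}[y]$, which extends meromorphically to $E\setminus\{\infty\}$ with simple poles at the $\Xi^{(i)}$. *)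

(* Defs.v *)
From HB Require Import structures.
From mathcomp Require Import all_boot all_order all_algebra finmap ring zify.
From mathcomp Require Import all_classical all_reals all_analysis.

Set Implicit Arguments.
Unset Strict Implicit.
Unset Printing Implicit Defensive.

Import Order.TTheory GRing.Theory Num.Theory.
Import numFieldNormedType.Exports.

Local Open Scope classical_set_scope.
Local Open Scope ring_scope.

(* Wext u v is u + v y in S[y] / (y ^ 2 + b y - c) *)
Record wext (S : Type) (b c : S) := Wext { wre : S; wim : S }.
Arguments Wext {S b c}.

Section WextRing.
Context (S : comNzRingType) (b c : S).
Notation E := (wext b c).
Implicit Types u v w : E.

Lemma wext_eq u v : wre u = wre v -> wim u = wim v -> u = v.
Proof. by case: u => ? ?; case: v => ? ? /= -> ->. Qed.

Let wpair u := (wre u, wim u).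
Let wunpair (p : S * S) : E := Wext p.1 p.2.
Let wpairK : cancel wpair wunpair. Proof. by case. Qed.

HB.instance Definition _ := Choice.copy E (can_type wpairK).

Definition wext_zero : E := Wext 0 0.
Definition wext_one : E := Wext 1 0.
Definition wext_opp u : E := Wext (- wre u) (- wim u).
Definition wext_add u v : E := Wext (wre u + wre v) (wim u + wim v).
Definition wext_mul u v : E :=
  Wext (wre u * wre v + wim u * wim v * c)
       (wre u * wim v + wim u * wre v - wim u * wim v * b).

Fact wext_addA : associative wext_add.
Proof. by move=> u v w; apply: wext_eq; apply: addrA. Qed.
Fact wext_addC : commutative wext_add.
Proof. by move=> u v; apply: wext_eq; apply: addrC. Qed.
Fact wext_add0 : left_id wext_zero wext_add.
Proof. by move=> u; apply: wext_eq; apply: add0r. Qed.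
Fact wext_addN : left_inverse wext_zero wext_opp wext_add.
Proof. by move=> u; apply: wext_eq; apply: addNr. Qed.

HB.instance Definition _ :=
  GRing.isZmodule.Build E wext_addA wext_addC wext_add0 wext_addN.

Fact wext_mulA : associative wext_mul.
Proof. by move=> u v w; apply: wext_eq => /=; ring. Qed.
Fact wext_mulC : commutative wext_mul.
Proof. by move=> u v; apply: wext_eq => /=; ring. Qed.
Fact wext_mul1 : left_id wext_one wext_mul.
Proof. by move=> u; apply: wext_eq => /=; ring. Qed.
Fact wext_mulD : left_distributive wext_mul +%R.
Proof. by move=> u v w; apply: wext_eq => /=; ring. Qed.
Fact wext_one_neq0 : wext_one != 0.
Proof. by apply/eqP => /(congr1 (@wre _ _ _)) /eqP; rewrite /= oner_eq0. Qed.

HB.instance Definition _ := GRing.Zmodule_isComNzRing.Build E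
  wext_mulA wext_mulC wext_mul1 wext_mulD wext_one_neq0.

Definition wext_unit : {pred E} := fun u => `[< exists v, v * u = 1 >].
Definition wext_inv u : E := xget u [set v | v * u = 1].

Fact wext_mulVr : {in wext_unit, left_inverse 1 wext_inv *%R}.
Proof. by move=> u /asboolP [v vu]; rewrite /wext_inv; case: xgetP => // /(_ v). Qed.
Fact wext_unitP u v : v * u = 1 -> wext_unit u.
Proof. by move=> vu; apply/asboolP; exists v. Qed.
Fact wext_inv_out : {in [predC wext_unit], wext_inv =1 id}.
Proof.
move=> u /asboolP nu; rewrite /wext_inv; case: xgetP => // v _ vu.
by case: nu; exists v.
Qed.

HB.instance Definition _ := GRing.ComNzRing_hasMulInverse.Build E
  wext_mulVr wext_unitP wext_inv_out.

Definition wcst (s : S) : E := Wext s 0.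
Definition wgen : E := Wext 0 1.

End WextRing.

Arguments wcst {S b c} s.
Arguments wgen {S b c}.

Record weierstrass (S : Type) :=
  Weierstrass { wa1 : S; wa2 : S; wa3 : S; wa4 : S; wa6 : S }.

Definition map_w (S T : Type) (h : S -> T) (W : weierstrass S) : weierstrass T :=
  Weierstrass (h (wa1 W)) (h (wa2 W)) (h (wa3 W)) (h (wa4 W)) (h (wa6 W)).

Section Weierstrass.
Context (S : comNzRingType) (W : weierstrass S).

Definition wlin (x : S) : S := wa1 W * x + wa3 W.
Definition wcub (x : S) : S := x ^+ 3 + wa2 W * x ^+ 2 + wa4 W * x + wa6 W.

Definition on_curve (x y : S) : Prop := y ^+ 2 + wlin x * y = wcub x.

(* S (+) S y, with y subject to the Weierstrass equation at x *)
Definition wring (x : S) := wext (wlin x) (wcub x).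

(* d/dy and d/dx of the Weierstrass equation *)
Definition wdy (x y : S) : S := 2 * y + wa1 W * x + wa3 W.
Definition wdx (x y : S) : S :=
  wa1 W * y - (3 * x ^+ 2 + 2 * wa2 W * x + wa4 W).

(* To be used over an algebraically closed field; the point at infinity is
   always nonsingular. *)
Definition nonsingular : Prop :=
  forall x y, on_curve x y -> ~ (wdx x y = 0 /\ wdy x y = 0).

End Weierstrass.

(* The chord-tangent law; None is the point at infinity. *)
Section GroupLaw.
Context (k : fieldType) (W : weierstrass k).

Definition wneg (P : option (k * k)) : option (k * k) :=
  if P is Some (x, y) then Some (x, - y - wa1 W * x - wa3 W) else None.

Definition wadd (P Q : option (k * k)) : option (k * k) :=
  match P, Q with
  | None, _ => Q
  | _, None => P
  | Some (x1, y1), Some (x2, y2) =>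
    if (x1 == x2) && (y1 + y2 + wa1 W * x2 + wa3 W == 0) then None else
    let l := if x1 == x2 then - wdx W x1 y1 / wdy W x1 y1
             else (y2 - y1) / (x2 - x1) in
    let x3 := l ^+ 2 + wa1 W * l - wa2 W - x1 - x2 in
    Some (x3, - (l + wa1 W) * x3 - (y1 - l * x1) - wa3 W)
  end.

End GroupLaw.

Definition coordA (F : finFieldType) (W : weierstrass F) :=
  wring (map_w polyC W) ('X : {poly F}).

Section CoordA.
Context (F : finFieldType) (W : weierstrass F).
Implicit Types a : coordA W.

(* t ^ i and t ^ j y have weights 2 i and 2 j + 3; size = degree + 1 *)
Definition wsgn a : F :=
  if (wim a == 0) || ((size (wim a)).+1 < size (wre a))%N
  then lead_coef (wre a) else lead_coef (wim a).

Definition Aplus : set (coordA W) := [set a | wsgn a = 1].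

Definition aev (S : comNzRingType) (h : F -> S) (x y : S) a : S :=
  (map_poly h (wre a)).[x] + (map_poly h (wim a)).[x] * y.

End CoordA.

HB.mixin Record Field_hasUltraAbs (R : realType) C of GRing.Field C := {
  uabs : C -> R;
  uabs_ge0 : forall x, 0 <= uabs x;
  uabs_eq0 : forall x, (uabs x == 0) = (x == 0);
  uabsM : forall x y, uabs (x * y) = uabs x * uabs y;
  uabsD : forall x y, uabs (x + y) <= Num.max (uabs x) (uabs y)
}.

#[short(type="ultraFieldType")]
HB.structure Definition UltraField (R : realType) :=
  { C of GRing.Field C & Field_hasUltraAbs R C }.

Section Ultra.
Context (R : realType) (C : ultraFieldType R).
Implicit Types (x y : C) (u : nat -> C).

Definition ucvg u x : Prop := (fun n => uabs (u n - x)) @ \oo --> (0 : R).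

Definition ucauchy u : Prop :=
  forall e : R, 0 < e ->
  exists N, forall m n, (N <= m)%N -> (N <= n)%N -> uabs (u m - u n) < e.

Definition has_usum u x : Prop := ucvg (fun n => \sum_(i < n) u i) x.

(* 0 if the series diverges *)
Definition usum u : C := xget 0 [set x | has_usum u x].

(* \sum_n u_n X ^ n converges on the closed disc of radius rho *)
Definition tends0 (rho : R) u : Prop :=
  (fun n => uabs (u n) * rho ^+ n) @ \oo --> (0 : R).

Definition tate_cond u : Prop := (fun n => uabs (u n)) @ \oo --> (0 : R).

Lemma uabs0 : uabs (0 : C) = 0 :> R.
Proof. by apply/eqP; rewrite uabs_eq0. Qed.

Lemma uabs1 : uabs (1 : C) = 1 :> R.
Proof.
have n0 : uabs (1 : C) != 0 :> R by rewrite uabs_eq0 oner_eq0.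
by apply: (mulfI n0); rewrite -uabsM !mulr1.
Qed.

Lemma uabsN x : uabs (- x) = uabs x :> R.
Proof.
have n1 : uabs (-1 : C) = 1 :> R.
  apply/eqP; rewrite -sqrp_eq1 ?uabs_ge0//.
  by rewrite expr2 -uabsM mulrNN mulr1 uabs1.
by rewrite -mulN1r uabsM n1 mul1r.
Qed.

Lemma uabsX x n : uabs (x ^+ n) = uabs x ^+ n :> R.
Proof. by elim: n => [|n IH]; rewrite ?uabs1// !exprS uabsM IH. Qed.

Lemma uabs_sum_lt (e : R) n u : 0 < e -> (forall i, (i < n)%N -> uabs (u i) < e) ->
  uabs (\sum_(i < n) u i) < e.
Proof.
move=> e0; elim: n => [|n IH] h; first by rewrite big_ord0 uabs0.
rewrite big_ord_recr/=; apply: le_lt_trans (uabsD _ _) _.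
by rewrite gt_max h// IH// => i ilt; apply/h/ltnW.
Qed.

Lemma tate_condP u : tate_cond u <->
  forall e : R, 0 < e -> exists N, forall n, (N <= n)%N -> uabs (u n) < e.
Proof.
split=> [/cvgr0Pnorm_lt h e /h [N _ hN]|h].
  by exists N => n /hN /=; rewrite ger0_norm ?uabs_ge0.
apply/cvgr0Pnorm_lt => e /h [N hN]; exists N => // n /= /hN.
by rewrite ger0_norm ?uabs_ge0.
Qed.

Lemma tate_cond_bounded u : tate_cond u ->
  exists2 M : R, 0 < M & forall n, uabs (u n) <= M.
Proof.
move=> /tate_condP /(_ 1 ltr01) [N hN].
suff [M M0 hM] : exists2 M : R, 0 < M & forall n, (n < N)%N -> uabs (u n) <= M.
  exists (Num.max M 1) => [|n]; first by rewrite lt_max M0.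
  by rewrite le_max; case: (ltnP n N) => [/hM ->|/hN /ltW ->]; rewrite ?orbT.
elim: N {hN} => [|N [M M0 hM]]; first by exists 1.
exists (Num.max M (uabs (u N))) => [|n]; first by rewrite lt_max M0.
by rewrite ltnS leq_eqVlt le_max => /predU1P[->|/hM ->//]; rewrite lexx orbT.
Qed.

Lemma tate_cond_fin u N : (forall n, (N <= n)%N -> u n = 0) -> tate_cond u.
Proof.
by move=> h; apply/tate_condP => e e0; exists N => n /h ->; rewrite uabs0.
Qed.

Lemma tate_condN u : tate_cond u -> tate_cond (fun n => - u n).
Proof.
move=> /tate_condP h; apply/tate_condP => e /h [N hN].
by exists N => n /hN; rewrite uabsN.
Qed.

Lemma tate_condD u v : tate_cond u -> tate_cond v -> tate_cond (fun n => u n + v n).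
Proof.
move=> /tate_condP hu /tate_condP hv; apply/tate_condP => e e0.
have [[M hM] [N hN]] := (hu _ e0, hv _ e0).
exists (maxn M N) => n; rewrite geq_max => /andP[/hM un /hN vn].
by apply: le_lt_trans (uabsD _ _) _; rewrite gt_max un.
Qed.

Lemma tate_condX m u : (0 < m)%N -> tate_cond u -> tate_cond (fun n => u n ^+ m).
Proof.
case: m => // m _ /tate_condP h; apply/tate_condP => e e0.
have [|N hN] := h (Num.min e 1); first by rewrite lt_min e0 ltr01.
exists N => n /hN; rewrite lt_min => /andP[ue u1].
rewrite uabsX exprS; apply: le_lt_trans ue.
by rewrite ler_piMr ?uabs_ge0// exprn_ile1 ?uabs_ge0// ltW.
Qed.

Lemma tate_condM u v : tate_cond u -> tate_cond v ->
  tate_cond (fun n => \sum_(i < n.+1) u i * v (n - i)%N).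
Proof.
move=> tu tv; have [M M0 uM] := tate_cond_bounded tu.
have [M' M'0 vM'] := tate_cond_bounded tv.
move/tate_condP: tu => hu; move/tate_condP: tv => hv.
apply/tate_condP => e e0.
have [N hN] := hu _ (divr_gt0 e0 M'0); have [N' hN'] := hv _ (divr_gt0 e0 M0).
exists (N + N')%N => n nN.
apply: (uabs_sum_lt (u := fun i => u i * v (n - i)%N)) => // i ile.
rewrite uabsM; case: (leqP N i) => [/hN ui|iN].
  apply: (@le_lt_trans _ _ (uabs (u i) * M')).
    by rewrite ler_wpM2l ?uabs_ge0.
  by rewrite -ltr_pdivlMr.
have /hN' vi : (N' <= n - i)%N by lia.
apply: (@le_lt_trans _ _ (M * uabs (v (n - i)%N))).
  by rewrite ler_wpM2r ?uabs_ge0.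
by rewrite mulrC -ltr_pdivlMr.
Qed.

End Ultra.

Record tate (R : realType) (C : ultraFieldType R) :=
  Tate { tcoef :> nat -> C; tateP : tate_cond tcoef }.

Section Tate.
Context (R : realType) (C : ultraFieldType R).
Notation T := (tate C).
Implicit Types f g h : T.

HB.instance Definition _ := gen_eqMixin T.
HB.instance Definition _ := gen_choiceMixin T.

Lemma tate_eq f g : tcoef f =1 tcoef g -> f = g.
Proof.
case: f g => [f fP] [g gP] /= /funext fg; subst g.
by congr Tate; apply: Prop_irrelevance.
Qed.

Definition tate_cst (x : C) : T.
Proof.
exists (fun n => if n == 0%N then x else 0).
by apply: (@tate_cond_fin _ _ _ 1%N) => -[].
Defined.

Definition tate_var : T.
Proof.
exists (fun n => if n == 1%N then 1 else 0).
by apply: (@tate_cond_fin _ _ _ 2%N) => -[|[]].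
Defined.

Definition tate_opp f : T := Tate (tate_condN (tateP f)).
Definition tate_add f g : T := Tate (tate_condD (tateP f) (tateP g)).
Definition tate_mul f g : T := Tate (tate_condM (tateP f) (tateP g)).

Fact tate_addA : associative tate_add.
Proof. by move=> f g h; apply: tate_eq => n; apply: addrA. Qed.
Fact tate_addC : commutative tate_add.
Proof. by move=> f g; apply: tate_eq => n; apply: addrC. Qed.
Fact tate_add0 : left_id (tate_cst 0) tate_add.
Proof. by move=> f; apply: tate_eq => n /=; rewrite if_same add0r. Qed.
Fact tate_addN : left_inverse (tate_cst 0) tate_opp tate_add.
Proof. by move=> f; apply: tate_eq => n /=; rewrite if_same addNr. Qed.

HB.instance Definition _ :=
  GRing.isZmodule.Build T tate_addA tate_addC tate_add0 tate_addN.

Let tpoly N f : {poly C} := \poly_(i < N) f i.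

Let tate_mulE N f g n : (n < N)%N ->
  tate_mul f g n = (tpoly N f * tpoly N g)`_n.
Proof.
move=> nN; rewrite coefM /=; apply: eq_bigr => i _.
by rewrite !coef_poly !ifT//; have := ltn_ord i; lia.
Qed.

Fact tate_mulA : associative tate_mul.
Proof.
move=> f g h; apply: tate_eq => n.
have -> : tate_mul f (tate_mul g h) n =
          (tpoly n.+1 f * (tpoly n.+1 g * tpoly n.+1 h))`_n.
  rewrite coefM; apply: eq_bigr => i _.
  by rewrite coef_poly ltn_ord (@tate_mulE n.+1)// ltnS leq_subr.
have -> : tate_mul (tate_mul f g) h n =
          (tpoly n.+1 f * tpoly n.+1 g * tpoly n.+1 h)`_n.
  rewrite coefM; apply: eq_bigr => i _.
  by rewrite coef_poly ltnS leq_subr (@tate_mulE n.+1).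
by rewrite mulrA.
Qed.
Fact tate_mulC : commutative tate_mul.
Proof.
by move=> f g; apply: tate_eq => n; rewrite !(@tate_mulE n.+1)// mulrC.
Qed.
Fact tate_mul1 : left_id (tate_cst 1) tate_mul.
Proof.
move=> f; apply: tate_eq => n /=.
rewrite big_ord_recl/= subn0 mul1r big1 ?addr0// => i _.
by rewrite mul0r.
Qed.
Fact tate_mulDl : left_distributive tate_mul +%R.
Proof.
move=> f g h; apply: tate_eq => n /=.
by rewrite -big_split; apply: eq_bigr => i _; rewrite mulrDl.
Qed.
Fact tate_one_neq0 : tate_cst 1 != 0.
Proof. by apply/eqP => /(congr1 (fun f : T => f 0%N)) /eqP; rewrite /= oner_eq0. Qed.

HB.instance Definition _ := GRing.Zmodule_isComNzRing.Build T
  tate_mulA tate_mulC tate_mul1 tate_mulDl tate_one_neq0.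

Definition gauss_norm f : R := sup (range (fun n => uabs (f n))).

Fact twist_subproof (F : finFieldType) k f :
  tate_cond (fun n => f n ^+ (#|F| ^ k)).
Proof.
apply: tate_condX (tateP f).
by rewrite expn_gt0; apply/orP; left; apply/card_gt0P; exists 0.
Qed.

(* f ^ (k) for q = #|F| *)
Definition twist_tate (F : finFieldType) k f : T := Tate (twist_subproof F k f).

Definition tate_eval f (x : C) : C := usum (fun n => f n * x ^+ n).

End Tate.

Arguments tate_cst {R C} x.
Arguments tate_var {R C}.

Section TateY.
Context (R : realType) (F : finFieldType) (W : weierstrass F)
  (C : ultraFieldType R) (iota : {rmorphism F -> C}).

Definition tateY := wring (map_w (tate_cst \o iota) W) (tate_var : tate C).

Definition tyc (x : C) : tateY := wcst (tate_cst x).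
Definition tyt : tateY := wcst tate_var.
Definition tyy : tateY := wgen.

Definition tynorm (g : tateY) : R :=
  Num.max (gauss_norm (wre g)) (gauss_norm (wim g)).

Definition twist k (g : tateY) : tateY :=
  Wext (twist_tate F k (wre g)) (twist_tate F k (wim g)).

Definition tycvg (u : nat -> tateY) (g : tateY) : Prop :=
  (fun n => tynorm (u n - g)) @ \oo --> (0 : R).

(* 1 if the limit does not exist *)
Definition tylim (u : nat -> tateY) : tateY := xget 1 [set g | tycvg u g].

(* Unordered sum of the u i for i in D *)
Definition has_tysum (I : choiceType) (D : set I) (u : I -> tateY) (g : tateY) :
    Prop :=
  forall e : R, 0 < e -> exists J : {fset I}, [set` J] `<=` D /\
    forall J' : {fset I}, [set` J] `<=` [set` J'] -> [set` J'] `<=` D ->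
      tynorm (\sum_(i <- J') u i - g) < e.

(* 0 if the family is not summable *)
Definition tysum (I : choiceType) (D : set I) (u : I -> tateY) : tateY :=
  xget 0 [set g | has_tysum D u g].

(* g converges on { P in E : |t(P)| <= rho } *)
Definition ty_analytic (rho : R) (g : tateY) : Prop :=
  tends0 rho (wre g) /\ tends0 rho (wim g).

Definition ty_eval (g : tateY) (x y : C) : C :=
  tate_eval (wre g) x + tate_eval (wim g) x * y.

(* G / H is the meromorphic continuation of g to { P in E : |t(P)| <= rho },
   for rho >= 1 *)
Definition mero_ext (rho : R) (g G H : tateY) : Prop :=
  [/\ ty_analytic rho G, ty_analytic rho H, H != 0 & H * g = G].

(* h(x, y) = \sum_(n >= 0) c_n (x - x0) ^ (n - N) on a punctured neighbourhood of
   the point (x0, y0) of E, at which t - x0 must be a local parameter *)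
Definition laurent_at (h : C -> C -> C) (x0 y0 : C) (N : nat) (c : nat -> C) :
    Prop :=
  exists2 e : R, 0 < e & forall x y, on_curve (map_w iota W) x y ->
    x != x0 -> uabs (x - x0) < e -> uabs (y - y0) < e ->
    has_usum (fun n => c n * (x - x0) ^+ n) (h x y * (x - x0) ^+ N).

(* r is the residue at (x0, y0) of g lambda, lambda = dt / (2 y + a1 t + a3);
   since dt = d(t - x0) it is the coefficient of (t - x0) ^ (-1) in the expansion
   of the coefficient of dt. *)
Definition is_res_lambda (g : tateY) (x0 y0 r : C) : Prop :=
  exists rho G H N c,
  [/\ 1 <= rho, uabs x0 < rho, mero_ext rho g G H,
      laurent_at (fun x y => ty_eval G x y / ty_eval H x y
                             / wdy (map_w iota W) x y) x0 y0 N c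
    & r = if N is N'.+1 then c N' else 0].

(* 0 if g does not extend meromorphically around (x0, y0) *)
Definition res_lambda (g : tateY) (x0 y0 : C) : C :=
  xget 0 [set r | is_res_lambda g x0 y0 r].

End TateY.

Section Data.
Context (R : realType) (F : finFieldType) (W : weierstrass F)
  (C : ultraFieldType R) (iota : {rmorphism F -> C}) (theta eta : C).
Local Notation q := #|F|.
Local Notation WC := (map_w iota W).

Definition Kfield : set C := [set x | exists a b : coordA W,
  aev iota theta eta b != 0 /\
  x = aev iota theta eta a / aev iota theta eta b].

(* Closure of K in C, which is its completion when C is complete *)
Definition Kinf : set C :=
  [set x | exists2 u : nat -> C, (forall n, Kfield (u n)) & ucvg u x].

Definition Minf : set C := [set x | Kinf x /\ uabs x < 1].

Definition algebraic_over_Kinf (x : C) : Prop :=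
  exists p : {poly C}, [/\ p != 0, forall i, Kinf p`_i & root p x].

(* C is the completion of an algebraic closure of K_oo, with absolute value
   q ^ deg on K *)
Record is_Cinf : Prop := IsCinf {
  Cinf_curve : on_curve WC theta eta;
  Cinf_theta : uabs theta = q%:R ^+ 2;
  Cinf_eta : uabs eta = q%:R ^+ 3;
  Cinf_complete : forall u : nat -> C, ucauchy u -> exists x, ucvg u x;
  Cinf_closed : GRing.closed_field_axiom C;
  Cinf_dense : forall (x : C) (e : R), 0 < e ->
    exists2 x', algebraic_over_Kinf x' & uabs (x - x') < e
}.

(* The affine point (x, y) lies in the formal group \hat E(M_oo), i.e. its
   parameters z = - x / y and w = - 1 / y are in M_oo; z alone is not enough,
   as w must be the root w(z) in M_oo of the Weierstrass equation in (z, w). *)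
Definition in_formal_group (x y : C) : Prop :=
  [/\ on_curve WC x y, y != 0, Minf (- x / y) & Minf (- 1 / y)].

(* V - V^(1) = Xi for V = (alpha, beta) *)
Definition is_drinfeld_point (alpha beta : C) : Prop :=
  in_formal_group alpha beta /\
  wadd WC (Some (alpha, beta)) (wneg WC (Some (alpha ^+ q, beta ^+ q)))
    = Some (theta, eta).

Definition shtuka_slope (alpha beta : C) : C :=
  (eta - beta ^+ q) / (theta - alpha ^+ q).

Definition shtuka_nu (alpha beta : C) : tateY W iota :=
  tyy W iota - tyc W iota eta
  - tyc W iota (shtuka_slope alpha beta) * (tyt W iota - tyc W iota theta).

Definition shtuka_delta (alpha : C) : tateY W iota :=
  tyt W iota - tyc W iota alpha.

Definition shtuka_f (alpha beta : C) : tateY W iota :=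
  shtuka_nu alpha beta / shtuka_delta alpha.

Definition shtuka_xi (alpha beta : C) : C :=
  - (shtuka_slope alpha beta + beta / alpha).

(* zeta is the chosen (q - 1)-st root of xi *)
Definition omega_rho (alpha beta zeta : C) : tateY W iota :=
  tyc W iota zeta *
  tylim (fun n => \prod_(i < n)
    (tyc W iota (shtuka_xi alpha beta ^+ (q ^ i))
     / twist i (shtuka_f alpha beta))).

Definition pi_rho (alpha beta zeta : C) : C :=
  - res_lambda (omega_rho alpha beta zeta) theta eta.

(* a(t, y) / a(theta, eta) *)
Definition Lterm (a : coordA W) : tateY W iota :=
  aev (fun x => tyc W iota (iota x)) (tyt W iota) (tyy W iota) a
  * tyc W iota (aev iota theta eta a)^-1.

Definition LA1 : tateY W iota := tysum (@Aplus F W) Lterm.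

End Data.

(* Main.v *)
Require Import Defs.
From HB Require Import structures.
From mathcomp Require Import all_boot all_order all_algebra all_field finmap ring lra zify.
From mathcomp Require Import all_classical all_reals all_analysis.

(** Two norms are played against each other. Xi lies outside the unit disc, as |theta| = Q ^ 2, so
    evaluations at Xi use the disc of radius Q ^ 3, on which the product without its factor at i = 0
    (the one with the pole at Xi) is a unit. No bound for the P_k on that disc is at hand, but their
    Gauss norms are at most 1; limits that involve them are taken for the Gauss norm, and they meet
    Xi only through the exact value P_k(Xi) = 1. The number n = 2 k + 1 is the dimension of the
    space of functions with pole order at most n at infinity. The power sums vanish for 0 < j < n
    because the coefficients of a form n free variables, and each division by a shtuka function
    spends one zero and lowers the pole order by one. The statement selects limits, sums and
    residues by choice, so each needs existence and uniqueness. For the residue, uniqueness ranges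
    over arbitrary meromorphic continuations; this is what requires local parametrisations and
    isolated zeros on the curve. *)

(* The finite sums P_k of a(t, y) / a(theta, eta) over the a in A_+ of bounded degree are
   functions on E, regular away from infinity. They take the value 1 at Xi and vanish at Xi^(j)
   for 0 < j < n, because a power sum over F_q^n of a product of fewer than n (q - 1) linear
   forms is 0. Multiplying P_k by delta^(n) and dividing in turn by the shtuka functions
   f^(n-1), ..., f^(1), each division uses one of these zeros; what remains has degree so
   small that it must be a multiple of the line through V^(1) and - V^(n), which tends to
   delta^(1) after scaling. Hence P_k \prod_(0 < i < n) xi^(i) / f^(i) is, up to a factor
   tending to 1, a constant multiple of a function tending to delta^(1), and the constant is
   found by evaluating at Xi. In the limit, with Pi = \prod_(i >= 1) xi^(i) / f^(i),
     L = (Pi(Xi) / (theta - alpha^q)) delta^(1) / Pi.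
   Finally f omega = zeta xi Pi, where zeta is the chosen root of xi, and (t - theta) omega is
   regular at Xi with a value that gives Res = zeta xi Pi(Xi) / (theta - alpha^q). *)

Set Implicit Arguments.
Unset Strict Implicit.
Unset Printing Implicit Defensive.

Import Order.TTheory GRing.Theory Num.Theory.
Import numFieldNormedType.Exports.
Local Open Scope ring_scope.

(** * Ultrametric rings *)

Section Basic.
Context (R : realType) (C : ultraFieldType R).
Implicit Types (x y : C) (u : nat -> C).

Lemma uabsV x : uabs x^-1 = (uabs x)^-1 :> R.
Proof.
have [->|x0] := eqVneq x 0; first by rewrite invr0 uabs0 invr0.
have ux0 : uabs x != 0 :> R by rewrite uabs_eq0.
by apply: (mulfI ux0); rewrite -uabsM !divff // uabs1.
Qed.

Lemma uabsB x y : uabs (x - y) <= Num.max (uabs x) (uabs y) :> R.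
Proof. by rewrite -(uabsN y); apply: uabsD. Qed.

Lemma uabs_gt0 x : (0 < uabs x :> R) = (x != 0).
Proof. by rewrite lt0r uabs_ge0 andbT uabs_eq0. Qed.

Lemma uabs_distC x y : uabs (x - y) = uabs (y - x) :> R.
Proof. by rewrite -uabsN opprB. Qed.

Lemma uabsD_lt (e : R) x y : uabs x < e -> uabs y < e -> uabs (x + y) < e.
Proof. by move=> hx hy; apply: le_lt_trans (uabsD _ _) _; rewrite gt_max hx. Qed.

Lemma uabsD_le (e : R) x y : uabs x <= e -> uabs y <= e -> uabs (x + y) <= e.
Proof. by move=> hx hy; apply: le_trans (uabsD _ _) _; rewrite ge_max hx. Qed.

Lemma uabsB_le (e : R) x y : uabs x <= e -> uabs y <= e -> uabs (x - y) <= e.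
Proof. by move=> hx hy; apply: uabsD_le; rewrite ?uabsN. Qed.

Lemma uabs_dom x y : uabs y < uabs x :> R -> uabs (x + y) = uabs x :> R.
Proof.
move=> yx; apply/eqP; rewrite eq_le; apply/andP; split.
  by apply: uabsD_le => //; apply: ltW.
rewrite leNgt; apply/negP => h.
have := uabsB (x + y) y; rewrite addrK le_max => /orP[|].
  by rewrite leNgt h.
by rewrite leNgt yx.
Qed.

Lemma uabs_sum_le (e : R) (I : Type) (s : seq I) (P : pred I) (g : I -> C) :
  0 <= e -> (forall i, P i -> uabs (g i) <= e) -> uabs (\sum_(i <- s | P i) g i) <= e.
Proof.
move=> e0 h; elim/big_ind: _ => //; first by rewrite uabs0.
exact: uabsD_le.
Qed.

Lemma ucvgP u x : ucvg u x <->
  forall e : R, 0 < e -> exists N, forall n, (N <= n)%N -> uabs (u n - x) < e.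
Proof. exact: (tate_condP (fun n => u n - x)). Qed.

Lemma tends0P (rho : R) u : 0 <= rho -> tends0 rho u <->
  forall e : R, 0 < e -> exists N, forall n, (N <= n)%N -> uabs (u n) * rho ^+ n < e.
Proof.
move=> rho0; have h n : `|uabs (u n) * rho ^+ n| = uabs (u n) * rho ^+ n.
  by rewrite ger0_norm// mulr_ge0 ?uabs_ge0 ?exprn_ge0.
split=> [/cvgr0Pnorm_lt hh e /hh [N _ hN]|hh].
  by exists N => n /hN /=; rewrite h.
apply/cvgr0Pnorm_lt => e /hh [N hN]; exists N => // n /= /hN.
by rewrite h.
Qed.

Lemma le_eps (x : R) : (forall e, 0 < e -> x <= e) -> x <= 0.
Proof.
by move=> h; rewrite leNgt; apply/negP => x0; have := h (x / 2); lra.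
Qed.

Lemma geo_small (k e M : R) : 0 <= k -> k < 1 -> 0 < e -> 0 <= M ->
  exists N, forall n, (N <= n)%N -> M * k ^+ n <= e.
Proof.
move=> k0 k1 e0 M0.
have /cvgr0Pnorm_lt h : ((fun n => k ^+ n : R) @ \oo --> (0 : R))%classic.
  by apply: cvg_expr; rewrite ger0_norm.
have e' : 0 < e / (M + 1) by rewrite divr_gt0 // ltr_wpDl.
have [N _ hN] := h _ e'; exists N => n /hN /=.
rewrite ger0_norm ?exprn_ge0// => kn.
have M1 : 0 < M + 1 by rewrite ltr_wpDl.
apply: (@le_trans _ _ ((M + 1) * k ^+ n)).
  by rewrite ler_wpM2r ?exprn_ge0// lerDl.
by rewrite mulrC -ler_pdivlMr// ltW.
Qed.

End Basic.

(* B M x stands for |x| <= M. Balls make sense for the Gauss norm on a disc of radius >= 1,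
   which is infinite on part of the Tate algebra. *)
Record ultra_ball (R : realType) (A : comNzRingType) (B : R -> A -> Prop) : Prop :=
  UltraBall {
  ballD : forall M x y, B M x -> B M y -> B M (x + y);
  ballN : forall M x, B M x -> B M (- x);
  ballM : forall M M' x y, B M x -> B M' y -> B (M * M') (x * y);
  ball1 : B 1 1;
  ball0 : forall M, 0 <= M -> B M 0;
  ballW : forall M M' x, M <= M' -> B M x -> B M' x;
  ball_ge0 : forall M x, B M x -> 0 <= M;
  ball_sep : forall x, (forall e, 0 < e -> B e x) -> x = 0;
  ball_cpl : forall u : nat -> A,
    (forall e, 0 < e -> exists N, forall n, (N <= n)%N -> B e (u n.+1 - u n)) ->
    exists g, forall e, 0 < e -> exists N, forall n, (N <= n)%N -> B e (u n - g) }.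

Definition blim (R : realType) (A : comNzRingType) (B : R -> A -> Prop)
    (u : nat -> A) (g : A) : Prop :=
  forall e, 0 < e -> exists N, forall n, (N <= n)%N -> B e (u n - g).

Definition bbounded (R : realType) (A : comNzRingType) (B : R -> A -> Prop)
    (u : nat -> A) : Prop := exists M, forall n, B M (u n).

Section Ball.
Context (R : realType) (A : comNzRingType) (B : R -> A -> Prop).
Hypothesis UB : ultra_ball B.
Implicit Types (u v : nat -> A) (x y g h : A).

Lemma ballB M x y : B M x -> B M y -> B M (x - y).
Proof. by move=> hx hy; apply: (ballD UB) => //; apply: (ballN UB). Qed.

Lemma ball_sum M (I : Type) (s : seq I) (P : pred I) (g : I -> A) : 0 <= M ->
  (forall i, P i -> B M (g i)) -> B M (\sum_(i <- s | P i) g i).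
Proof.
move=> M0 h; elim/big_ind: _ => //; first exact: (ball0 UB).
exact: (ballD UB).
Qed.

Lemma ballX M x n : B M x -> B (M ^+ n) (x ^+ n).
Proof.
move=> h; elim: n => [|n IH]; first by rewrite !expr0; apply: ball1.
by rewrite !exprS; apply: ballM.
Qed.

Lemma ball_prod (I : Type) (s : seq I) (P : pred I) (g : I -> A) :
  (forall i, P i -> B 1 (g i)) -> B 1 (\prod_(i <- s | P i) g i).
Proof.
move=> h; elim/big_ind: _ => //; first exact: (ball1 UB).
by move=> x y hx hy; have := ballM UB hx hy; rewrite mulr1.
Qed.

Lemma ballXW k x n : B k x -> k <= 1 -> B 1 (x ^+ n).
Proof.
move=> h k1; apply: (ballW UB) (ballX n h).
by rewrite exprn_ile1 // (ball_ge0 UB h).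
Qed.

Lemma blim_uniq u g h : blim B u g -> blim B u h -> g = h.
Proof.
move=> ug uh; apply/eqP; rewrite -subr_eq0; apply/eqP/(ball_sep UB) => e e0.
have [[N hN] [N' hN']] := (ug _ e0, uh _ e0).
have := ballB (hN' _ (leq_maxr N N')) (hN _ (leq_maxl N N')).
suff -> : u (maxn N N') - h - (u (maxn N N') - g) = g - h by [].
by ring.
Qed.

Lemma blim_cst g : blim B (fun=> g) g.
Proof. by move=> e e0; exists 0%N => n _; rewrite subrr; apply: (ball0 UB); apply: ltW. Qed.

Lemma blim_eventually u v g N : (forall n, (N <= n)%N -> u n = v n) ->
  blim B u g -> blim B v g.
Proof.
move=> uv h e e0; have [N' hN'] := h _ e0; exists (maxn N N') => n.
by rewrite geq_max => /andP[n1 n2]; rewrite -uv//; apply: hN'.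
Qed.

Lemma blim_eq u v g : u =1 v -> blim B u g -> blim B v g.
Proof. by move=> uv; apply: (@blim_eventually _ _ _ 0) => n _. Qed.

Lemma blim_shift u g k : blim B u g -> blim B (fun n => u (n + k)%N) g.
Proof.
move=> h e e0; have [N hN] := h _ e0; exists N => n nN.
by apply: hN; apply: leq_trans nN (leq_addr _ _).
Qed.

Lemma blim_unshift u g : blim B (fun n => u n.+1) g -> blim B u g.
Proof.
move=> h e e0; have [N hN] := h _ e0; exists N.+1 => -[//|n]; rewrite ltnS.
exact: hN.
Qed.

Lemma blimD u v g h : blim B u g -> blim B v h -> blim B (fun n => u n + v n) (g + h).
Proof.
move=> ug vh e e0; have [[N hN] [N' hN']] := (ug _ e0, vh _ e0).
exists (maxn N N') => n; rewrite geq_max => /andP[/hN n1 /hN' n2].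
by rewrite opprD addrACA; apply: (ballD UB).
Qed.

Lemma blimN u g : blim B u g -> blim B (fun n => - u n) (- g).
Proof.
move=> ug e e0; have [N hN] := ug _ e0; exists N => n /hN h.
by rewrite -opprD; apply: (ballN UB).
Qed.

Lemma blimB u v g h : blim B u g -> blim B v h -> blim B (fun n => u n - v n) (g - h).
Proof. by move=> ug /blimN; apply: blimD. Qed.

Lemma blim_bnd0 u v : blim B u 0 -> bbounded B v -> blim B (fun n => u n * v n) 0.
Proof.
move=> ug [M hM] e e0.
have M0 : 0 <= M by apply: (ball_ge0 UB (hM 0%N)).
have M1 : 0 < M + 1 by lra.
have [N hN] := ug _ (divr_gt0 e0 M1); exists N => n /hN; rewrite !subr0 => h.
apply: (ballW UB) (ballM UB h (hM n)).
by rewrite mulrAC ler_pdivrMr // ler_pM2l //; lra.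
Qed.

Lemma blim_closed u g M : 0 < M -> (forall n, B M (u n)) -> blim B u g -> B M g.
Proof.
move=> M0 h ug; have [N hN] := ug _ M0.
have -> : g = u N - (u N - g) by ring.
by apply: ballB => //; apply: hN.
Qed.

(** Boundedness is asked of the whole sequence [u]: where the norm can be infinite, the first terms
    of a convergent sequence may lie in no ball. *)
Lemma blimM u v g h : bbounded B u -> (exists M, B M h) ->
  blim B u g -> blim B v h -> blim B (fun n => u n * v n) (g * h).
Proof.
move=> bu [M bh] ug vh.
have l1 : blim B (fun n => (u n - g) * h) 0.
  apply: (@blim_bnd0 _ (fun=> h)); last by exists M.
  by have := blimB ug (blim_cst g); rewrite subrr.
have l2 : blim B (fun n => (v n - h) * u n) 0.
  apply: blim_bnd0 => //.
  by have := blimB vh (blim_cst h); rewrite subrr.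
have := blimD (blimD l1 l2) (blim_cst (g * h)).
rewrite !add0r; apply: blim_eq => n; ring.
Qed.

(** The inverse is the geometric series in [x]. *)
Lemma ball_geo_inv (k : R) x : k < 1 -> B k x ->
  exists h, (1 - x) * h = 1 /\ B k (h - 1).
Proof.
move=> k1 bx; have k0 := ball_ge0 UB bx.
pose S n := \sum_(i < n) x ^+ i.
have [h hh] : exists g, blim B S g.
  apply: (ball_cpl UB) => e e0; have [N hN] := geo_small k0 k1 e0 ler01.
  exists N => n /hN kn; rewrite /S big_ord_recr /= addrAC subrr add0r.
  by apply: (ballW UB) (ballX n bx); rewrite -[X in X <= _]mul1r.
exists h; split.
  have l : blim B (fun n => (1 - x) * S n) ((1 - x) * h).
    rewrite mulrC; apply: (@blim_eq (fun n => S n * (1 - x))).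
      by move=> n; rewrite mulrC.
    apply: blimM => //; last exact: blim_cst.
      exists 1 => n; apply: ball_sum => // i _; apply: ballXW bx _; exact: ltW.
    exists 1; apply: ballB; first exact: (ball1 UB).
    by apply: (ballW UB) bx; apply: ltW.
  apply: blim_uniq l _ => e e0; have [N hN] := geo_small k0 k1 e0 ler01.
  exists N => n /hN kn.
  have -> : (1 - x) * S n - 1 = - x ^+ n.
    have -> : (1 - x) * S n = - (x ^+ n - 1) by rewrite subrX1 -mulNr opprB.
    by rewrite opprB addrAC subrr add0r.
  by apply: (ballN UB); apply: (ballW UB) (ballX n bx); rewrite -[X in X <= _]mul1r.
have /(blim_closed _) : blim B (fun n => S n.+1 - 1) (h - 1).
  apply: blimB; last exact: blim_cst.
  by have := blim_shift 1 hh; apply: blim_eq => n; rewrite addn1.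
have bS n : B k (S n.+1 - 1).
  rewrite /S big_ord_recl expr0 addrAC subrr add0r; apply: ball_sum => // i _.
  rewrite /= exprS -[k]mulr1; apply: (ballM UB) => //.
  by apply: ballXW bx _; apply: ltW.
(* [blim_closed] wants a positive radius; for k = 0 every [S n.+1] equals 1, and so does the
   limit. *)
move: k0; rewrite le_eqVlt => /predU1P[k0 _|]; last by move=> k0; apply.
move: (bS); rewrite -k0 => bS0.
suff -> : h - 1 = 0 by apply: (ball0 UB).
have S1 n : S n.+1 = 1.
  apply/eqP; rewrite -subr_eq0; apply/eqP/(ball_sep UB) => e e0.
  by apply: (ballW UB) (bS0 n); apply: ltW.
apply/eqP; rewrite subr_eq0; apply/eqP/(blim_uniq (blim_shift 1 hh)).
by apply: (@blim_eq (fun=> 1)); [move=> n; rewrite addn1 S1|exact: blim_cst].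
Qed.

(** Successive partial products differ by [P n * e n], which tends to 0 because [P n] stays in the
    unit ball; ultrametrically this is enough for convergence. *)
Lemma ball_inf_prod (k : R) (e : nat -> A) : 0 <= k -> k < 1 ->
  (forall i, B (k ^+ i.+1) (e i)) ->
  exists2 g, blim B (fun n => \prod_(i < n) (1 + e i)) g &
    B k (g - 1) /\ forall n, B 1 (\prod_(i < n) (1 + e i)).
Proof.
move=> k0 k1 be; pose P n := \prod_(i < n) (1 + e i).
have bek i : B k (e i).
  apply: (ballW UB) (be i); rewrite exprS ler_piMr// exprn_ile1// ltW//.
have b1 n : B 1 (P n).
  apply: ball_prod => i _; apply: (ballD UB); first exact: (ball1 UB).
  by apply: (ballW UB) (bek i); apply: ltW.
have PS n : P n.+1 - P n = P n * e n by rewrite /P big_ord_recr /=; ring.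
have bP1 n : B k (P n - 1).
  elim: n => [|n IH]; first by rewrite /P big_ord0 subrr; apply: (ball0 UB).
  have -> : P n.+1 - 1 = (P n.+1 - P n) + (P n - 1) by ring.
  by apply: (ballD UB) => //; rewrite PS -[k]mul1r; apply: (ballM UB).
have [g hg] : exists g, blim B P g.
  apply: (ball_cpl UB) => d d0; have [N hN] := geo_small k0 k1 d0 k0.
  exists N => n /hN kn; rewrite PS; apply: (ballW UB kn).
  by rewrite -exprS -[_ ^+ _]mul1r; apply: (ballM UB).
exists g => //; split => //.
have l := blimB hg (blim_cst 1).
have [N hN] := l 1 ltr01.
case: (ltrgtP 0 k) k0 => // [k0 _|k0 _]; first exact: blim_closed l.
have P1 n : P n = 1.
  apply/eqP; rewrite -subr_eq0; apply/eqP/(ball_sep UB) => d d0.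
  by apply: (ballW UB) (bP1 n); rewrite -k0; apply: ltW.
have -> : g = 1 by apply: (blim_uniq hg); apply: blim_eq (blim_cst 1) => n; rewrite P1.
by rewrite subrr; apply: (ball0 UB); rewrite -k0.
Qed.

(* z |-> e + b z + c z ^ 2 is a contraction of the ball of radius k *)
Lemma ball_quadratic_fixpoint (k M : R) e b c : 0 < k -> k < 1 -> M * k < 1 ->
  B k e -> B k b -> B M c -> exists2 z, B k z & z = e + b * z + c * z ^+ 2.
Proof.
move=> k0 k1 Mk be bb bc; have M0 := ball_ge0 UB bc.
pose phi z := e + b * z + c * z ^+ 2.
pose l := Num.max k (M * k).
have l0 : 0 <= l by rewrite le_max ltW.
have l1 : l < 1 by rewrite gt_max k1.
have bphi z : B k z -> B k (phi z).
  move=> bz; apply: (ballD UB); first apply: (ballD UB) => //.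
    by apply: (ballW UB) (ballM UB bb bz); rewrite ler_piMr// ltW.
  apply: (ballW UB) (ballM UB bc (ballX 2 bz)).
  by rewrite expr2 mulrA ler_piMl// ltW.
have lip K z z' : B k z -> B k z' -> B K (z - z') -> B (l * K) (phi z - phi z').
  move=> bz bz' bd.
  have -> : phi z - phi z' = (b + c * (z + z')) * (z - z') by rewrite /phi; ring.
  apply: (ballM UB) => //; apply: (ballD UB).
    by apply: (ballW UB) bb; rewrite le_max lexx.
  have bzz : B k (z + z') by apply: (ballD UB).
  by apply: (ballW UB) (ballM UB bc bzz); rewrite le_max lexx orbT.
pose z n := iter n phi 0.
have bz n : B k (z n) by elim: n => [|n IH]; [apply: (ball0 UB); apply: ltW|apply: bphi].
have bd n : B (l ^+ n * k) (z n.+1 - z n).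
  elim: n => [|n IH]; first by rewrite expr0 mul1r subr0.
  by rewrite exprS -mulrA; exact: lip (bz n.+1) (bz n) IH.
have [g hg] : exists g, blim B z g.
  apply: (ball_cpl UB) => d d0; have [N hN] := geo_small l0 l1 d0 (ltW k0).
  by exists N => n /hN kn; apply: (ballW UB kn); rewrite mulrC.
have bg : B k g by apply: blim_closed hg.
exists g => //.
suff lim_phi : blim B (fun n => z (n + 1)%N) (phi g).
  exact: blim_uniq (blim_shift 1 hg) lim_phi.
move=> d d0; have [N hN] := hg _ d0.
exists N => n /hN h; rewrite addn1 /=.
by apply: (ballW UB) (lip _ _ _ (bz n) bg h); rewrite ler_piMl// ltW.
Qed.

End Ball.

(** * Tate algebras *)

Definition ucomplete (R : realType) (C : ultraFieldType R) : Prop :=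
  forall u : nat -> C, ucauchy u -> exists x, ucvg u x.

Definition uball (R : realType) (C : ultraFieldType R) (M : R) (x : C) : Prop :=
  uabs x <= M.

Definition nb (R : realType) (C : ultraFieldType R) (r M : R) (f : tate C) : Prop :=
  forall n, uabs (f n) * r ^+ n <= M.

Section TateBall.
Context (R : realType) (C : ultraFieldType R).
Hypothesis cpl : ucomplete C.
Notation T := (tate C).
Implicit Types (f g h : T) (x y : C).

(** By the ultrametric inequality small consecutive differences already bound [u m - u n]. *)
Lemma cauchy_step (u : nat -> C) :
  (forall e : R, 0 < e -> exists N, forall n, (N <= n)%N -> uabs (u n.+1 - u n) <= e) ->
  ucauchy u.
Proof.
move=> h e e0; have e2 : 0 < e / 2 by lra.
have [N hN] := h _ e2; exists N.
have hk k : uabs (u (N + k)%N - u N) <= e / 2.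
  elim: k => [|k IH]; first by rewrite addn0 subrr uabs0 ltW.
  have -> : u (N + k.+1)%N - u N = (u (N + k).+1 - u (N + k)%N) + (u (N + k)%N - u N).
    by rewrite addnS; ring.
  by apply: uabsD_le => //; apply: hN; apply: leq_addr.
move=> m n /subnKC <- /subnKC <-.
have -> : u (N + (m - N))%N - u (N + (n - N))%N =
   (u (N + (m - N))%N - u N) - (u (N + (n - N))%N - u N) by ring.
by apply: le_lt_trans (uabsB_le (hk _) (hk _)) _; lra.
Qed.

Lemma uball_ultra : ultra_ball (@uball R C).
Proof.
split; rewrite /uball.
- by move=> M x y; apply: uabsD_le.
- by move=> M x; rewrite uabsN.
- by move=> M M' x y hx hy; rewrite uabsM ler_pM ?uabs_ge0.
- by rewrite uabs1.
- by move=> M; rewrite uabs0.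
- by move=> M M' x MM' hx; apply: le_trans MM'.
- by move=> M x; apply: le_trans; apply: uabs_ge0.
- move=> x h; apply/eqP; rewrite -(uabs_eq0 (s:=C)) eq_le uabs_ge0 andbT.
  exact: le_eps.
- move=> u /cauchy_step /cpl [x /ucvgP hx]; exists x => e /hx [N hN].
  by exists N => n /hN /ltW.
Qed.

Lemma blim_ucvg (u : nat -> C) x : blim (@uball R C) u x <-> ucvg u x.
Proof.
split=> [h|/ucvgP h e e0].
  apply/ucvgP => e e0; have e2 : 0 < e / 2 by lra.
  by have [N hN] := h _ e2; exists N => n /hN hn; apply: le_lt_trans hn _; lra.
by have [N hN] := h _ e0; exists N => n /hN /ltW.
Qed.

Lemma tateDE f g n : (f + g) n = f n + g n. Proof. by []. Qed.
Lemma tateNE f n : (- f) n = - f n. Proof. by []. Qed.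
Lemma tateBE f g n : (f - g) n = f n - g n. Proof. by []. Qed.
Lemma tateME f g n : (f * g) n = \sum_(i < n.+1) f i * g (n - i)%N.
Proof. by []. Qed.
Lemma tate0E n : (0 : T) n = 0. Proof. by rewrite /= if_same. Qed.
Lemma tate1E n : (1 : T) n = (n == 0%N)%:R.
Proof. by rewrite /=; case: (n == 0%N). Qed.

Lemma tate_bounded f : exists2 M : R, 0 < M & nb 1 M f.
Proof.
have [M M0 hM] := tate_cond_bounded (tateP f).
by exists M => // n; rewrite expr1n mulr1.
Qed.

Section Radius.
Variables (r : R) (r1 : 1 <= r).
Let r0 : 0 < r. Proof. exact: lt_le_trans ltr01 r1. Qed.
Let rn0 n : 0 < r ^+ n. Proof. exact: exprn_gt0. Qed.

Lemma nb_mul M M' f g : nb r M f -> nb r M' g -> nb r (M * M') (f * g).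
Proof.
move=> hf hg n; rewrite -ler_pdivlMr// tateME.
have M0 : 0 <= M by apply: le_trans (hf 0%N); rewrite mulr_ge0 ?uabs_ge0// ltW.
have M0' : 0 <= M' by apply: le_trans (hg 0%N); rewrite mulr_ge0 ?uabs_ge0// ltW.
apply: uabs_sum_le => [|[i /= ilt] _]; first by rewrite divr_ge0 ?mulr_ge0// ltW.
rewrite ler_pdivlMr// uabsM -{2}(@subnKC i n)// exprD mulrACA.
by rewrite ler_pM// mulr_ge0 ?uabs_ge0// ltW.
Qed.

Lemma nb_ultra : ultra_ball (@nb R C r).
Proof.
split.
- move=> M f g hf hg n; rewrite -ler_pdivlMr// tateDE.
  by apply: uabsD_le; rewrite ler_pdivlMr.
- by move=> M f hf n; rewrite tateNE uabsN.
- exact: nb_mul.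
- by move=> n; rewrite tate1E; case: n => [|n]; rewrite ?uabs1 ?uabs0 ?mul0r ?mulr1.
- by move=> M M0 n; rewrite tate0E uabs0 mul0r.
- by move=> M M' f MM' hf n; apply: le_trans MM'.
- by move=> M f hf; apply: le_trans (hf 0%N); rewrite mulr_ge0 ?uabs_ge0// ltW.
- move=> f h; apply: tate_eq => n; rewrite tate0E.
  apply/eqP; rewrite -(uabs_eq0 (s:=C)) eq_le uabs_ge0 andbT.
  suff : uabs (f n) * r ^+ n <= 0 by rewrite pmulr_lle0.
  by apply: le_eps => e /h.
- move=> u hu.
  have le1 e x n : uabs x * r ^+ n <= e -> uabs x <= e :> R.
    by apply: le_trans; rewrite ler_peMr ?uabs_ge0 ?exprn_ege1.
  have hc n : exists x, ucvg (fun k => u k n) x.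
    apply: cpl; apply: cauchy_step => e /hu [N hN]; exists N => k /hN /(_ n).
    by rewrite tateBE => /le1.
  pose c n := projT1 (cid (hc n)).
  have cP n : ucvg (fun k => u k n) (c n) by rewrite /c; case: cid.
  (* The estimate for consecutive terms passes to the coefficientwise limit uniformly in n; this
     makes the limit a Tate series and the convergence one in norm. *)
  have close e : 0 < e -> exists N, forall k, (N <= k)%N ->
      forall n, uabs (u k n - c n) * r ^+ n <= e.
    move=> e0; have [N hN] := hu _ e0; exists N => k Nk n.
    rewrite -ler_pdivlMr//; have e1 : 0 < e / r ^+ n by rewrite divr_gt0.
    have /ucvgP/(_ _ e1) [N' hN'] := cP n.
    have kd j : uabs (u (k + j)%N n - u k n) <= e / r ^+ n.
      elim: j => [|j IH]; first by rewrite addn0 subrr uabs0 ltW.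
      have -> : u (k + j.+1)%N n - u k n =
        (u (k + j).+1 n - u (k + j)%N n) + (u (k + j)%N n - u k n).
        by rewrite addnS; ring.
      apply: uabsD_le => //; rewrite ler_pdivlMr// -tateBE.
      by apply: hN; apply: leq_trans Nk _; apply: leq_addr.
    have -> : u k n - c n = (u (k + N')%N n - c n) - (u (k + N')%N n - u k n) by ring.
    by apply: uabsB_le => //; apply/ltW/hN'; apply: leq_addl.
  have ct : tate_cond c.
    apply/tate_condP => e e0; have e2 : 0 < e / 2 by lra.
    have [N /(_ N (leqnn N)) hN] := close _ e2.
    have /tate_condP/(_ _ e0) [N' hN'] := tateP (u N).
    exists N' => n nN'.
    have -> : c n = u N n - (u N n - c n) by ring.
    apply: le_lt_trans (uabsB _ _) _; rewrite gt_max hN'//=.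
    by apply: le_lt_trans (le1 _ _ _ (hN n)) _; lra.
  exists (Tate ct) => e /close [N hN]; exists N => k /hN h n.
  by rewrite tateBE.
Qed.

Lemma nb_cst M x : uabs x <= M -> nb r M (tate_cst x).
Proof.
move=> xM [|n]; first by rewrite mulr1.
by rewrite /= uabs0 mul0r; apply: le_trans xM; apply: uabs_ge0.
Qed.

Lemma nb_var : nb r r (tate_var : T).
Proof.
by move=> [|[|n]]; rewrite /= ?uabs0 ?uabs1 ?mul0r ?mul1r ?expr1// ltW.
Qed.

(** The decay comes from (r' / r) ^ n. *)
Lemma nb_tends0 r' M f : 0 <= r' -> r' < r -> nb r M f -> tends0 r' f.
Proof.
move=> r'0 r'r hf; apply/tends0P => // e e0.
have M0 := ball_ge0 nb_ultra hf.
have k0 : 0 <= r' / r by rewrite divr_ge0// ltW.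
have k1 : r' / r < 1 by rewrite ltr_pdivrMr// mul1r.
have e2 : 0 < e / 2 by lra.
have [N hN] := geo_small k0 k1 e2 M0; exists N => n /hN h.
apply: (@le_lt_trans _ _ (e / 2)); last by lra.
apply: le_trans h; rewrite expr_div_n mulrA ler_pdivlMr// mulrAC.
by rewrite ler_wpM2r// exprn_ge0.
Qed.

Lemma nb_le r' M f : 0 <= r' -> r' <= r -> nb r M f -> nb r' M f.
Proof.
move=> r'0 r'r hf n; apply: le_trans (hf n).
by rewrite ler_wpM2l ?uabs_ge0// lerXn2r// nnegrE// ltW.
Qed.

End Radius.

Lemma tends0_bounded (r : R) (u : nat -> C) : 0 <= r -> tends0 r u ->
  exists2 M : R, 0 < M & forall n, uabs (u n) * r ^+ n <= M.
Proof.
move=> r0 /(tends0P _ r0) /(_ 1 ltr01) [N hN].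
suff [M M0 hM] : exists2 M : R, 0 < M & forall n, (n < N)%N -> uabs (u n) * r ^+ n <= M.
  exists (Num.max M 1) => [|n]; first by rewrite lt_max M0.
  by rewrite le_max; case: (ltnP n N) => [/hM ->|/hN /ltW ->]; rewrite ?orbT.
elim: N {hN} => [|N [M M0 hM]]; first by exists 1.
exists (Num.max M (uabs (u N) * r ^+ N)) => [|n]; first by rewrite lt_max M0.
by rewrite ltnS leq_eqVlt le_max => /predU1P[->|/hM ->//]; rewrite lexx orbT.
Qed.

Lemma gauss_normP (M : R) f : 0 <= M -> gauss_norm f <= M <-> nb 1 M f.
Proof.
move=> M0; have [K _ hK] := tate_bounded f.
split=> [h n|h].
  rewrite expr1n mulr1; apply: le_trans h; apply: ub_le_sup; last by exists n.
  by exists K => _ [k _ <-]; have := hK k; rewrite expr1n mulr1.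
apply: ge_sup; first by exists (uabs (f 0%N)), 0%N.
by move=> _ [k _ <-]; have := h k; rewrite expr1n mulr1.
Qed.

Lemma tate_poly_subproof (p : {poly C}) : tate_cond (fun n => p`_n).
Proof. by apply: (@tate_cond_fin _ _ _ (size p)) => n; apply: nth_default. Qed.

Definition tate_poly (p : {poly C}) : T := Tate (tate_poly_subproof p).

Lemma tate_polyM p q : tate_poly (p * q) = tate_poly p * tate_poly q.
Proof. by apply: tate_eq => n; rewrite /= coefM. Qed.

Lemma tate_polyC x : tate_poly x%:P = tate_cst x.
Proof. by apply: tate_eq => n; rewrite /= coefC. Qed.

Lemma tate_polyX : tate_poly 'X = tate_var.
Proof. by apply: tate_eq => n; rewrite /= coefX; case: eqP. Qed.

Fact tate_poly_zmod : zmod_morphism tate_poly.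
Proof. by move=> p q; apply: tate_eq => n; rewrite /= coefB. Qed.
Fact tate_poly_monoid : monoid_morphism tate_poly.
Proof. by split; [rewrite tate_polyC|exact: tate_polyM]. Qed.
HB.instance Definition _ := GRing.isZmodMorphism.Build _ _ tate_poly tate_poly_zmod.
HB.instance Definition _ := GRing.isMonoidMorphism.Build _ _ tate_poly tate_poly_monoid.

Fact tate_cst_zmod : zmod_morphism (@tate_cst R C).
Proof. by move=> x y; rewrite -!tate_polyC polyCB rmorphB. Qed.
Fact tate_cst_monoid : monoid_morphism (@tate_cst R C).
Proof. by split => // x y; rewrite -!tate_polyC polyCM rmorphM. Qed.
HB.instance Definition _ := GRing.isZmodMorphism.Build _ _ (@tate_cst R C) tate_cst_zmod.
HB.instance Definition _ :=
  GRing.isMonoidMorphism.Build _ _ (@tate_cst R C) tate_cst_monoid.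

End TateBall.

(** * Tate series as limits of polynomials *)

Section Trunc.
Context (R : realType) (C : ultraFieldType R).
Hypothesis cpl : ucomplete C.
Notation T := (tate C).
Implicit Types (f g h : T) (x y : C).

Definition trunc n f : {poly C} := \poly_(i < n) f i.

Section Radius.
Variables (r : R) (r1 : 1 <= r).
Let r0 : 0 <= r. Proof. exact: le_trans ler01 r1. Qed.
Let UT := nb_ultra cpl r1.

Lemma trunc_lim f : tends0 r f ->
  blim (@nb R C r) (fun n => tate_poly (trunc n f)) f.
Proof.
move=> /(tends0P _ r0) h e e0; have [N hN] := h _ e0; exists N => n Nn k.
rewrite tateBE /= coef_poly; case: ltnP => kn.
  by rewrite subrr uabs0 mul0r ltW.
by rewrite sub0r uabsN; apply/ltW/hN/(leq_trans Nn kn).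
Qed.

(** Beyond the degree of a polynomial close to f, the coefficients of f are those of the difference.
    Closure of convergence under sums and products is deduced from this. *)
Lemma poly_approx_tends0 (p : nat -> {poly C}) f :
  blim (@nb R C r) (fun n => tate_poly (p n)) f -> tends0 r f.
Proof.
move=> h; apply/tends0P => // e e0; have e2 : 0 < e / 2 by lra.
have [N /(_ N (leqnn N)) hN] := h _ e2; exists (size (p N)) => n pn.
have := hN n; rewrite tateBE /= nth_default// sub0r uabsN => hn.
by apply: le_lt_trans hn _; lra.
Qed.

Lemma trunc_bounded f : tends0 r f ->
  bbounded (@nb R C r) (fun n => tate_poly (trunc n f)).
Proof.
move=> /(tends0_bounded r0) [M M0 hM]; exists M => n k.
by rewrite /= coef_poly; case: ltnP => // _; rewrite uabs0 mul0r ltW.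
Qed.

Lemma truncM_lim f g : tends0 r f -> tends0 r g ->
  blim (@nb R C r) (fun n => tate_poly (trunc n f * trunc n g)) (f * g).
Proof.
move=> hf hg; apply: (@blim_eq _ _ _ (fun n => tate_poly (trunc n f) * tate_poly (trunc n g))).
  by move=> n; rewrite rmorphM.
apply: (blimM UT); [exact: trunc_bounded| |exact: trunc_lim|exact: trunc_lim].
by have [M _ hM] := tends0_bounded r0 hg; exists M.
Qed.

Lemma truncD_lim f g : tends0 r f -> tends0 r g ->
  blim (@nb R C r) (fun n => tate_poly (trunc n f + trunc n g)) (f + g).
Proof.
move=> hf hg; apply: (@blim_eq _ _ _ (fun n => tate_poly (trunc n f) + tate_poly (trunc n g))).
  by move=> n; rewrite rmorphD.
by apply: (blimD UT); apply: trunc_lim.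
Qed.

Lemma tends0M f g : tends0 r f -> tends0 r g -> tends0 r (f * g).
Proof. by move=> hf hg; apply: poly_approx_tends0 (truncM_lim hf hg). Qed.

Lemma tends0D f g : tends0 r f -> tends0 r g -> tends0 r (f + g).
Proof. by move=> hf hg; apply: poly_approx_tends0 (truncD_lim hf hg). Qed.

Lemma tends0N f : tends0 r f -> tends0 r (- f).
Proof.
move=> /(tends0P _ r0) h; apply/tends0P => // e /h [N hN].
by exists N => n /hN; rewrite tateNE uabsN.
Qed.

Lemma tends0_poly (p : {poly C}) : tends0 r (tate_poly p).
Proof.
apply: (@poly_approx_tends0 (fun=> p)); exact: (blim_cst UT).
Qed.

Lemma tends0_cst x : tends0 r (tate_cst x).
Proof. by rewrite -tate_polyC; apply: tends0_poly. Qed.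

Lemma tends0_var : tends0 r (tate_var : T).
Proof. by rewrite -tate_polyX; apply: tends0_poly. Qed.

Lemma tends0W r' f : 0 <= r' -> r' <= r -> tends0 r f -> tends0 r' f.
Proof.
move=> r'0 r'r /(tends0P _ r0) h; apply/tends0P => // e /h [N hN].
exists N => n /hN; apply: le_lt_trans.
by rewrite ler_wpM2l ?uabs_ge0// lerXn2r// nnegrE.
Qed.

End Radius.

Lemma tends0_1 f : tends0 1 f.
Proof.
apply/tends0P => // e e0; have /tate_condP/(_ _ e0) [N hN] := tateP f.
by exists N => n /hN; rewrite expr1n mulr1.
Qed.

End Trunc.

(** * Evaluation and substitution *)

Section Eval.
Context (R : realType) (C : ultraFieldType R).
Hypothesis cpl : ucomplete C.
Notation T := (tate C).
Context (A : comNzRingType) (B : R -> A -> Prop) (UB : ultra_ball B).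
Context (j : {rmorphism C -> A}) (Bj : forall c, B (uabs c) (j c)).
Implicit Types (f g h : T) (x y : C) (w : A) (p : {poly C}).

Definition hev p w : A := (map_poly j p).[w].

Definition is_ev f w (a : A) : Prop := blim B (fun n => hev (trunc n f) w) a.

(* f(w) for w in any complete normed C-algebra A: evaluation at points when A = C,
   substitution of power series when A is the Tate algebra *)
Definition ev f w : A := xget 0 [set a | is_ev f w a]%classic.

Lemma hevD p q w : hev (p + q) w = hev p w + hev q w.
Proof. by rewrite /hev rmorphD hornerD. Qed.
Lemma hevB p q w : hev (p - q) w = hev p w - hev q w.
Proof. by rewrite /hev rmorphB hornerD hornerN. Qed.
Lemma hevM p q w : hev (p * q) w = hev p w * hev q w.
Proof. by rewrite /hev rmorphM hornerM. Qed.
Lemma hevC x w : hev x%:P w = j x.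
Proof. by rewrite /hev map_polyC hornerC. Qed.
Lemma hevX w : hev 'X w = w.
Proof. by rewrite /hev map_polyX hornerX. Qed.

Section Radius.
Variables (r : R) (r1 : 1 <= r).
Let r0 : 0 <= r. Proof. exact: le_trans ler01 r1. Qed.
Let UT := nb_ultra cpl r1.

Lemma hev_bound p w M : 0 <= M -> B r w -> nb r M (tate_poly p) -> B M (hev p w).
Proof.
move=> M0 bw h; rewrite /hev (@horner_coef_wide _ (size p)) ?size_map_poly//.
apply: (ball_sum UB) => // i _; rewrite coef_map.
by apply: (ballW UB) (ballM UB (Bj _) (ballX UB i bw)); apply: h.
Qed.

Lemma hev_null (p : nat -> {poly C}) w : B r w ->
  blim (@nb R C r) (fun n => tate_poly (p n)) 0 -> blim B (fun n => hev (p n) w) 0.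
Proof.
move=> bw h e e0; have [N hN] := h _ e0; exists N => n /hN; rewrite !subr0.
by apply: hev_bound => //; apply: ltW.
Qed.

Lemma is_ev_ex f w : tends0 r f -> B r w -> exists a, is_ev f w a.
Proof.
move=> hf bw; apply: (ball_cpl UB) => e e0.
have := blimB UT (blim_shift 1 (trunc_lim r1 hf)) (trunc_lim r1 hf).
rewrite subrr => /(_ _ e0) [N hN]; exists N => n /hN.
rewrite subr0 addn1 -rmorphB -hevB; exact: hev_bound (ltW e0) bw.
Qed.

Lemma evP f w : tends0 r f -> B r w -> is_ev f w (ev f w).
Proof. by move=> hf bw; have [a ha] := is_ev_ex hf bw; apply: xgetPex; exists a. Qed.

(** [ev] is defined by truncations, but a product of truncations is not a truncation of the product;
    hence the freedom to use any approximating polynomials. *)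
Lemma ev_lim f w (p : nat -> {poly C}) : tends0 r f -> B r w ->
  blim (@nb R C r) (fun n => tate_poly (p n)) f -> blim B (fun n => hev (p n) w) (ev f w).
Proof.
move=> hf bw hp.
have l1 : blim B (fun n => hev (p n - trunc n f) w) 0.
  apply: hev_null => //.
  have := blimB UT hp (trunc_lim r1 hf).
  by rewrite subrr; apply: blim_eq => n; rewrite rmorphB.
have := blimD UB l1 (evP hf bw); rewrite add0r.
by apply: blim_eq => n; rewrite hevB subrK.
Qed.

Lemma ev_poly p w : B r w -> ev (tate_poly p) w = hev p w.
Proof.
move=> bw; apply: (blim_uniq UB) (blim_cst UB _).
by apply: (ev_lim (p := fun=> p)) (blim_cst UT _); first exact: tends0_poly.
Qed.

Lemma evD f g w : tends0 r f -> tends0 r g -> B r w -> ev (f + g) w = ev f w + ev g w.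
Proof.
move=> hf hg bw; apply: (blim_uniq UB (ev_lim _ bw (truncD_lim cpl r1 hf hg))).
  exact: tends0D.
have := blimD UB (evP hf bw) (evP hg bw).
by apply: blim_eq => n; rewrite hevD.
Qed.

Lemma ev_bound f w M : 0 < M -> nb r M f -> tends0 r f -> B r w -> B M (ev f w).
Proof.
move=> M0 fM hf bw; apply: (blim_closed UB M0 _ (evP hf bw)) => n.
apply: hev_bound => //; first exact: ltW.
by move=> k; rewrite /= coef_poly; case: ltnP => // _; rewrite uabs0 mul0r ltW.
Qed.

Lemma evM f g w : tends0 r f -> tends0 r g -> B r w -> ev (f * g) w = ev f w * ev g w.
Proof.
move=> hf hg bw; apply: (blim_uniq UB (ev_lim _ bw (truncM_lim cpl r1 hf hg))).
  exact: tends0M.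
apply: (@blim_eq _ _ _ (fun n => hev (trunc n f) w * hev (trunc n g) w)).
  by move=> n; rewrite hevM.
have bd (k : T) : tends0 r k -> bbounded B (fun n => hev (trunc n k) w).
  move=> /(trunc_bounded r1) [M hM]; exists M => n.
  by apply: hev_bound => //; exact: (ball_ge0 UT (hM 0%N)).
apply: (blimM UB); [exact: bd| |exact: evP|exact: evP].
have [M M0 hM] := tends0_bounded r0 hg; exists M.
exact: ev_bound.
Qed.

Lemma ev_cst x w : B r w -> ev (tate_cst x) w = j x.
Proof. by move=> bw; rewrite -tate_polyC ev_poly// hevC. Qed.

Lemma ev_var w : B r w -> ev tate_var w = w.
Proof. by move=> bw; rewrite -tate_polyX ev_poly// hevX. Qed.

Lemma evN f w : tends0 r f -> B r w -> ev (- f) w = - ev f w.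
Proof.
move=> hf bw; have -> : - f = tate_cst (-1) * f by rewrite rmorphN1 mulN1r.
rewrite evM//; last exact: tends0_cst.
by rewrite ev_cst// rmorphN1 mulN1r.
Qed.

Lemma ev0 w : B r w -> ev 0 w = 0.
Proof. by move=> bw; rewrite -(rmorph0 (@tate_cst R C)) ev_cst ?rmorph0. Qed.

End Radius.

Lemma ev_cont (u : nat -> T) f w : B 1 w -> blim (@nb R C 1) u f ->
  blim B (fun n => ev (u n) w) (ev f w).
Proof.
move=> bw h e e0; have [N hN] := h _ e0; exists N => n /hN hn.
rewrite -(evN (lexx 1))//; last exact: tends0_1.
rewrite -(evD (lexx 1))//; try exact: tends0_1.
by apply: (ev_bound (lexx 1)) => //; exact: tends0_1.
Qed.

End Eval.

Section Comp.
Context (R : realType) (C : ultraFieldType R).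
Hypothesis cpl : ucomplete C.
Notation T := (tate C).
Context (A : comNzRingType) (B : R -> A -> Prop) (UB : ultra_ball B).
Context (j : {rmorphism C -> A}) (Bj : forall c, B (uabs c) (j c)).

Definition tcomp (f w : T) : T := ev (@nb R C 1) (@tate_cst R C) f w.

Lemma nb1_cst (c : C) : nb 1 (uabs c) (tate_cst c).
Proof. exact: nb_cst. Qed.

(** Clear when f is a polynomial; the general case follows by continuity of evaluation at [v]. *)
Lemma ev_tcomp (r : R) (f w : T) (v : A) : 1 <= r -> tends0 r f -> nb 1 r w -> B 1 v ->
  ev B j (tcomp f w) v = ev B j f (ev B j w v).
Proof.
move=> r1 hf bw bv; have r0 : 0 < r by apply: lt_le_trans r1.
have U1 := nb_ultra cpl (lexx (1 : R)).
have bwv : B r (ev B j w v).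
  by apply: (ev_bound cpl UB Bj (lexx 1)) => //; exact: tends0_1.
have hp (p : {poly C}) : ev B j (hev (@tate_cst R C) p w) v = hev j p (ev B j w v).
  have h1 := @tends0_1 _ C; have l1 := lexx (1 : R).
  elim/poly_ind: p => [|p c IH].
    by rewrite -[0]/(0%:P) !hevC !rmorph0 (ev0 cpl UB Bj l1).
  rewrite !hevD !hevM !hevX !hevC (evD cpl UB Bj l1)// (evM cpl UB Bj l1)// IH.
  by rewrite (ev_cst cpl UB Bj l1).
apply: (blim_uniq UB) (evP cpl UB Bj r1 hf bwv).
have := ev_cont cpl UB Bj bv (evP cpl U1 nb1_cst r1 hf bw).
by apply: blim_eq => n.
Qed.

End Comp.

Section TateEval.
Context (R : realType) (C : ultraFieldType R).
Hypothesis cpl : ucomplete C.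
Notation T := (tate C).
Implicit Types (f g h : T) (x y : C).

Let UC := uball_ultra cpl.
Let idC : {rmorphism C -> C} := idfun.

Lemma uball_id (c : C) : uball (uabs c) (idC c). Proof. exact: lexx. Qed.

Lemma hev_id_sum f n x : hev idC (trunc n f) x = \sum_(i < n) f i * x ^+ i.
Proof. by rewrite /hev map_poly_id// horner_poly. Qed.

Lemma tate_evalE f x : tate_eval f x = ev (@uball R C) idC f x.
Proof.
rewrite /tate_eval /usum /ev; congr xget; apply/seteqP; split => y /= h.
  by apply: blim_eq (iffRL (blim_ucvg _ _) h) => n; rewrite hev_id_sum.
by apply/blim_ucvg; apply: blim_eq h => n; rewrite hev_id_sum.
Qed.

Section Radius.
Variables (r : R) (r1 : 1 <= r).

Lemma has_usum_eval f x : tends0 r f -> uabs x <= r ->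
  has_usum (fun n => f n * x ^+ n) (tate_eval f x).
Proof.
move=> hf hx; rewrite tate_evalE; apply/blim_ucvg.
by apply: blim_eq (evP cpl UC uball_id r1 hf hx) => n; rewrite hev_id_sum.
Qed.

Lemma tate_evalD f g x : tends0 r f -> tends0 r g -> uabs x <= r ->
  tate_eval (f + g) x = tate_eval f x + tate_eval g x.
Proof. by move=> *; rewrite !tate_evalE (evD cpl UC uball_id r1). Qed.

Lemma tate_evalM f g x : tends0 r f -> tends0 r g -> uabs x <= r ->
  tate_eval (f * g) x = tate_eval f x * tate_eval g x.
Proof. by move=> *; rewrite !tate_evalE (evM cpl UC uball_id r1). Qed.

Lemma tate_evalN f x : tends0 r f -> uabs x <= r ->
  tate_eval (- f) x = - tate_eval f x.
Proof. by move=> *; rewrite !tate_evalE (evN cpl UC uball_id r1). Qed.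

Lemma tate_eval_bound f x (M : R) : 0 < M -> nb r M f -> tends0 r f -> uabs x <= r ->
  uabs (tate_eval f x) <= M.
Proof. by move=> *; rewrite tate_evalE; apply: (ev_bound cpl UC uball_id r1). Qed.

End Radius.

Lemma tate_evalD1 f g x : uabs x <= 1 :> R ->
  tate_eval (f + g) x = tate_eval f x + tate_eval g x.
Proof. by apply: (tate_evalD (lexx 1)); apply: tends0_1. Qed.

Lemma tate_evalM1 f g x : uabs x <= 1 :> R ->
  tate_eval (f * g) x = tate_eval f x * tate_eval g x.
Proof. by apply: (tate_evalM (lexx 1)); apply: tends0_1. Qed.

Lemma tate_eval_cst c x : tate_eval (tate_cst c) x = c.
Proof.
have r1 : 1 <= Num.max 1 (uabs x) :> R by rewrite le_max lexx.
by rewrite tate_evalE (ev_cst cpl UC uball_id r1)// /uball le_max lexx orbT.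
Qed.

Lemma tate_eval_var x : tate_eval (tate_var : T) x = x.
Proof.
have r1 : 1 <= Num.max 1 (uabs x) :> R by rewrite le_max lexx.
by rewrite tate_evalE (ev_var cpl UC uball_id r1)// /uball le_max lexx orbT.
Qed.

Lemma tate_eval_comp r f w x : 1 <= r -> tends0 r f -> nb 1 r w -> uabs x <= 1 ->
  tate_eval (tcomp f w) x = tate_eval f (tate_eval w x).
Proof. by move=> r1 hf hw hx; rewrite !tate_evalE (ev_tcomp cpl UC uball_id r1). Qed.

Lemma tcompA r f w v : 1 <= r -> tends0 r f -> nb 1 r w -> nb 1 1 v ->
  tcomp (tcomp f w) v = tcomp f (tcomp w v).
Proof.
move=> r1 hf hw hv.
exact: (ev_tcomp cpl (nb_ultra cpl (lexx 1)) (@nb1_cst R C) r1).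
Qed.

Lemma tcomp_var r f : 1 <= r -> tends0 r f -> tcomp f tate_var = f.
Proof.
move=> r1 hf; have U1 := nb_ultra cpl (lexx (1 : R)).
have vr : nb 1 r (tate_var : T) by apply: (ballW U1 r1); apply: nb_var.
apply: (blim_uniq U1 (evP cpl U1 (@nb1_cst R C) r1 hf vr)).
apply: blim_eq (trunc_lim (lexx 1) (tends0_1 f)) => n.
rewrite /hev.
elim/poly_ind: (trunc n f) => [|p c IH]; first by rewrite !rmorph0 horner0.
by rewrite !rmorphD !rmorphM /= map_polyX map_polyC hornerMXaddC -IH tate_polyX tate_polyC.
Qed.

(** The explicit coefficients show that the substitution T -> s T is injective for s != 0. *)
Lemma tcomp_scale f s n : uabs s <= 1 :> R ->
  tcomp f (tate_cst s * tate_var) n = f n * s ^+ n.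
Proof.
move=> s1; have U1 := nb_ultra cpl (lexx (1 : R)).
have tc : tate_cond (fun n => f n * s ^+ n).
  apply/tate_condP => e e0; have /tate_condP/(_ _ e0) [N hN] := tateP f.
  exists N => k /hN; apply: le_lt_trans.
  by rewrite uabsM ler_piMr ?uabs_ge0// uabsX exprn_ile1 ?uabs_ge0.
have bw : nb 1 1 (tate_cst s * tate_var : T).
  by have := nb_mul (lexx 1) (nb_cst 1 s1) (nb_var C (lexx 1)); rewrite mulr1.
suff -> : tcomp f (tate_cst s * tate_var) = Tate tc by [].
apply: (blim_uniq U1 (evP cpl U1 (@nb1_cst R C) (lexx 1) (tends0_1 f) bw)).
apply: blim_eq (trunc_lim (lexx 1) (tends0_1 (Tate tc))) => k.
rewrite /hev; have -> : trunc k (Tate tc) = trunc k f \Po (s *: 'X).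
  apply/polyP => i; rewrite comp_polyE.
  under eq_bigr => l _ do rewrite exprZn scalerA.
  have := @poly_def _ (size (trunc k f)) (fun l => (trunc k f)`_l * s ^+ l).
  move=> <-; rewrite !coef_poly; case: ltnP => ik; last by rewrite mul0r if_same.
  case: ltnP => // /(nth_default 0); rewrite coef_poly ik /= => ->; exact: mul0r.
elim/poly_ind: (trunc k f) => [|p c IH].
  by rewrite comp_poly0 !rmorph0 horner0.
rewrite comp_poly_MXaddC !rmorphD !rmorphM /= map_polyX map_polyC hornerMXaddC -IH.
by rewrite tate_polyC -mul_polyC rmorphM /= tate_polyX tate_polyC.
Qed.

(** Close to 0 the lowest nonzero term f_k x ^ k exceeds all later ones, so no cancellation can
    produce 0. *)
Lemma tate_isolated_zero f : f != 0 -> exists2 e : R, 0 < e &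
  forall x, x != 0 -> uabs x < e -> tate_eval f x != 0.
Proof.
move=> f0.
have [k fk kmin] : exists2 k, f k != 0 & forall i, (i < k)%N -> f i = 0.
  have exk : exists k, f k != 0.
    apply: contrapT => h; move/eqP: f0; apply; apply: tate_eq => n.
    rewrite tate0E; apply/eqP; apply: contrapT => fn.
    by apply: h; exists n; apply/negP.
  have [k fk kmin] := ex_minnP exk; exists k => // i ik.
  by apply/eqP; apply: contraTT ik => fi; rewrite -leqNgt kmin.
have [M M0 hM] := tate_bounded f.
have fk0 : 0 < uabs (f k) :> R by rewrite uabs_gt0.
exists (Num.min 1 (uabs (f k) / M)); first by rewrite lt_min ltr01 divr_gt0.
move=> x x0; rewrite lt_min => /andP[x1 xM].
have ux0 : 0 < uabs x :> R by rewrite uabs_gt0.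
have dom n : uabs (\sum_(i < k.+1 + n) f i * x ^+ i) = uabs (f k * x ^+ k) :> R.
  elim: n => [|n IH].
    rewrite addn0 big_ord_recr /= big1 ?add0r// => i _.
    by rewrite kmin// mul0r.
  rewrite addnS big_ord_recr /= uabs_dom// IH !uabsM !uabsX.
  rewrite addSnnS exprD mulrCA [ltRHS]mulrC ltr_pM2l ?exprn_gt0//.
  apply: (@le_lt_trans _ _ (M * uabs x)).
    apply: ler_pM; rewrite ?uabs_ge0 ?exprn_ge0 ?uabs_ge0//.
      by have := hM (k + n.+1)%N; rewrite expr1n mulr1.
    by rewrite exprS ler_piMr ?uabs_ge0// exprn_ile1 ?uabs_ge0// ltW.
  by rewrite mulrC -ltr_pdivlMr.
apply/eqP => fx0.
have := has_usum_eval (lexx 1) (tends0_1 f) (ltW x1); rewrite fx0 => /ucvgP h.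
have p0 : 0 < uabs (f k * x ^+ k) :> R by rewrite uabs_gt0 mulf_neq0// expf_neq0.
have [N /(_ (k.+1 + N)%N (leq_addl _ _))] := h _ p0.
by rewrite subr0 dom ltxx.
Qed.

End TateEval.

(** * Functions on the curve *)

Section WextTheory.
Context (S : comNzRingType) (b c : S).
Notation E := (wext b c).
Implicit Types u v w : E.

Lemma wreD u v : wre (u + v) = wre u + wre v. Proof. by []. Qed.
Lemma wimD u v : wim (u + v) = wim u + wim v. Proof. by []. Qed.
Lemma wreN u : wre (- u) = - wre u. Proof. by []. Qed.
Lemma wimN u : wim (- u) = - wim u. Proof. by []. Qed.
Lemma wreM u v : wre (u * v) = wre u * wre v + wim u * wim v * c. Proof. by []. Qed.
Lemma wimM u v : wim (u * v) = wre u * wim v + wim u * wre v - wim u * wim v * b.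
Proof. by []. Qed.
Lemma wre0 : wre (0 : E) = 0. Proof. by []. Qed.
Lemma wim0 : wim (0 : E) = 0. Proof. by []. Qed.
Lemma wre1 : wre (1 : E) = 1. Proof. by []. Qed.
Lemma wim1 : wim (1 : E) = 0. Proof. by []. Qed.
Lemma wre_cst x : wre (wcst x : E) = x. Proof. by []. Qed.
Lemma wim_cst x : wim (wcst x : E) = 0. Proof. by []. Qed.
Lemma wre_gen : wre (wgen : E) = 0. Proof. by []. Qed.
Lemma wim_gen : wim (wgen : E) = 1. Proof. by []. Qed.
Definition wextE := (wre_gen, wim_gen, wreD, wimD, wreN, wimN, wreM, wimM, wre0, wim0, wre1, wim1,
  wre_cst, wim_cst).

Fact wcst_zmod : zmod_morphism (@wcst S b c).
Proof. by move=> x y; apply: wext_eq; rewrite !wextE ?subr0. Qed.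
Fact wcst_monoid : monoid_morphism (@wcst S b c).
Proof.
split; first exact: wext_eq.
by move=> x y; apply: wext_eq; rewrite !wextE !(mul0r, mulr0, addr0, subr0).
Qed.
HB.instance Definition _ := GRing.isZmodMorphism.Build _ _ (@wcst S b c) wcst_zmod.
HB.instance Definition _ := GRing.isMonoidMorphism.Build _ _ (@wcst S b c) wcst_monoid.

Lemma wextP u : u = wcst (wre u) + wcst (wim u) * wgen.
Proof. by apply: wext_eq; rewrite !wextE; ring. Qed.

(* y |-> - y - b *)
Definition wconj u : E := Wext (wre u - b * wim u) (- wim u).
Definition wnorm u : S := wre u ^+ 2 - b * wre u * wim u - c * wim u ^+ 2.

Lemma wre_conj u : wre (wconj u) = wre u - b * wim u. Proof. by []. Qed.
Lemma wim_conj u : wim (wconj u) = - wim u. Proof. by []. Qed.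

Lemma mul_wconj u : u * wconj u = wcst (wnorm u).
Proof.
apply: wext_eq; first by rewrite wreM wre_conj wim_conj wre_cst /wnorm; ring.
by rewrite wimM wre_conj wim_conj wim_cst; ring.
Qed.

Lemma wext_unitI u v : u * v = 1 -> u \is a GRing.unit.
Proof. by move=> uv; apply/unitrPr; exists v. Qed.

Lemma wext_invI u v : u * v = 1 -> u^-1 = v.
Proof. by move=> uv; apply: (mulrI (wext_unitI uv)); rewrite uv divrr// (wext_unitI uv). Qed.

End WextTheory.

Section DomIndex.
Context (R : realType) (C : ultraFieldType R).
Notation T := (tate C).
Implicit Types (f g h : T).
Variables (r : R) (r0 : 0 < r).
Let rn0 n : 0 < r ^+ n. Proof. exact: exprn_gt0. Qed.
Let wt f n := uabs (f n) * r ^+ n.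

(** The last index at which the Gauss norm on the disc of radius r is attained, that is, the
    Weierstrass degree. Being additive under products, it is even for squares. *)
Definition dom_index f d : Prop :=
  [/\ 0 < uabs (f d) * r ^+ d, forall n, uabs (f n) * r ^+ n <= uabs (f d) * r ^+ d &
      forall n, (d < n)%N -> uabs (f n) * r ^+ n < uabs (f d) * r ^+ d].

Lemma dom_index_ex f : tends0 r f -> f != 0 -> exists d, dom_index f d.
Proof.
move=> hf f0.
have [k fk] : exists k, f k != 0.
  apply: contrapT => h; move/eqP: f0; apply; apply: tate_eq => n.
  by rewrite tate0E; apply: contrapT => /eqP fn; apply: h; exists n.
have wk : 0 < wt f k by rewrite mulr_gt0// uabs_gt0.
have /(tends0P _ (ltW r0))/(_ _ wk) [N hN] := hf.
have kN : (k < N)%N by rewrite ltnNge; apply/negP => /hN; rewrite ltxx.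
suff [d [dN dmax dlast]] : exists d, [/\ (d < N)%N, forall n, (n < N)%N -> wt f n <= wt f d &
    forall n, (n < N)%N -> (d < n)%N -> wt f n < wt f d].
  exists d; split.
  - exact: lt_le_trans wk (dmax _ kN).
  - move=> n; case: (ltnP n N) => [/dmax//|/hN h].
    exact: ltW (lt_le_trans h (dmax _ kN)).
  - move=> n dn; case: (ltnP n N) => [/dlast->//|/hN h].
    exact: (lt_le_trans h (dmax _ kN)).
case: N kN {hN} => // N _.
elim: N => [|N [d [dN dmax dlast]]].
  by exists 0%N; split => // -[].
case: (leP (wt f d) (wt f N.+1)) => h.
  exists N.+1; split => // n; last by rewrite ltnS => /leq_ltn_trans h1 /h1; rewrite ltnn.
  rewrite ltnS leq_eqVlt => /predU1P[->//|/dmax h1]; exact: le_trans h1 h.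
exists d; split; first exact: ltnW.
  by move=> n; rewrite ltnS leq_eqVlt => /predU1P[->|/dmax//]; apply: ltW.
by move=> n; rewrite ltnS leq_eqVlt => /predU1P[->//|/dlast//].
Qed.

Let wtM f g d e n : (forall i, wt f i <= wt f d) -> (forall i, wt g i <= wt g e) ->
  (forall i, (d < i)%N -> wt f i < wt f d) -> (forall i, (e < i)%N -> wt g i < wt g e) ->
  0 < wt f d -> 0 < wt g e ->
  forall i, (i <= n)%N -> uabs (f i * g (n - i)%N) * r ^+ n <= wt f d * wt g e /\
    ((d + e <= n)%N -> i != d \/ (d + e < n)%N ->
     uabs (f i * g (n - i)%N) * r ^+ n < wt f d * wt g e).
Proof.
move=> fd ge fd' ge' f0 g0 i ile.
have -> : uabs (f i * g (n - i)%N) * r ^+ n = wt f i * wt g (n - i)%N.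
  by rewrite /wt mulrACA -uabsM -exprD subnKC.
have p k h : 0 <= wt h k by rewrite /wt mulr_ge0 ?uabs_ge0// ltW.
split; first by rewrite ler_pM.
move=> den hi; have [di|id] := ltnP d i.
  apply: (@le_lt_trans _ _ (wt f i * wt g e)); first by rewrite ler_wpM2l.
  by rewrite ltr_pM2r//; apply: fd'.
apply: (@le_lt_trans _ _ (wt f d * wt g (n - i)%N)); first by rewrite ler_wpM2r.
rewrite ltr_pM2l//; apply: ge'; lia.
Qed.

(** In the coefficient of index d + e only the product of the two dominant terms reaches the
    maximum. *)
Lemma dom_indexM f g d e : dom_index f d -> dom_index g e ->
  dom_index (f * g) (d + e) /\
  uabs ((f * g) (d + e)%N) * r ^+ (d + e) = uabs (f d) * r ^+ d * (uabs (g e) * r ^+ e).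
Proof.
move=> [f0 fd fd'] [g0 ge ge'].
have mx := wtM fd ge fd' ge' f0 g0.
have F0 : 0 < wt f d * wt g e by rewrite mulr_gt0.
have top : wt (f * g) (d + e)%N = wt f d * wt g e.
  have dlt : (d < (d + e).+1)%N by lia.
  have fge : uabs (f d * g e) * r ^+ (d + e) = wt f d * wt g e.
    by rewrite uabsM exprD /wt; ring.
  rewrite /wt tateME (bigD1 (Ordinal dlt))//= addKn.
  set rest := \sum_(i < _ | _) _.
  suff hrest : uabs rest < uabs (f d * g e) by rewrite uabs_dom.
  rewrite -(ltr_pM2r (rn0 (d + e))) fge -ltr_pdivlMr//.
  have q0 : 0 < wt f d * wt g e / r ^+ (d + e) by rewrite divr_gt0.
  rewrite /rest; elim/big_ind: _ => [|x y|i]; [by rewrite uabs0|exact: uabsD_lt|].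
  move=> ni; rewrite ltr_pdivlMr//; have ilt := ltn_ord i.
  have [|_] := mx (d + e)%N i; first by lia.
  apply; [by lia|left].
  by apply: contraNneq ni => ni; apply/eqP/val_inj.
split => //; split.
- by rewrite -/(wt _ _) top.
- move=> n; rewrite -!/(wt _ _) top /wt -ler_pdivlMr// tateME.
  apply: uabs_sum_le => [|[i /= ilt] _]; first by rewrite divr_ge0// ltW.
  by rewrite ler_pdivlMr//; have [] := mx n i ilt.
- move=> n den; rewrite -!/(wt _ _) top /wt -ltr_pdivlMr// tateME.
  apply: (uabs_sum_lt (u := fun i => f i * g (n - i)%N)); first by rewrite divr_gt0.
  move=> i ilt; rewrite ltr_pdivlMr//; have [|_] := mx n i; first by [].
  by apply; [exact: ltnW|right].
Qed.

End DomIndex.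

Section CurvePolynomials.
Context (F : finFieldType) (W : weierstrass F) (C : fieldType) (iota : {rmorphism F -> C}).
Notation WC := (map_w iota W).

Definition linP : {poly C} := wlin (map_w (polyC \o iota) W) 'X.
Definition cubP : {poly C} := wcub (map_w (polyC \o iota) W) 'X.

Lemma linPE x : linP.[x] = wlin WC x.
Proof. by rewrite /linP /wlin /= !hornerE. Qed.
Lemma cubPE x : cubP.[x] = wcub WC x.
Proof. by rewrite /cubP /wcub /= !(hornerD, hornerM, hornerXn, hornerC, hornerX). Qed.

Lemma size_linP : (size linP <= 2)%N.
Proof.
rewrite /linP /wlin /=; apply: leq_trans (size_polyD _ _) _; rewrite geq_max.
rewrite (leq_trans (size_polyC_leq1 _))// andbT.
by apply: leq_trans (size_polyMleq _ _) _; rewrite size_polyX addn2 /= ltnS size_polyC_leq1.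
Qed.

Lemma size_cubP : (size cubP <= 4)%N.
Proof.
rewrite /cubP /wcub /=; apply/leq_sizeP => j j4.
rewrite !coefD !coefCM coefXn coefXn coefX coefC.
by case: j j4 => [|[|[|[|j]]]] //= _; rewrite !mulr0 !addr0.
Qed.

End CurvePolynomials.

Section Curve.
Context (R : realType) (F : finFieldType) (W : weierstrass F)
  (C : ultraFieldType R) (iota : {rmorphism F -> C}).
Hypothesis cpl : ucomplete C.
Notation T := (tate C).
Notation TY := (tateY W iota).
Notation WC := (map_w iota W).
Implicit Types (f h : T) (x y : C) (g u v w : TY).

Definition linT : T := wlin (map_w (tate_cst \o iota) W) (tate_var : tate C).
Definition cubT : T := wcub (map_w (tate_cst \o iota) W) (tate_var : tate C).
Notation linP := (linP W iota).
Notation cubP := (cubP W iota).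

(** Nonzero elements of a finite field are roots of unity. *)
Lemma uabs_iota (a : F) : a != 0 -> uabs (iota a) = 1 :> R.
Proof.
move=> a0; have card2 : (1 < #|F|)%N := finNzRing_gt1 F.
have h : uabs (iota a) ^+ #|F|.-1 = 1 :> R.
  rewrite -uabsX -rmorphXn /=; suff -> : a ^+ #|F|.-1 = 1 by rewrite rmorph1 uabs1.
  by apply: (mulfI a0); rewrite -exprS prednK ?expf_card ?mulr1//; lia.
apply/eqP; rewrite -(@pexpr_eq1 _ _ #|F|.-1) ?uabs_ge0 ?h//; by lia.
Qed.

Lemma uabs_iota_le (a : F) : uabs (iota a) <= 1 :> R.
Proof. by have [->|/uabs_iota ->//] := eqVneq a 0; rewrite rmorph0 uabs0. Qed.


Lemma linT_poly : linT = tate_poly linP.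
Proof.
by rewrite /linT /wlin rmorphD rmorphM /= !tate_polyC tate_polyX.
Qed.

Lemma cubT_poly : cubT = tate_poly cubP.
Proof.
by rewrite /cubT /wcub /cubP /= -!tate_polyC -!tate_polyX -!rmorphXn -!rmorphM -!rmorphD.
Qed.

Lemma tate_eval_poly (p : {poly C}) x : tate_eval (tate_poly p) x = p.[x].
Proof.
have r1 : 1 <= Num.max 1 (uabs x) :> R by rewrite le_max lexx.
rewrite tate_evalE (ev_poly cpl (uball_ultra cpl) (@uball_id R C) r1).
  by rewrite /hev map_poly_id.
by rewrite /uball le_max lexx orbT.
Qed.

(* y is given norm 1 / s *)
Definition nbY (r s M : R) (g : TY) : Prop := nb r M (wre g) /\ nb r (M * s) (wim g).

Section Radius.
Variables (r s : R).
Hypotheses (r1 : 1 <= r) (s0 : 0 < s) (sr : s * r <= 1) (ssr : s ^+ 2 * r ^+ 3 <= 1).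
Let r0 : 0 < r. Proof. exact: lt_le_trans ltr01 r1. Qed.
Let UT := nb_ultra cpl r1.

Lemma nb_linT : nb r r linT.
Proof.
apply: (ballD UT); last by apply: (ballW UT r1); apply: nb_cst; apply: uabs_iota_le.
rewrite -[X in nb _ X _]mul1r; apply: (ballM UT); last exact: nb_var.
by apply: nb_cst; apply: uabs_iota_le.
Qed.

Lemma nb_cubT : nb r (r ^+ 3) cubT.
Proof.
have hX k : (k <= 3)%N -> nb r (r ^+ 3) ((tate_var : T) ^+ k).
  move=> k3; apply: (ballW UT) (ballX UT k (nb_var C r1)).
  by rewrite -(subnKC k3) exprD ler_peMr ?exprn_ge0 ?exprn_ege1// ltW.
have hc (a : F) k : (k <= 3)%N -> nb r (r ^+ 3) (tate_cst (iota a) * (tate_var : T) ^+ k).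
  move=> k3; rewrite -[X in nb _ X _]mul1r; apply: (ballM UT); last exact: hX.
  by apply: nb_cst; apply: uabs_iota_le.
apply: (ballD UT); last by have := hc (wa6 W) 0%N isT; rewrite expr0 mulr1.
apply: (ballD UT); last by have := hc (wa4 W) 1%N isT; rewrite expr1.
by apply: (ballD UT); [exact: hX|exact: hc].
Qed.

(** Replacing [y ^ 2] by [c - b y] must not raise the norm: with |y| = 1 / s, |c| <= r ^ 3 and |b|
    <= r, this is what the two upper bounds on s give. *)
Lemma nbY_ultra : ultra_ball (nbY r s).
Proof.
have s1 : s <= 1 by apply: le_trans sr; rewrite ler_peMr// ltW.
split.
- by move=> M g h [g1 g2] [h1 h2]; split; apply: (ballD UT).
- by move=> M g [g1 g2]; split; apply: (ballN UT).
- move=> M M' g h [g1 g2] [h1 h2].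
  have [M0 M0'] := (ball_ge0 UT g1, ball_ge0 UT h1).
  have MM0 : 0 <= M * M' by rewrite mulr_ge0.
  split; first rewrite wreM; last rewrite wimM.
    apply: (ballD UT); first exact: (ballM UT).
    apply: (ballW UT) (ballM UT (ballM UT g2 h2) nb_cubT).
    have -> : M * s * (M' * s) * r ^+ 3 = M * M' * (s ^+ 2 * r ^+ 3) by ring.
    by rewrite ler_piMr.
  apply: (ballB UT); first apply: (ballD UT).
  + by apply: (ballW UT) (ballM UT g1 h2); rewrite mulrA.
  + by apply: (ballW UT) (ballM UT g2 h1); rewrite mulrAC.
  apply: (ballW UT) (ballM UT (ballM UT g2 h2) nb_linT).
  have -> : M * s * (M' * s) * r = M * M' * s * (s * r) by ring.
  by rewrite ler_piMr// mulr_ge0// ltW.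
- split; first exact: (ball1 UT).
  by rewrite wim1 mul1r; apply: (ball0 UT (ltW s0)).
- by move=> M M0; split; apply: (ball0 UT) => //; rewrite mulr_ge0// ltW.
- move=> M M' g MM' [g1 g2]; split; first exact: (ballW UT) g1.
  by apply: (ballW UT) g2; rewrite ler_wpM2r// ltW.
- by move=> M g [g1 _]; apply: (ball_ge0 UT) g1.
- move=> g h; apply: wext_eq; apply: (ball_sep UT) => e e0.
    by have [] := h e e0.
  have es : 0 < e / s by rewrite divr_gt0.
  by have [_] := h _ es; rewrite divfK// gt_eqF.
- move=> u hu.
  have [a ha] : exists a, blim (nb r) (fun n => wre (u n)) a.
    by apply: (ball_cpl UT) => e /hu [N hN]; exists N => n /hN [].
  have [b hb] : exists b, blim (nb r) (fun n => wim (u n)) b.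
    apply: (ball_cpl UT) => e e0; have [N hN] := hu _ (divr_gt0 e0 s0).
    by exists N => n /hN [_]; rewrite divfK// gt_eqF.
  exists (Wext a b) => e e0.
  have [[N hN] [N' hN']] := (ha _ e0, hb _ (mulr_gt0 e0 s0)).
  by exists (maxn N N') => n; rewrite geq_max => /andP[/hN ? /hN' ?]; split.
Qed.

Lemma nbY_cst M x : uabs x <= M -> nbY r s M (tyc W iota x).
Proof.
move=> xM; split; first exact: nb_cst.
apply: (ball0 UT); rewrite mulr_ge0 ?(ltW s0)//; exact: le_trans (uabs_ge0 _) xM.
Qed.

Lemma nbY_t : nbY r s r (tyt W iota).
Proof.
by split; [exact: nb_var|apply: (ball0 UT); rewrite mulr_ge0// ltW].
Qed.

Lemma nbY_y : nbY r s s^-1 (tyy W iota).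
Proof.
split; first by apply: (ball0 UT); rewrite invr_ge0 ltW.
by rewrite mulVf ?gt_eqF//; apply: (ball1 UT).
Qed.

Lemma nbY_gauss M u : s <= 1 -> nbY r s M u -> nbY 1 1 M u.
Proof.
move=> s1 [h1 h2]; have M0 := ball_ge0 UT h1.
split; apply: (@nb_le _ _ r) => //.
by apply: (ballW UT) h2; rewrite ler_wpM2l.
Qed.

End Radius.

Lemma nbY1_ultra : ultra_ball (nbY 1 1).
Proof. by apply: nbY_ultra; rewrite ?mulr1 ?expr1n ?mulr1. Qed.

Lemma tynormP (M : R) u : 0 <= M -> tynorm u <= M <-> nbY 1 1 M u.
Proof.
move=> M0; rewrite /nbY mulr1 /tynorm ge_max; split.
  by move=> /andP[/(gauss_normP _ M0) h1 /(gauss_normP _ M0) h2].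
by move=> [/(gauss_normP _ M0) -> /(gauss_normP _ M0) ->].
Qed.

Lemma tynorm_ge0 u : 0 <= tynorm u.
Proof.
rewrite /tynorm le_max; apply/orP; left.
have [K _ hK] := tate_bounded (wre u).
apply: (@le_trans _ _ (uabs (wre u 0%N))); first exact: uabs_ge0.
apply: ub_le_sup; last by exists 0%N.
by exists K => _ [k _ <-]; have := hK k; rewrite expr1n mulr1.
Qed.

Lemma nbY1_ex u : exists M, nbY 1 1 M u.
Proof. by exists (tynorm u); apply/tynormP => //; apply: tynorm_ge0. Qed.

Lemma tycvgP (u : nat -> TY) g : tycvg u g <-> blim (nbY 1 1) u g.
Proof.
have ge n : `|tynorm (u n - g)| = tynorm (u n - g) by rewrite ger0_norm// tynorm_ge0.
split=> [/cvgr0Pnorm_lt h e e0|h].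
  have [N _ hN] := h e e0; exists N => n /hN /=; rewrite ge => /ltW.
  by move/(tynormP _ (ltW e0)).
apply/cvgr0Pnorm_lt => e e0; have e2 : 0 < e / 2 by lra.
have [N hN] := h _ e2; exists N => // n /= /hN /(tynormP _ (ltW e2)) hn.
by rewrite ge; apply: le_lt_trans hn _; lra.
Qed.

Lemma tylimE (u : nat -> TY) g : tycvg u g -> tylim u = g.
Proof.
move=> ug; apply: (blim_uniq nbY1_ultra (u := u)); apply/tycvgP => //.
by apply: xgetPex; exists g.
Qed.

Section Analytic.
Variables (r : R) (r1 : 1 <= r).
Let r0 : 0 <= r. Proof. exact: le_trans ler01 r1. Qed.

Lemma tends0_linT : tends0 r linT.
Proof. by rewrite linT_poly; apply: tends0_poly. Qed.
Lemma tends0_cubT : tends0 r cubT.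
Proof. by rewrite cubT_poly; apply: tends0_poly. Qed.

Lemma tyaD u v : ty_analytic r u -> ty_analytic r v -> ty_analytic r (u + v).
Proof. by move=> [u1 u2] [v1 v2]; split; apply: tends0D. Qed.
Lemma tyaN u : ty_analytic r u -> ty_analytic r (- u).
Proof. by move=> [u1 u2]; split; apply: tends0N. Qed.
Lemma tyaB u v : ty_analytic r u -> ty_analytic r v -> ty_analytic r (u - v).
Proof. by move=> hu hv; apply: tyaD => //; apply: tyaN. Qed.
Lemma tyaM u v : ty_analytic r u -> ty_analytic r v -> ty_analytic r (u * v).
Proof.
have M f h := @tends0M R C cpl r r1 f h; have D f h := @tends0D R C cpl r r1 f h.
move=> [u1 u2] [v1 v2]; split; rewrite ?wreM ?wimM.
  by apply: (D) (M _ _ _ _) (M _ _ (M _ _ _ _) tends0_cubT).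
apply: (D); first by apply: (D); apply: (M).
by apply: tends0N => //; apply: (M) (M _ _ _ _) tends0_linT.
Qed.
Lemma tya_cst x : ty_analytic r (tyc W iota x).
Proof. by split; [exact: tends0_cst|rewrite wim_cst -(rmorph0 (@tate_cst R C)); exact: tends0_cst]. Qed.
Lemma tya_t : ty_analytic r (tyt W iota).
Proof. by split; [exact: tends0_var|rewrite wim_cst -(rmorph0 (@tate_cst R C)); exact: tends0_cst]. Qed.
Lemma tya_y : ty_analytic r (tyy W iota).
Proof.
split; last by rewrite wim_gen -(rmorph1 (@tate_cst R C)); exact: tends0_cst.
by rewrite wre_gen -(rmorph0 (@tate_cst R C)); exact: tends0_cst.
Qed.
Lemma tya_conj u : ty_analytic r u -> ty_analytic r (wconj u).
Proof.
move=> [u1 u2]; split; rewrite ?wre_conj ?wim_conj; last exact: tends0N.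
apply: tends0D => //; apply: tends0N => //; apply: tends0M => //.
exact: tends0_linT.
Qed.

Section Point.
Variables (x y : C) (xr : uabs x <= r) (exy : on_curve WC x y).

Lemma ty_evalD u v : ty_analytic r u -> ty_analytic r v ->
  ty_eval (u + v) x y = ty_eval u x y + ty_eval v x y.
Proof.
move=> [u1 u2] [v1 v2]; rewrite /ty_eval !(tate_evalD cpl r1)//; ring.
Qed.

Lemma ty_evalN u : ty_analytic r u -> ty_eval (- u) x y = - ty_eval u x y.
Proof.
move=> [u1 u2]; rewrite /ty_eval !(tate_evalN cpl r1)//; ring.
Qed.

Lemma ty_evalB u v : ty_analytic r u -> ty_analytic r v ->
  ty_eval (u - v) x y = ty_eval u x y - ty_eval v x y.
Proof. by move=> hu hv; rewrite ty_evalD ?ty_evalN//; apply: tyaN. Qed.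

Lemma ty_evalM u v : ty_analytic r u -> ty_analytic r v ->
  ty_eval (u * v) x y = ty_eval u x y * ty_eval v x y.
Proof.
have M f h := @tends0M R C cpl r r1 f h.
have eM f h := @tate_evalM R C cpl r r1 f h x.
move=> [u1 u2] [v1 v2]; rewrite /ty_eval wreM wimM.
have hl := tends0_linT; have hc := tends0_cubT.
have h1 := M _ _ u1 v1; have h2 := M _ _ u2 v2; have h3 := M _ _ u1 v2.
have h4 := M _ _ u2 v1; have h5 := M _ _ h2 hc; have h6 := M _ _ h2 hl.
have h7 := tends0N r1 h6; have h8 := tends0D cpl r1 h3 h4.
rewrite -/cubT -/linT !(tate_evalD cpl r1)// (tate_evalN cpl r1)// !eM//.
have -> : tate_eval cubT x = wcub WC x by rewrite cubT_poly tate_eval_poly cubPE.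
have -> : tate_eval linT x = wlin WC x by rewrite linT_poly tate_eval_poly linPE.
rewrite -exy; ring.
Qed.

Lemma ty_eval_cst a : ty_eval (tyc W iota a) x y = a.
Proof.
by rewrite /ty_eval wre_cst wim_cst -(rmorph0 (@tate_cst R C)) !tate_eval_cst// mul0r addr0.
Qed.

Lemma ty_eval_t : ty_eval (tyt W iota) x y = x.
Proof.
by rewrite /ty_eval wre_cst wim_cst -(rmorph0 (@tate_cst R C)) tate_eval_cst// tate_eval_var// mul0r addr0.
Qed.

Lemma ty_eval_bound s M u : 0 < M -> 0 < s -> nbY r s M u -> ty_analytic r u ->
  uabs (ty_eval u x y) <= M * Num.max 1 (s * uabs y).
Proof.
move=> M0 s0 [u1 u2] [v1 v2]; rewrite /ty_eval; apply: uabsD_le.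
  apply: (@le_trans _ _ M); first exact: (tate_eval_bound cpl r1).
  by rewrite ler_peMr ?(ltW M0)// le_max lexx.
rewrite uabsM; apply: (@le_trans _ _ (M * s * uabs y)).
  rewrite ler_wpM2r ?uabs_ge0//; apply: (tate_eval_bound cpl r1) => //.
  by rewrite mulr_gt0.
by rewrite -mulrA ler_wpM2l ?(ltW M0)// le_max lexx orbT.
Qed.

Lemma ty_eval_blim s (u : nat -> TY) g : 0 < s -> (forall n, ty_analytic r (u n)) ->
  ty_analytic r g -> blim (nbY r s) u g ->
  blim (@uball R C) (fun n => ty_eval (u n) x y) (ty_eval g x y).
Proof.
move=> s0 au ag ug e e0; pose K := Num.max 1 (s * uabs y).
have K0 : 0 < K by rewrite lt_max ltr01.
have [N hN] := ug _ (divr_gt0 e0 K0); exists N => n /hN h.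
rewrite /uball -ty_evalB//; have := ty_eval_bound (divr_gt0 e0 K0) s0 h (tyaB (au n) ag).
by rewrite -/K divfK// gt_eqF.
Qed.

End Point.
End Analytic.

Lemma nbY_analytic r r' s M u : 1 <= r -> 0 <= r' -> r' < r -> nbY r s M u ->
  ty_analytic r' u.
Proof. by move=> r1 r'0 r'r [u1 u2]; split; apply: nb_tends0 r'r _ => //; eassumption. Qed.

End Curve.

(** * Frobenius and the Drinfeld point *)

Section Frobenius.
Context (R : realType) (F : finFieldType) (W : weierstrass F)
  (C : ultraFieldType R) (iota : {rmorphism F -> C}).
Notation q := #|F|.
Notation T := (tate C).
Notation TY := (tateY W iota).
Notation WC := (map_w iota W).
Implicit Types (x y : C) (f h : T) (u v : TY).

Lemma card_pnat : [pchar C].-nat q.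
Proof.
have [p pp pF] := finPcharP F.
have pC : p \in [pchar C] := rmorph_pchar iota pF.
have := pprimeChar_pgroup pF; rewrite /pgroup.pgroup cardsT.
by apply: sub_in_pnat => l _; rewrite inE => /eqP ->.
Qed.

Lemma frobD k x y : (x + y) ^+ (q ^ k) = x ^+ (q ^ k) + y ^+ (q ^ k).
Proof. by apply: exprDn_pchar; rewrite pnatX card_pnat. Qed.

Lemma card_expn_gt0 k : (0 < q ^ k)%N.
Proof. by rewrite expn_gt0 ltnW ?finNzRing_gt1. Qed.

Lemma frobN k x : (- x) ^+ (q ^ k) = - x ^+ (q ^ k).
Proof.
by apply/eqP; rewrite -addr_eq0 -frobD addNr expr0n -leqn0 leqNgt card_expn_gt0.
Qed.

Lemma frobB k x y : (x - y) ^+ (q ^ k) = x ^+ (q ^ k) - y ^+ (q ^ k).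
Proof. by rewrite frobD frobN. Qed.

Lemma frob_sum k (I : Type) (s : seq I) (P : pred I) (g : I -> C) :
  (\sum_(i <- s | P i) g i) ^+ (q ^ k) = \sum_(i <- s | P i) g i ^+ (q ^ k).
Proof.
apply: (big_morph (fun x => x ^+ (q ^ k))) => [x y|]; first exact: frobD.
by rewrite expr0n -leqn0 leqNgt card_expn_gt0.
Qed.

Lemma frob_iota k (a : F) : iota a ^+ (q ^ k) = iota a.
Proof.
elim: k => [|k IH]; first by rewrite expr1.
by rewrite expnSr exprM IH -rmorphXn /= expf_card.
Qed.

Lemma frob_inj k x y : x ^+ (q ^ k) = y ^+ (q ^ k) -> x = y.
Proof.
move/eqP; rewrite -subr_eq0 -frobB expf_eq0 card_expn_gt0 /= subr_eq0.
by move/eqP.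
Qed.

Lemma frob_lin k x : wlin WC x ^+ (q ^ k) = wlin WC (x ^+ (q ^ k)).
Proof. by rewrite /wlin frobD exprMn !frob_iota. Qed.

Lemma frob_cub k x : wcub WC x ^+ (q ^ k) = wcub WC (x ^+ (q ^ k)).
Proof.
have e (a : F) n : (iota a * x ^+ n) ^+ (q ^ k) = iota a * (x ^+ (q ^ k)) ^+ n.
  by rewrite exprMn frob_iota exprAC.
by rewrite /wcub !frobD exprAC e (e _ 1%N) frob_iota.
Qed.

Lemma frob_on_curve k x y : on_curve WC x y -> on_curve WC (x ^+ (q ^ k)) (y ^+ (q ^ k)).
Proof.
move=> h; have e : (wlin WC x * y) ^+ (q ^ k) = wlin WC (x ^+ (q ^ k)) * y ^+ (q ^ k).
  by rewrite exprMn frob_lin.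
by rewrite /on_curve -e -exprAC -frobD h frob_cub.
Qed.

Fact twist_tate_zmod k : zmod_morphism (@twist_tate R C F k).
Proof. by move=> f h; apply: tate_eq => n; rewrite tateBE /= frobB. Qed.
Fact twist_tate_monoid k : monoid_morphism (@twist_tate R C F k).
Proof.
split; first by apply: tate_eq => -[|n] /=; rewrite ?expr1n// expr0n -leqn0 leqNgt card_expn_gt0.
move=> f h; apply: tate_eq => n; rewrite tateME /= frob_sum.
by apply: eq_bigr => i _; rewrite exprMn.
Qed.

Lemma twist_tateD k f h : twist_tate F k (f + h) = twist_tate F k f + twist_tate F k h.
Proof. by apply: tate_eq => n; rewrite tateDE /= frobD. Qed.
Lemma twist_tateB k f h : twist_tate F k (f - h) = twist_tate F k f - twist_tate F k h.
Proof. exact: twist_tate_zmod. Qed.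
Lemma twist_tateM k f h : twist_tate F k (f * h) = twist_tate F k f * twist_tate F k h.
Proof. by have [_] := twist_tate_monoid k; apply. Qed.
Lemma twist_tate_cst k x : twist_tate F k (tate_cst x : T) = tate_cst (x ^+ (q ^ k)).
Proof.
by apply: tate_eq => -[|n] //=; rewrite expr0n -leqn0 leqNgt card_expn_gt0.
Qed.
Lemma twist_tate_var k : twist_tate F k (tate_var : T) = tate_var.
Proof.
by apply: tate_eq => -[|[|n]] //=; rewrite ?expr1n// expr0n -leqn0 leqNgt card_expn_gt0.
Qed.

Lemma twist_tateX k f n : twist_tate F k (f ^+ n) = twist_tate F k f ^+ n.
Proof.
elim: n => [|n IH]; first by rewrite !expr0; exact: (twist_tate_monoid k).1.
by rewrite !exprS twist_tateM IH.
Qed.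

Lemma twist_linT k : twist_tate F k (linT W iota) = linT W iota.
Proof.
by rewrite /linT /wlin twist_tateD twist_tateM /= !twist_tate_cst !frob_iota twist_tate_var.
Qed.

Lemma twist_cubT k : twist_tate F k (cubT W iota) = cubT W iota.
Proof.
rewrite /cubT /wcub /= !twist_tateD !(twist_tateM k (tate_cst _)) !twist_tateX.
by rewrite !twist_tate_cst !frob_iota twist_tate_var.
Qed.

Lemma twistM k u v : twist k (u * v) = twist k u * twist k v.
Proof.
apply: wext_eq => /=; rewrite ?wreM ?wimM.
  rewrite -[wcub _ _]/(cubT W iota) /=.
  by rewrite -{1}[LHS]/(twist_tate F k (wre u * wre v + wim u * wim v * cubT W iota))
    twist_tateD !twist_tateM twist_cubT.
by rewrite -{1}[LHS]/(twist_tate F k (wre u * wim v + wim u * wre v - wim u * wim v * linT W iota))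
    twist_tateB twist_tateD !twist_tateM twist_linT.
Qed.

Lemma twistB k u v : twist k (u - v) = twist k u - twist k v.
Proof.
apply: wext_eq; first exact: (twist_tateB k (wre u) (wre v)).
exact: (twist_tateB k (wim u) (wim v)).
Qed.

Lemma twist_cst k x : twist k (tyc W iota x) = tyc W iota (x ^+ (q ^ k)).
Proof.
apply: wext_eq; first exact: twist_tate_cst.
rewrite wim_cst -[LHS]/(twist_tate F k (wim (tyc W iota x))) wim_cst.
by rewrite -{1}(rmorph0 (@tate_cst R C)) twist_tate_cst expr0n -leqn0 leqNgt card_expn_gt0.
Qed.

Lemma twist0T k : twist_tate F k (0 : T) = 0.
Proof. by have := twist_tateB k 0 0; rewrite !subrr. Qed.

Lemma twist_t k : twist k (tyt W iota) = tyt W iota.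
Proof. by apply: wext_eq; [exact: twist_tate_var|exact: twist0T]. Qed.

Lemma twist_y k : twist k (tyy W iota) = tyy W iota.
Proof.
apply: wext_eq; first exact: twist0T.
exact: (twist_tate_monoid k).1.
Qed.

Lemma twist_div k u v : v \is a GRing.unit -> twist k (u / v) = twist k u / twist k v.
Proof.
move=> vU; rewrite twistM; congr (_ * _); apply/esym/wext_invI.
rewrite -twistM divrr//; apply: wext_eq; first exact: (twist_tate_monoid k).1.
exact: twist0T.
Qed.

End Frobenius.

Section Chord.
Context (F : finFieldType) (W : weierstrass F) (C : fieldType) (iota : {rmorphism F -> C}).
Notation WC := (map_w iota W).

(* for V - V' = Xi with Xi = (th, et), V = (al, be), V' = (al', be'): Xi, V' and - V lie
   on the line of slope m *)
Record chord (th et al be al' be' m : C) : Prop := Chord {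
  chord1 : on_curve WC th et;
  chord2 : on_curve WC al be;
  chord3 : on_curve WC al' be';
  chord4 : et - be' = m * (th - al');
  chord5 : - be - wlin WC al - et = m * (al - th);
  chord6 : al + th + al' = m ^+ 2 + wa1 WC * m - wa2 WC;
  chord7 : th != al' }.

Section Norm.
Context (th et al be al' be' m : C) (D : chord th et al be al' be' m).

(** Over C the difference of the two sides is at most linear, its quadratic coefficient vanishing by
    [chord6]; the linear remainder [e1 * x + e0] has the two roots th and al'. The general S serves
    both the Tate algebra and polynomials. *)
Lemma chord_norm (S : comNzRingType) (j : {rmorphism C -> S}) (X : S) :
  let WS := map_w (j \o iota) W in
  let Y := j et + j m * (X - j th) in
  wcub WS X - Y ^+ 2 - wlin WS X * Y = (X - j th) * (X - j al) * (X - j al').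
Proof.
move=> WS Y; case: D => h1 h2 h3 h4 h5 h6 h7.
set a1 := iota (wa1 W); set a2 := iota (wa2 W); set a3 := iota (wa3 W).
set a4 := iota (wa4 W); set a6 := iota (wa6 W).
have a2E : a2 = m ^+ 2 + a1 * m - al - th - al'.
  by move: h6; rewrite /= -/a1 -/a2 => h6; rewrite -!addrA -!opprD (addrA al) h6; ring.
pose c0 := et - m * th.
pose e1 := a4 - 2 * m * c0 - a1 * c0 - a3 * m - (th * al + th * al' + al * al').
pose e0 := a6 - c0 ^+ 2 - a3 * c0 + th * al * al'.
have gen x : wcub WC x - (m * x + c0) ^+ 2 - wlin WC x * (m * x + c0) =
    (x - th) * (x - al) * (x - al') + e1 * x + e0.
  rewrite /wcub /wlin /= -/a1 -/a2 -/a3 -/a4 -/a6 a2E /e1 /e0; ring.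
have v1 : e1 * th + e0 = 0.
  have := gen th; rewrite subrr !mul0r add0r => <-.
  have -> : m * th + c0 = et by rewrite /c0; ring.
  rewrite -h1; ring.
have v2 : e1 * al' + e0 = 0.
  have := gen al'; rewrite subrr mulr0 add0r => <-.
  have -> : m * al' + c0 = be'.
    have -> : be' = et - m * (th - al') by rewrite -h4; ring.
    by rewrite /c0; ring.
  rewrite -h3; ring.
have e10 : e1 = 0.
  apply/eqP; have : e1 * (th - al') == 0.
    have -> : e1 * (th - al') = (e1 * th + e0) - (e1 * al' + e0) by ring.
    by rewrite v1 v2 subrr.
  by rewrite mulf_eq0 => /orP[//|]; rewrite (subr_eq0 th al') (negPf h7).
have e00 : e0 = 0 by move: v1; rewrite e10 mul0r add0r.
have a4E : a4 = 2 * m * c0 + a1 * c0 + a3 * m + (th * al + th * al' + al * al').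
  by rewrite -[RHS]add0r -e10 /e1; ring.
have a6E : a6 = c0 ^+ 2 + a3 * c0 - th * al * al'.
  by rewrite -[RHS]add0r -e00 /e0; ring.
rewrite /Y /WS /wcub /wlin /= -/a1 -/a2 -/a3 -/a4 -/a6 a2E a4E a6E /c0.
rewrite !(rmorphB, rmorphD, rmorphXn, rmorphM, rmorph_nat) /=; ring.
Qed.

End Norm.
End Chord.

Section ChordAlgebra.
Context (k : fieldType) (W : weierstrass k).

(** Once the denominator is cleared and the squares of y1 and y2 are eliminated, the cubes cancel.
    What remains has the single dominant term [x1 * x2 ^+ 2] when the second point is much farther
    out than the first. *)
Lemma wadd_abscissa (x1 y1 x2 y2 l : k) : on_curve W x1 y1 -> on_curve W x2 y2 ->
  l * (x2 - x1) = y2 - y1 ->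
  (x2 - x1) ^+ 2 * (l ^+ 2 + wa1 W * l - wa2 W - x1 - x2) = x1 * x2 ^+ 2 +
   (x1 ^+ 2 * x2 + (- (2 * (y1 * y2)) + (- (wa1 W * (y2 * x1)) + (- (wa1 W * (y1 * x2))
   + (2 * (wa2 W * (x1 * x2)) + (- (wa3 W * y1) + (- (wa3 W * y2)
   + (wa4 W * x1 + (wa4 W * x2 + 2 * wa6 W))))))))).
Proof.
move=> c1 c2 lE.
have s1 : y1 ^+ 2 = wcub W x1 - wlin W x1 * y1 by rewrite -c1; ring.
have s2 : y2 ^+ 2 = wcub W x2 - wlin W x2 * y2 by rewrite -c2; ring.
have -> : (x2 - x1) ^+ 2 * (l ^+ 2 + wa1 W * l - wa2 W - x1 - x2) =
    y2 ^+ 2 - 2 * (y1 * y2) + y1 ^+ 2 + wa1 W * (y2 - y1) * (x2 - x1)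
      - (wa2 W + x1 + x2) * (x2 - x1) ^+ 2.
  have -> : y2 ^+ 2 - 2 * (y1 * y2) + y1 ^+ 2 = (y2 - y1) ^+ 2 by ring.
  by rewrite -lE; ring.
by rewrite s1 s2 /wcub /wlin; ring.
Qed.

Lemma wneg_on_curve (x y : k) : on_curve W x y -> on_curve W x (- y - wa1 W * x - wa3 W).
Proof. by rewrite /on_curve => <-; rewrite /wlin; ring. Qed.

(* if P1 + P2 = P3, then - l - a1 is the slope of the line through - P1, - P2 and P3 *)
Lemma opposite_slope (x1 y1 x2 y2 x3 y3 l : k) : l * (x2 - x1) = y2 - y1 ->
  y3 = - (l + wa1 W) * x3 - (y1 - l * x1) - wa3 W ->
  y3 - (- y2 - wa1 W * x2 - wa3 W) = (- l - wa1 W) * (x3 - x2) /\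
  - y1 - wlin W x1 - y3 = (- l - wa1 W) * (x1 - x3).
Proof.
move=> lE ->; have -> : y2 = y1 + l * (x2 - x1) by rewrite lE; ring.
by rewrite /wlin; split; ring.
Qed.

Lemma slope_quadratic (x1 x2 x3 l : k) : l ^+ 2 + wa1 W * l - wa2 W - x1 - x2 = x3 ->
  x1 + x3 + x2 = (- l - wa1 W) ^+ 2 + wa1 W * (- l - wa1 W) - wa2 W.
Proof. by move=> <-; ring. Qed.

End ChordAlgebra.

Section DrinfeldPoint.
Context (R : realType) (F : finFieldType) (W : weierstrass F)
  (C : ultraFieldType R) (iota : {rmorphism F -> C}).
Notation q := #|F|.
Notation WC := (map_w iota W).
Implicit Types (x y : C).

Lemma card_gt1 : (1 < q)%N. Proof. exact: finNzRing_gt1. Qed.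

Ltac qlia := generalize card_gt1; generalize #|F|; clear; lia.

Lemma uabs_lin_le x : 1 <= uabs x :> R -> uabs (wlin WC x) <= uabs x :> R.
Proof.
move=> x1; apply: uabsD_le; last exact: le_trans (uabs_iota_le _ _) x1.
by rewrite uabsM ler_piMl ?uabs_ge0// uabs_iota_le.
Qed.

Lemma uabs_cub x : 1 < uabs x :> R -> uabs (wcub WC x) = uabs x ^+ 3 :> R.
Proof.
move=> x1; have x0 : 0 < uabs x :> R by apply: lt_trans x1.
rewrite /wcub -!addrA uabs_dom ?uabsX//.
have b (a : F) n : (n < 3)%N -> uabs (iota a * x ^+ n) < uabs x ^+ 3 :> R.
  move=> n3; apply: (@le_lt_trans _ _ (uabs x ^+ n)); last by rewrite ltr_eXn2l.
  by rewrite uabsM uabsX ler_piMl ?exprn_ge0 ?uabs_ge0// uabs_iota_le.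
apply: uabsD_lt; first exact: b; apply: uabsD_lt; first exact: (b _ 1%N).
by have := b (wa6 W) 0%N isT; rewrite expr0 mulr1.
Qed.

(** Far out, y ^ 2 and x ^ 3 dominate the Weierstrass equation, whence |y| ^ 2 = |x| ^ 3. *)
Lemma far_point_abs x y : on_curve WC x y -> 1 < uabs y :> R -> uabs x < uabs y :> R ->
  let g := uabs y / uabs x in [/\ 1 < g, uabs x = g ^+ 2 & uabs y = g ^+ 3].
Proof.
move=> exy y1 xy g; have y0 : 0 < uabs y :> R by apply: lt_trans y1.
have x1 : 1 < uabs x :> R.
  (* For |x| <= 1 the left side of the equation has absolute value |y| ^ 2 > 1, the right side at
     most 1. *)
  rewrite ltNge; apply/negP => x1.
  have lin1 : uabs (wlin WC x) <= 1 :> R.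
    apply: uabsD_le; last exact: uabs_iota_le.
    by rewrite uabsM -[X in _ <= X](mulr1 1) ler_pM ?uabs_ge0 ?uabs_iota_le.
  have cub1 : uabs (wcub WC x) <= 1 :> R.
    have b (a : C) n : uabs a <= 1 :> R -> uabs (a * x ^+ n) <= 1 :> R.
      move=> a1; rewrite uabsM uabsX -[X in _ <= X](mulr1 1).
      by rewrite ler_pM ?uabs_ge0 ?exprn_ge0 ?uabs_ge0// exprn_ile1 ?uabs_ge0.
    rewrite /wcub; apply: uabsD_le; last exact: uabs_iota_le.
    apply: uabsD_le; last exact: (b _ 1%N (uabs_iota_le _ _)).
    apply: uabsD_le; last exact: b (uabs_iota_le _ _).
    by rewrite -[x ^+ 3]mul1r b// uabs1.
  have := uabs_dom (x := y ^+ 2) (y := wlin WC x * y); rewrite exy => h.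
  have : uabs (wlin WC x * y) < uabs (y ^+ 2) :> R.
    rewrite uabsM uabsX expr2 ltr_pM2r//; exact: le_lt_trans lin1 y1.
  move/h => e; move: cub1; rewrite e uabsX leNgt => /negP; apply.
  by rewrite exprn_egt1.
have x0 : 0 < uabs x :> R by apply: lt_trans x1.
have e : uabs y ^+ 2 = uabs x ^+ 3.
  rewrite -uabs_cub// -exy uabs_dom ?uabsX// uabsM expr2 ltr_pM2r//.
  exact: le_lt_trans (uabs_lin_le (ltW x1)) xy.
have gx : uabs x = g ^+ 2.
  by rewrite /g expr_div_n e exprS mulfK// expf_neq0// gt_eqF.
split => //; first by rewrite ltr_pdivlMr// mul1r.
by rewrite exprS -gx /g divfK// gt_eqF.
Qed.

Context (theta eta alpha beta : C).
Hypothesis C_inf : is_Cinf W iota theta eta.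
Hypothesis V_def : is_drinfeld_point W iota theta eta alpha beta.
Notation Q := (q%:R : R).
Notation m := (shtuka_slope F theta eta alpha beta).

Lemma Q_gt1 : 1 < Q. Proof. by rewrite ltr1n card_gt1. Qed.
Let Q1 := Q_gt1.
Let Q0 : 0 < Q. Proof. exact: lt_trans Q1. Qed.

(** The formal group condition only puts V far out: |alpha| = g ^ 2 and |beta| = g ^ 3 for some g >
    1. The addition formula then gives |theta| = g ^ 2, which fixes g = Q. *)
Lemma drinfeld_abs : [/\ uabs alpha = Q ^+ 2, uabs beta = Q ^+ 3 &
  chord W iota theta eta alpha beta (alpha ^+ q) (beta ^+ q) m].
Proof.
have [[ab b0 [_ ab1] [_ b1]] add] := V_def.
have [eXi thQ etQ _ _ _] := C_inf.
have be1 : 1 < uabs beta :> R.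
  have b00 : 0 < uabs beta :> R by rewrite uabs_gt0.
  by move: b1; rewrite mulN1r uabsN uabsV invf_lt1.
have albe : uabs alpha < uabs beta :> R.
  by move: ab1; rewrite mulNr uabsN uabsM uabsV ltr_pdivrMr ?mul1r ?uabs_gt0.
have [g1 ag bg] := far_point_abs ab be1 albe; set g := uabs beta / uabs alpha in g1 ag bg.
have g0 : 0 < g by apply: lt_trans g1.
have gq n k : (n < k)%N -> g ^+ n < g ^+ k by move=> nk; rewrite ltr_eXn2l.
have cq := card_gt1.
set x1 := alpha; set y1 := beta; set x2 := alpha ^+ q.
pose y2 := - beta ^+ q - wa1 WC * x2 - wa3 WC.
have abq : on_curve WC x2 (beta ^+ q) by have := frob_on_curve 1 ab; rewrite expn1.
have c2 : on_curve WC x2 y2 := wneg_on_curve abq.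
have x2g : uabs x2 = g ^+ (2 * q) by rewrite uabsX ag exprM.
have bqg : uabs (beta ^+ q) = g ^+ (3 * q) by rewrite uabsX bg exprM.
have y2g : uabs y2 = g ^+ (3 * q).
  rewrite /y2 -addrA -opprD -[wa1 WC * x2 + _]/(wlin WC x2) uabs_dom ?uabsN ?bqg//.
  apply: (@le_lt_trans _ _ (uabs x2)).
    by apply: uabs_lin_le; rewrite x2g exprn_ege1// ltW.
  by rewrite x2g; apply: gq; qlia.
have x12g : uabs (x2 - x1) = g ^+ (2 * q) by rewrite uabs_dom ?uabsN ?x2g ?ag//; apply: gq; qlia.
have x12 : x1 == x2 = false.
  apply/eqP => e; move: x12g; rewrite e subrr uabs0 => /eqP.
  by rewrite eq_sym expf_eq0 gt_eqF ?andbF.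
have x120 : x2 - x1 != 0 by rewrite subr_eq0 eq_sym x12.
move: add; rewrite /wneg /wadd -/x1 -/x2 -/y1 -/y2 x12 /=.
set l := (y2 - y1) / (x2 - x1) => -[thE etE].
have lE : l * (x2 - x1) = y2 - y1 by rewrite divfK.
have key := wadd_abscissa ab c2 lE; rewrite thE in key.
have n2 : uabs (2 : C) <= 1 :> R.
  by rewrite -(rmorph_nat iota) uabs_iota_le.
have big k n x : (n < k)%N -> uabs x = g ^+ n -> uabs x < g ^+ k.
  by move=> nk ->; apply: gq.
have sm k (a x : C) : uabs a <= 1 :> R -> uabs x < g ^+ k -> uabs (a * x) < g ^+ k.
  by move=> a1 xk; rewrite uabsM; apply: le_lt_trans xk; rewrite ler_piMl ?uabs_ge0.
have i1 (a : F) := uabs_iota_le iota a.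
(* [x1 * x2 ^+ 2] has size g ^ (4 q + 2), and each further term of [key] is strictly smaller. *)
have thg : uabs theta = g ^+ 2.
  have : uabs ((x2 - x1) ^+ 2 * theta) = g ^+ (4 * q + 2).
    rewrite key uabs_dom uabsM uabsX x2g ag.
      by rewrite -exprM -exprD; congr (_ ^+ _); qlia.
    have -> : g ^+ 2 * (g ^+ (2 * q)) ^+ 2 = g ^+ (4 * q + 2).
      by rewrite -exprM -exprD; congr (_ ^+ _); qlia.
    apply: uabsD_lt.
      by apply: (@big _ (4 + 2 * q)%N); [qlia|rewrite uabsM uabsX ag x2g -exprM exprD].
    apply: uabsD_lt.
      rewrite uabsN; apply: sm => //.
      by apply: (@big _ (3 + 3 * q)%N); [qlia|rewrite uabsM bg y2g exprD].
    apply: uabsD_lt.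
      rewrite uabsN; apply: sm; first exact: i1.
      by apply: (@big _ (3 * q + 2)%N); [qlia|rewrite uabsM ag y2g exprD].
    apply: uabsD_lt.
      rewrite uabsN; apply: sm; first exact: i1.
      by apply: (@big _ (3 + 2 * q)%N); [qlia|rewrite uabsM bg x2g exprD].
    apply: uabsD_lt.
      apply: (sm) => //; apply: sm; first exact: i1.
      by apply: (@big _ (2 + 2 * q)%N); [qlia|rewrite uabsM ag x2g exprD].
    apply: uabsD_lt.
      by rewrite uabsN; apply: sm; [exact: i1|]; apply: big bg; qlia.
    apply: uabsD_lt.
      by rewrite uabsN; apply: sm; [exact: i1|]; apply: big y2g; qlia.
    apply: uabsD_lt.
      by apply: sm; [exact: i1|]; apply: big ag; qlia.
    apply: uabsD_lt.
      by apply: sm; [exact: i1|]; apply: big x2g; qlia.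
    by apply: sm => //; apply: (le_lt_trans (i1 _)); rewrite exprn_egt1//; qlia.
  rewrite uabsM uabsX x12g -exprM => e.
  have gn : g ^+ (2 * q * 2) != 0 by rewrite expf_neq0// gt_eqF.
  by apply: (mulfI gn); rewrite e -exprD; congr (_ ^+ _); qlia.
have gQ : g = Q.
  by apply/eqP; rewrite -(@eqrXn2 _ 2) ?(ltW g0) ?(ltW Q0)// -thg -thQ.
have thal : theta != alpha ^+ q.
  apply/eqP => e; have := x2g; rewrite /x2 -e thg => /eqP; rewrite lt_eqF//.
  by apply: gq; qlia.
have ybE : beta ^+ q = - y2 - wa1 WC * x2 - wa3 WC.
  by rewrite /y2; move: (beta ^+ q) (wa1 WC * x2) => b c; ring.
have etE' : eta = - (l + wa1 WC) * theta - (y1 - l * x1) - wa3 WC by rewrite -thE -etE.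
have [sl1 sl2] := opposite_slope lE etE'; rewrite -ybE in sl1.
have mE : m = - l - wa1 WC.
  have d0 : theta - alpha ^+ q != 0 by rewrite subr_eq0.
  by apply: (mulIf d0); rewrite /shtuka_slope divfK.
split; rewrite ?ag ?bg ?gQ//; split => //.
- by rewrite /shtuka_slope divfK// subr_eq0.
- by rewrite mE.
- by rewrite mE; apply: slope_quadratic.
Qed.

End DrinfeldPoint.

Section TLin.
Context (R : realType) (F : finFieldType) (W : weierstrass F)
  (C : ultraFieldType R) (iota : {rmorphism F -> C}).
Hypothesis cpl : ucomplete C.
Notation TY := (tateY W iota).
Notation tyc := (tyc W iota).
Notation tyt := (tyt W iota).
Notation tyy := (tyy W iota).

Definition tlin (x : C) : TY := tyt - tyc x.

Lemma tycD x y : tyc (x + y) = tyc x + tyc y.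
Proof. by rewrite /Defs.tyc !rmorphD. Qed.
Lemma tycN x : tyc (- x) = - tyc x.
Proof. by rewrite /Defs.tyc !rmorphN. Qed.
Lemma tycM x y : tyc (x * y) = tyc x * tyc y.
Proof. by rewrite /Defs.tyc !rmorphM. Qed.
Lemma tyc1 : tyc 1 = 1. Proof. by rewrite /Defs.tyc !rmorph1. Qed.
Lemma tyc_mulV x : x != 0 -> tyc x * tyc x^-1 = 1.
Proof. by move=> x0; rewrite -tycM divff// tyc1. Qed.
Lemma tyc_unit x : x != 0 -> tyc x \is a GRing.unit.
Proof. by move/tyc_mulV/wext_unitI. Qed.

Section Radius.
Variables (r s : R).
Hypotheses (r1 : 1 <= r) (s0 : 0 < s) (sr : s * r <= 1) (ssr : s ^+ 2 * r ^+ 3 <= 1).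
Let UB := nbY_ultra W iota cpl r1 s0 sr ssr.

Lemma nbY_t_div x k : r <= k * uabs x -> x != 0 -> nbY r s k (tyt * tyc x^-1).
Proof.
move=> h x0; have x00 : 0 < uabs x :> R by rewrite uabs_gt0.
have := ballM UB (nbY_t W iota cpl r1 s0) (nbY_cst W iota cpl r1 s0 (lexx (uabs x^-1))).
by apply: (ballW UB); rewrite uabsV ler_pdivrMr.
Qed.

Lemma tlin_inv x : r < uabs x -> exists v, tlin x * v = 1 /\ exists M, nbY r s M v.
Proof.
move=> rx; have r0 : 0 < r by apply: lt_le_trans r1.
have x00 : 0 < uabs x :> R by apply: lt_trans rx.
have x0 : x != 0 by rewrite -(uabs_gt0 (R := R)).
have k1 : r / uabs x < 1 by rewrite ltr_pdivrMr// mul1r.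
have bt : nbY r s (r / uabs x) (tyt * tyc x^-1).
  by apply: nbY_t_div => //; rewrite divfK// gt_eqF.
have [h [h1 h2]] := ball_geo_inv UB k1 bt.
exists (- (tyc x^-1 * h)); split.
  rewrite -h1 /tlin mulrN -mulNr opprB mulrA; congr (_ * h).
  by rewrite mulrBl tyc_mulV.
exists (uabs x^-1 * 1); apply: (ballN UB); apply: (ballM UB).
  exact: (nbY_cst W iota cpl r1 s0).
rewrite -(subrK 1 h); apply: (ballD UB); last exact: (ball1 UB).
by apply: (ballW UB) h2; apply: ltW.
Qed.

End Radius.

Lemma tlin_unit x : 1 < uabs x :> R -> tlin x \is a GRing.unit.
Proof.
move=> x1; have [||||v [/wext_unitI]] := @tlin_inv 1 1 _ _ _ _ x x1 => //.
Qed.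

Definition line_fun (th et m : C) : TY := tyy - tyc et - tyc m * (tyt - tyc th).

Lemma line_fun_norm th et al be al' be' m : chord W iota th et al be al' be' m ->
  line_fun th et m * wconj (line_fun th et m) = - (tlin th * tlin al * tlin al').
Proof.
move=> D; rewrite mul_wconj.
pose Y : tate C := tate_cst et + tate_cst m * (tate_var - tate_cst th).
have h : cubT W iota - Y ^+ 2 - linT W iota * Y = (tate_var - tate_cst th) *
    (tate_var - tate_cst al) * (tate_var - tate_cst al').
  refine (chord_norm D (@tate_cst R C) tate_var).
have reE : wre (line_fun th et m) = - Y.
  by rewrite /line_fun !(wreD, wreN, wreM) wre_gen !wre_cst wim_cst /Y; ring.
have imE : wim (line_fun th et m) = 1.
  by rewrite /line_fun !(wimD, wimN, wimM) wim_gen !wim_cst; ring.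
have -> : tlin th * tlin al * tlin al' =
    wcst ((tate_var - tate_cst th) * (tate_var - tate_cst al) * (tate_var - tate_cst al')).
  by rewrite !rmorphM !rmorphB.
rewrite -rmorphN; congr wcst; rewrite -h /wnorm reE imE -/(linT W iota) -/(cubT W iota); ring.
Qed.

(** Its norm is, up to sign, a product of three units. *)
Lemma line_fun_unit th et al be al' be' m : chord W iota th et al be al' be' m ->
  1 < uabs th :> R -> 1 < uabs al :> R -> 1 < uabs al' :> R ->
  line_fun th et m \is a GRing.unit.
Proof.
move=> /line_fun_norm h h1 h2 h3.
have : line_fun th et m * wconj (line_fun th et m) \is a GRing.unit.
  by rewrite h unitrN !unitrM !tlin_unit.
by rewrite unitrM => /andP[].
Qed.

End TLin.

(** * The product for omega *)

Section OmegaProduct.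
Context (R : realType) (F : finFieldType) (W : weierstrass F)
  (C : ultraFieldType R) (iota : {rmorphism F -> C}).
Context (theta eta alpha beta : C).
Hypothesis C_inf : is_Cinf W iota theta eta.
Hypothesis V_def : is_drinfeld_point W iota theta eta alpha beta.
Notation q := #|F|.
Notation Q := (q%:R : R).
Notation m := (shtuka_slope F theta eta alpha beta).
Notation xi := (shtuka_xi F theta eta alpha beta).
Notation WC := (map_w iota W).
Notation TY := (tateY W iota).
Notation tyc := (tyc W iota).
Notation tyt := (tyt W iota).
Notation tyy := (tyy W iota).
Notation fr k x := (x ^+ (q ^ k)).
Let cpl : ucomplete C := Cinf_complete C_inf.
Let Q1 : 1 < Q := Q_gt1 R F.
Let Q0 : 0 < Q. Proof. exact: lt_trans Q1. Qed.
Let al_abs : uabs alpha = Q ^+ 2. Proof. by have [] := drinfeld_abs C_inf V_def. Qed.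
Let be_abs : uabs beta = Q ^+ 3. Proof. by have [] := drinfeld_abs C_inf V_def. Qed.
Let th_abs : uabs theta = Q ^+ 2 := Cinf_theta C_inf.
Let et_abs : uabs eta = Q ^+ 3 := Cinf_eta C_inf.

Ltac qlia := generalize (card_gt1 F); generalize #|F|; clear; lia.

Lemma QX_lt n k : (n < k)%N -> Q ^+ n < Q ^+ k.
Proof. by move=> nk; rewrite ltr_eXn2l. Qed.
Lemma QX_le n k : (n <= k)%N -> Q ^+ n <= Q ^+ k.
Proof. by move=> nk; rewrite ler_eXn2l. Qed.

Lemma frob_abs k (x : C) n : uabs x = Q ^+ n -> uabs (fr k x) = Q ^+ (n * q ^ k).
Proof. by move=> h; rewrite uabsX h exprM. Qed.

Lemma slope_abs : uabs m = Q ^+ q.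
Proof.
have cq := card_gt1 F; have aq : uabs (alpha ^+ q) = Q ^+ (2 * q) by rewrite uabsX al_abs exprM.
have bq : uabs (beta ^+ q) = Q ^+ (3 * q) by rewrite uabsX be_abs exprM.
rewrite uabsM uabsV uabs_distC uabs_dom; last first.
  by rewrite uabsN bq et_abs; apply: QX_lt; qlia.
rewrite uabs_distC uabs_dom; last by rewrite uabsN aq th_abs; apply: QX_lt; qlia.
have -> : uabs (beta ^+ q) = Q ^+ q * Q ^+ (2 * q) by rewrite bq -exprD; congr (_ ^+ _); qlia.
by rewrite aq mulfK// expf_neq0// gt_eqF.
Qed.

Lemma xi_abs : uabs xi = Q ^+ q.
Proof.
have cq := card_gt1 F; rewrite uabsN uabs_dom slope_abs//.
rewrite uabsM uabsV be_abs al_abs exprSr mulrC mulKf ?expf_neq0 ?gt_eqF//.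
by rewrite -{1}(expr1 Q); apply: QX_lt.
Qed.

Lemma chord_frob k : chord W iota (fr k theta) (fr k eta) (fr k alpha) (fr k beta)
  (fr k.+1 alpha) (fr k.+1 beta) (fr k m).
Proof.
have [_ _ [h1 h2 h3 h4 h5 h6 h7]] := drinfeld_abs C_inf V_def.
rewrite expnS !exprM; have on := frob_on_curve k (W := W) (iota := iota).
have fb := frobB iota k; have fd := frobD iota k; have fn := frobN iota k.
split; try exact: on.
- by rewrite -!fb h4 exprMn.
- rewrite -(frob_lin W iota) -fn -!fb h5 exprMn; congr (_ * _).
- rewrite -!fd h6 fb fd /=; congr (_ + _ - _); last exact: frob_iota.
    exact: exprAC.
  by rewrite exprMn frob_iota.
- by apply/eqP => /(frob_inj iota)/eqP; rewrite (negPf h7).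
Qed.

Definition nu k : TY := line_fun W iota (fr k theta) (fr k eta) (fr k m).
Definition del k : TY := tlin W iota (fr k alpha).

Lemma nu_twist k : twist k (shtuka_nu W iota theta eta alpha beta) = nu k.
Proof. by rewrite /nu /line_fun /shtuka_nu !(twistB, twistM, twist_cst, twist_t, twist_y). Qed.

Lemma del_twist k : twist k (shtuka_delta W iota alpha) = del k.
Proof. by rewrite /del /tlin /shtuka_delta !(twistB, twist_cst, twist_t). Qed.

Lemma fr_abs_gt1 k (x : C) n : (0 < n)%N -> uabs x = Q ^+ n -> 1 < uabs (fr k x) :> R.
Proof.
move=> n0 h; rewrite uabsX h -exprM exprn_egt1//.
by rewrite -lt0n muln_gt0 n0 card_expn_gt0.
Qed.

Lemma del_unit k : del k \is a GRing.unit.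
Proof. by apply: (tlin_unit W iota cpl); exact: fr_abs_gt1 al_abs. Qed.

Lemma nu_unit k : nu k \is a GRing.unit.
Proof.
apply: (line_fun_unit cpl (chord_frob k)).
- exact: fr_abs_gt1 th_abs.
- exact: fr_abs_gt1 al_abs.
- exact: fr_abs_gt1 al_abs.
Qed.

Lemma f_twist k : twist k (shtuka_f W iota theta eta alpha beta) = nu k / del k.
Proof.
have du : shtuka_delta W iota alpha \is a GRing.unit by exact: (del_unit 0).
by rewrite /shtuka_f (twist_div k (shtuka_nu W iota theta eta alpha beta) du)
  nu_twist del_twist.
Qed.

(* The disc of radius r contains theta, with |theta| = Q ^ 2, in its interior. *)
Let r : R := Q ^+ 3.
(** 5 is the least integer e with 2 e >= 9, as [ssr_le1] demands for r = Q ^ 3. *)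
Let s : R := Q ^- 5.
Lemma r_ge1 : 1 <= r. Proof. by rewrite exprn_ege1// ltW. Qed.
Lemma s_gt0 : 0 < s. Proof. by rewrite invr_gt0 exprn_gt0. Qed.
Lemma s_le1 : s <= 1. Proof. by rewrite invf_le1 ?exprn_gt0// exprn_ege1// ltW. Qed.
Lemma sr_le1 : s * r <= 1.
Proof. by rewrite mulrC ler_pdivrMr ?exprn_gt0// mul1r; apply: QX_le. Qed.
Lemma ssr_le1 : s ^+ 2 * r ^+ 3 <= 1.
Proof.
by rewrite mulrC /s exprVn -!exprM ler_pdivrMr ?exprn_gt0// mul1r; apply: QX_le.
Qed.
Definition nbY_rs_ultra := nbY_ultra W iota cpl r_ge1 s_gt0 sr_le1 ssr_le1.
Let UB : ultra_ball (nbY r s) := nbY_rs_ultra.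

Let factor k : TY := tyc (xi ^+ (q ^ k)) / twist k (shtuka_f W iota theta eta alpha beta).

Lemma xi_neq0 : xi != 0.
Proof. by rewrite -(uabs_gt0 (R := R)) xi_abs exprn_gt0. Qed.
Lemma alpha_neq0 : alpha != 0.
Proof. by rewrite -(uabs_gt0 (R := R)) al_abs exprn_gt0. Qed.

Lemma frob_card_ge k : (k + 2 <= 2 * q ^ k)%N.
Proof.
elim: k => [|k IH]; first by [].
rewrite expnS; move: (card_gt1 F) IH; move: (q ^ k)%N => a; move: #|F| => b; clear; nia.
Qed.

Ltac njlia := match goal with H : is_true (1 < _)%N, H1 : is_true (_ + 2 <= _)%N, j := _ |- _ =>
  move: H H1; rewrite ?/j; generalize (q ^ j)%N; generalize #|F|; clear; nia end.

(** With j = k + 1 and A = alpha^(j), nu^(j) = - xi^(j) A (1 - a) and delta^(j) = - A (1 - t / A),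
    so the factor is (1 - t / A) / (1 - a). On the disc both t / A and a have norm at most Q ^ (-
    j). *)
Lemma factor_bound k : nbY r s (Q^-1 ^+ k.+1) (factor k.+1 - 1).
Proof.
set j := k.+1; have cq := card_gt1 F; have qk := frob_card_ge k.
have qj : (k + 2 <= q ^ j)%N by rewrite /j expnS; move: cq qk; move: (q ^ k)%N => a; move: #|F| => b; clear; nia.
set A := fr j alpha; set X := fr j xi; set M := fr j m.
have A0 : A != 0 by rewrite expf_neq0// alpha_neq0.
have X0 : X != 0 by rewrite expf_neq0// xi_neq0.
have Aabs : uabs A = Q ^+ (2 * q ^ j) := frob_abs j al_abs.
have Xabs : uabs X = Q ^+ (q * q ^ j) := frob_abs j xi_abs.
have Mabs : uabs M = Q ^+ (q * q ^ j) := frob_abs j slope_abs.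
have kap : Q^-1 ^+ j = (Q ^+ j)^-1 by rewrite exprVn.
set l := wlin WC A.
have l1 : uabs l <= uabs A :> R.
  by apply: uabs_lin_le; rewrite Aabs exprn_ege1// ltW.
(* By definition of xi, X A = - (M A + beta^(j)), and the line passes through - V^(j); together
   these write the constant term of nu^(j) as - X A up to the much smaller [l]. *)
have nuE : nu j = tyy - tyc M * tyt + tyc l - tyc X * tyc A.
  have XA : X * A = - (M * A + fr j beta).
    rewrite -exprMn -(exprMn (q ^ j)%N m) -(frobD iota) -(frobN iota); congr (fr j _).
    by rewrite /shtuka_xi mulNr mulrDl divfK// alpha_neq0.
  have := chord5 (chord_frob j); rewrite -/A -/M -/l => e.
  have e' : - fr j eta + M * fr j theta = l - X * A.
    have -> : - fr j eta = M * (A - fr j theta) + fr j beta + l by rewrite -e; ring.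
    by rewrite XA; ring.
  have E : tyc l - tyc X * tyc A = - tyc (fr j eta) + tyc M * tyc (fr j theta).
    by rewrite -!tycM -!tycN -!tycD e'.
  rewrite -addrA E /nu /line_fun -/M; ring.
pose a := (tyy - tyc M * tyt + tyc l) * (tyc (X * A)^-1).
have b2 : nbY r s (Q^-1 ^+ j) (tyt * tyc A^-1).
  apply: (nbY_t_div W iota cpl r_ge1 s_gt0 sr_le1 ssr_le1) => //.
  rewrite kap Aabs mulrC ler_pdivlMr ?exprn_gt0// /r -exprD; apply: QX_le; njlia.
have b1 : nbY r s (Q^-1 ^+ j) a.
  have XAi : uabs (X * A)^-1 = (Q ^+ (q * q ^ j + 2 * q ^ j))^-1.
    by rewrite uabsV uabsM Xabs Aabs exprD.
  rewrite /a mulrDl mulrBl; apply: (ballD UB); first apply: (ballB UB).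
  - apply: (ballW UB) (ballM UB (nbY_y W iota cpl r_ge1 s_gt0) (nbY_cst W iota cpl r_ge1 s_gt0 (lexx _))).
    rewrite kap XAi invrK mulrC ler_pdivrMl ?exprn_gt0// ler_pdivlMr ?exprn_gt0// -exprD.
    apply: QX_le; njlia.
  (* |m^(j)| = |xi^(j)|, so this term is as small as t / A. *)
  - have -> : tyc M * tyt * tyc (X * A)^-1 = tyc (M / X) * (tyt * tyc A^-1).
      by rewrite invfM !tycM; ring.
    rewrite -[Q^-1 ^+ j]mul1r; apply: (ballM UB) => //; apply: (nbY_cst W iota cpl r_ge1 s_gt0).
    by rewrite uabsM uabsV Mabs Xabs divff// expf_neq0// gt_eqF.
  - rewrite -tycM; apply: (nbY_cst W iota cpl r_ge1 s_gt0).
    rewrite kap uabsM uabsV uabsM.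
    have A00 : 0 < uabs A :> R by rewrite uabs_gt0.
    have X00 : 0 < uabs X :> R by rewrite uabs_gt0.
    apply: (@le_trans _ _ (uabs X)^-1).
      by rewrite invfM mulrCA ler_piMr ?invr_ge0 ?uabs_ge0// ler_pdivrMr// mul1r.
    rewrite lef_pV2 ?posrE ?exprn_gt0// Xabs; apply: QX_le; njlia.
have k1 : Q^-1 ^+ j < 1 by rewrite kap invf_lt1 ?exprn_gt0// exprn_egt1.
have [h [h1 h2]] := ball_geo_inv UB k1 b1.
have -> : factor j = (1 - tyt * tyc A^-1) * h.
  rewrite /factor f_twist invrM ?unitrV ?del_unit ?nu_unit// invrK.
  apply: (mulIr (nu_unit j)); rewrite mulrA divrK ?nu_unit// [LHS]mulrC -/X.
  have -> : nu j = - (tyc (X * A)) * (1 - a).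
    have aE : tyc (X * A) * a = tyy - tyc M * tyt + tyc l.
      by rewrite /a mulrCA tyc_mulV ?mulr1// mulf_neq0.
    have -> : - tyc (X * A) * (1 - a) = tyc (X * A) * a - tyc (X * A) by ring.
    by rewrite aE nuE tycM.
  have -> : del j * tyc X = - tyc X * tyc A * (1 - tyt * tyc A^-1).
    have -> : - tyc X * tyc A * (1 - tyt * tyc A^-1) =
        - tyc X * tyc A + tyc X * tyt * (tyc A * tyc A^-1) by ring.
    by rewrite tyc_mulV// /del /tlin -/A; ring.
  have -> : (1 - tyt * tyc A^-1) * h * (- tyc (X * A) * (1 - a)) =
    - tyc X * tyc A * (1 - tyt * tyc A^-1) * ((1 - a) * h) by rewrite tycM; ring.
  by rewrite h1 mulr1.
have -> : (1 - tyt * tyc A^-1) * h - 1 = (h - 1) - tyt * tyc A^-1 * h by ring.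
apply: (ballB UB) => //; rewrite -[Q^-1 ^+ j]mulr1; apply: (ballM UB) => //.
rewrite -(subrK 1 h); apply: (ballD UB); last exact: (ball1 UB).
by apply: (ballW UB) h2; apply: ltW.
Qed.

Lemma blim_gauss (u : nat -> TY) g : blim (nbY r s) u g -> blim (nbY 1 1) u g.
Proof.
move=> h e /h [N hN]; exists N => n /hN; apply: nbY_gauss => //; [exact: r_ge1|exact: s_le1].
Qed.

(** The factor at 0 is split off because f vanishes at Xi, which lies in the disc of radius r; the
    product of the other factors is close to 1 there, hence invertible. *)
Lemma omega_product : exists Pi Pi' : TY,
  [/\ nbY r s 1 Pi, nbY r s 1 Pi', Pi * Pi' = 1,
      blim (nbY r s) (fun n => \prod_(i < n) factor i.+1) Pi /\
      (forall n, nbY r s 1 (\prod_(i < n) factor i.+1)) &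
      forall zeta, omega_rho W iota theta eta alpha beta zeta =
        tyc zeta * (factor 0 * Pi)].
Proof.
have k0 : 0 <= Q^-1 by rewrite invr_ge0 ltW.
have k1 : Q^-1 < 1 by rewrite invf_lt1.
have [Pi lPi [bPi bP]] := ball_inf_prod UB k0 k1 factor_bound.
have e n : \prod_(i < n) (1 + (factor i.+1 - 1)) = \prod_(i < n) factor i.+1.
  by apply: eq_bigr => i _; rewrite addrC subrK.
have lP : blim (nbY r s) (fun n => \prod_(i < n) factor i.+1) Pi.
  by apply: blim_eq lPi => n; rewrite e.
have [Pi' [h1 h2]] := ball_geo_inv UB k1 (ballN UB bPi).
have one (g : TY) : nbY r s Q^-1 (g - 1) -> nbY r s 1 g.
  move=> hg; have -> : g = (g - 1) + 1 by rewrite subrK.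
  apply: (ballD UB); last exact: (ball1 UB).
  by apply: (ballW UB) hg; apply: ltW.
exists Pi, Pi'; split; [exact: one|exact: one| | |].
- by rewrite -h1; congr (_ * _); rewrite opprK addrC subrK.
- by split => // n; rewrite -e.
move=> zeta; rewrite /omega_rho; congr (_ * _); apply: (tylimE cpl); apply: (iffRL (tycvgP _ _)).
(* From here on only the Gauss norm is available, as [factor 0] has its pole inside the larger
   disc. *)
apply: blim_unshift.
have U1 := nbY1_ultra W iota cpl.
have [M bM] := nbY1_ex (factor 0).
apply: (@blim_eq _ _ _ (fun n => factor 0 * \prod_(i < n) factor i.+1)).
  by move=> n; rewrite big_ord_recl.
apply: (blimM U1).
- by exists M.
- by have [M' bM'] := nbY1_ex Pi; exists M'.
- exact: (blim_cst U1).
- exact: blim_gauss.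
Qed.

End OmegaProduct.

(** * Residues *)

Section LocalParameter.
Context (R : realType) (F : finFieldType) (W : weierstrass F)
  (C : ultraFieldType R) (iota : {rmorphism F -> C}).
Hypothesis cpl : ucomplete C.
Notation T := (tate C).
Notation TY := (tateY W iota).
Notation WC := (map_w iota W).
Notation WT := (map_w (tate_cst \o iota) W).
Implicit Types (x y : C) (f h : T) (g u v w : TY).
Let U1 := nb_ultra cpl (lexx (1 : R)).
Let UC := uball_ultra cpl.

(* In u ^ 2 - b u v - c v ^ 2, with c monic of degree 3, the dominant terms of u ^ 2 and
   c v ^ 2 sit in degrees of different parity, so they cannot cancel. *)
Lemma wnorm_neq0 (r : R) w : 1 < r -> ty_analytic r w -> w != 0 -> wnorm w != 0.
Proof.
move=> r1 [hu hv] w0; have r0 : 0 < r by apply: lt_trans r1.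
have r1' := ltW r1; apply/eqP => n0.
set a := wre w in hu; set b := wim w in hv.
have eqn : a ^+ 2 = cubT W iota * b ^+ 2 + linT W iota * (a * b).
  have -> : a ^+ 2 = wnorm w + (cubT W iota * b ^+ 2 + linT W iota * (a * b)).
    by rewrite /wnorm -/(cubT W iota) -/(linT W iota) -/a -/b; ring.
  by rewrite n0 add0r.
have dc : dom_index r (cubT W iota) 3 /\ uabs (cubT W iota 3%N) * r ^+ 3 = r ^+ 3.
  have c3 : cubT W iota 3%N = 1.
    by rewrite cubT_poly /= /cubP !coefD coefXn !coefCM coefXn coefX coefC /= !mulr0 !addr0.
  rewrite c3 uabs1 mul1r; split => //; split; rewrite ?c3 ?uabs1 ?mul1r ?exprn_gt0//.
    by move=> n; apply: nb_cubT.
  move=> n n3; rewrite cubT_poly /= nth_default ?uabs0 ?mul0r ?exprn_gt0//.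
  exact: leq_trans (size_cubP W iota) n3.
have [b0|b0] := eqVneq b 0.
  have [a0|a0] := eqVneq a 0.
    by move/eqP: w0; apply; apply: wext_eq.
  have [d hd] := dom_index_ex r0 hu a0.
  have [[p _ _] _] := dom_indexM r0 hd hd.
  by move: p; rewrite -expr2 eqn b0 expr2 !mulr0 addr0 tate0E uabs0 mul0r ltxx.
have [e he] := dom_index_ex r0 hv b0.
have [he2 ve2] := dom_indexM r0 he he; rewrite -expr2 in he2 ve2.
have [hcb vcb] := dom_indexM r0 dc.1 he2.
have [a0|a0] := eqVneq a 0.
  have [p _ _] := hcb; move: eqn; rewrite a0 expr2 !mul0r mulr0 addr0 => /esym z.
  by move: p; rewrite z tate0E uabs0 mul0r ltxx.
have [d hd] := dom_index_ex r0 hu a0.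
have [hd2 vd2] := dom_indexM r0 hd hd; rewrite -expr2 in hd2 vd2.
set A := uabs (a d) * r ^+ d in vd2; set B := uabs (b e) * r ^+ e in ve2.
have A0 : 0 < A by case: hd. have B0 : 0 < B by case: he.
rewrite dc.2 ve2 in vcb.
have bl n : uabs ((linT W iota * (a * b)) n) * r ^+ n <= r * (A * B).
  have ha : nb r A a by case: hd. have hb : nb r B b by case: he.
  exact: (nb_mul r1' (nb_linT W iota cpl r1') (nb_mul r1' ha hb)).
have [p2 q2 s2] := hd2. have [p3 q3 s3] := hcb.
have r3 : r ^+ 3 = r * r * r by ring.
set da := (d + d)%N in hd2 vd2 p2 q2 s2; set db := (3 + (e + e))%N in hcb vcb p3 q3 s3.
have E1 n : uabs ((a ^+ 2) n) * r ^+ n <=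
    Num.max (uabs ((cubT W iota * b ^+ 2) n) * r ^+ n) (r * (A * B)).
  rewrite {1}eqn tateDE; apply: (@le_trans _ _ (Num.max (uabs ((cubT W iota * b ^+ 2) n))
    (uabs ((linT W iota * (a * b)) n)) * r ^+ n)).
    by rewrite ler_pM2r ?exprn_gt0// uabsD.
  by rewrite maxr_pMl ?exprn_ge0 ?(ltW r0)// ge_max !le_max lexx bl orbT.
have E2 n : uabs ((cubT W iota * b ^+ 2) n) * r ^+ n <=
    Num.max (uabs ((a ^+ 2) n) * r ^+ n) (r * (A * B)).
  have -> : cubT W iota * b ^+ 2 = a ^+ 2 - linT W iota * (a * b) by rewrite eqn addrK.
  rewrite tateBE; apply: (@le_trans _ _ (Num.max (uabs ((a ^+ 2) n))
    (uabs ((linT W iota * (a * b)) n)) * r ^+ n)).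
    by rewrite ler_pM2r ?exprn_gt0// uabsB.
  by rewrite maxr_pMl ?exprn_ge0 ?(ltW r0)// ge_max !le_max lexx bl orbT.
(* When the mixed term [linT * (a * b)] is as large as one of a ^ 2 and c b ^ 2, that one is
   strictly smaller than the other; so the mixed term never decides a comparison. *)
have lin_small1 : A * A <= r * (A * B) -> A * A < r ^+ 3 * (B * B).
  move=> h; have AB : A <= r * B.
    by rewrite -(ler_pM2l A0); apply: le_trans h _; rewrite mulrCA.
  apply: (@le_lt_trans _ _ (r * B * (r * B))); first by rewrite ler_pM// ltW.
  have -> : r * B * (r * B) = r * r * (B * B) by ring.
  have rr : r * r < r ^+ 3 by rewrite r3 ltr_pMr// mulr_gt0.
  by rewrite ltr_pM2r// mulr_gt0.
have lin_small2 : r ^+ 3 * (B * B) <= r * (A * B) -> r ^+ 3 * (B * B) < A * A.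
  move=> h; have AB : r * r * B <= A.
    rewrite -(ler_pM2l (mulr_gt0 r0 B0)); apply: le_trans (_ : r * (A * B) <= _).
      by apply: le_trans h; rewrite r3 le_eqVlt; apply/orP; left; apply/eqP; ring.
    by rewrite le_eqVlt; apply/orP; left; apply/eqP; ring.
  have rB : 0 <= r * r * B by apply: mulr_ge0; [apply: mulr_ge0|]; apply: ltW.
  apply: (@lt_le_trans _ _ (r * r * B * (r * r * B))); last by apply: (ler_pM rB rB AB AB).
  have -> : r * r * B * (r * r * B) = r ^+ 3 * r * (B * B) by ring.
  by rewrite (ltr_pM2r (mulr_gt0 B0 B0)) (ltr_pMr _ (exprn_gt0 3 r0)).
(* If da < db, then a ^ 2 is below its maximum at index db, which forces |c b ^ 2| < |a ^ 2|, while
   index da forces |a ^ 2| <= |c b ^ 2|. The case da > db is symmetric, and da = db contradicts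
   parity. *)
have [dab|dab|dab] := ltngtP da db.
- have h1 : r ^+ 3 * (B * B) < A * A.
    have := E2 db; rewrite vcb le_max => /orP[h|/lin_small2//].
    by apply: le_lt_trans h _; rewrite -vd2; apply: s2.
  have := E1 da; rewrite vd2 le_max => /orP[h|/lin_small1 h].
    have := lt_le_trans h1 (le_trans h (q3 da)); by rewrite vcb ltxx.
  by have := lt_trans h1 h; rewrite ltxx.
- have h1 : A * A < r ^+ 3 * (B * B).
    have := E1 da; rewrite vd2 le_max => /orP[h|/lin_small1//].
    by apply: le_lt_trans h _; rewrite -vcb; apply: s3.
  have := E2 db; rewrite vcb le_max => /orP[h|/lin_small2 h].
    have := lt_le_trans h1 (le_trans h (q2 db)); by rewrite vd2 ltxx.
  by have := lt_trans h1 h; rewrite ltxx.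
- by move: dab; rewrite /da /db; clear; lia.
Qed.

Lemma tcomp_lin a b f : nb 1 1 f ->
  tcomp (tate_cst a + tate_cst b * tate_var) f = tate_cst a + tate_cst b * f.
Proof.
move=> hf; have h1 := @tends0_1 _ C; have l1 := lexx (1 : R).
rewrite /tcomp (evD cpl U1 (@nb1_cst R C) l1)// (evM cpl U1 (@nb1_cst R C) l1)//.
by rewrite !(ev_cst cpl U1 (@nb1_cst R C) l1)// (ev_var cpl U1 (@nb1_cst R C) l1).
Qed.

Lemma nb1_lin a b : uabs b <= uabs a -> nb 1 (uabs a) (tate_cst a + tate_cst b * tate_var : T).
Proof.
move=> ba; apply: (ballD U1); first exact: nb_cst.
by have := ballM U1 (nb_cst 1 ba) (nb_var C (lexx 1)); rewrite mulr1.
Qed.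

(* x0 + x0 T maps the unit disc onto the disc |x| <= |x0|; past it, only a rescaling
   of the coefficients by powers of s / x0 remains *)
Lemma recenter_inj x0 s f : 1 <= uabs x0 :> R -> s != 0 -> uabs s <= 1 :> R ->
  tends0 (uabs x0 : R) f -> tcomp f (tate_cst x0 + tate_cst s * tate_var) = 0 -> f = 0.
Proof.
move=> x01 s0 s1 hf h0; have x00 : x0 != 0.
  by rewrite -(uabs_gt0 (R := R)); apply: lt_le_trans x01.
have sx : uabs (s / x0) <= 1 :> R.
  rewrite uabsM uabsV ler_pdivrMr ?mul1r ?uabs_gt0//; exact: le_trans s1 x01.
set k := tcomp f (tate_cst x0 + tate_cst x0 * tate_var).
have b1 : nb 1 1 (tate_cst (s / x0) * tate_var : T).
  by have := ballM U1 (nb_cst 1 sx) (nb_var C (lexx 1)); rewrite mulr1.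
have k0 : k = 0.
  apply: tate_eq => n; rewrite tate0E; apply/eqP.
  have : tcomp k (tate_cst (s / x0) * tate_var) n = 0.
    rewrite (tcompA cpl x01)//; last exact: nb1_lin.
    by rewrite tcomp_lin// mulrA -rmorphM /= [x0 * _]mulrC divfK// h0 tate0E.
  rewrite (tcomp_scale cpl)// => /eqP; rewrite mulf_eq0 expf_eq0 mulf_eq0 invr_eq0.
  by rewrite (negPf s0) (negPf x00) andbF orbF.
(* T -> - 1 + T / x0 inverts T -> x0 + x0 T and maps the unit disc into itself because |x0| >= 1; so
   f is recovered from k. *)
have b2 : nb 1 1 (tate_cst (- 1) + tate_cst x0^-1 * tate_var : T).
  have h : uabs x0^-1 <= uabs (-1 : C) :> R.
    by rewrite uabsN uabs1 uabsV invf_le1//; apply: lt_le_trans x01.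
  by have := nb1_lin h; rewrite uabsN uabs1.
have := tcompA cpl x01 hf (nb1_lin (lexx (uabs x0))) b2.
rewrite -/k k0 tcomp_lin//.
have -> : tate_cst x0 + tate_cst x0 * (tate_cst (-1) + tate_cst x0^-1 * tate_var) =
   (tate_var : T).
  rewrite mulrDr mulrA -!rmorphM /= divff// mulrN1 rmorphN rmorph1 mul1r.
  by rewrite addrA subrr add0r.
by rewrite (tcomp_var cpl x01)// /tcomp (ev0 cpl U1 (@nb1_cst R C) (lexx 1)).
Qed.

Lemma tate_var_mulE f n : (tate_var * f) n = if n is k.+1 then f k else 0.
Proof.
rewrite tateME; case: n => [|n]; first by rewrite big_ord1 mul0r.
rewrite big_ord_recl mul0r add0r big_ord_recl /= mul1r subn1 big1 ?addr0// => i _.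
by rewrite mul0r.
Qed.

Lemma tate_varX_mulE f n : (tate_var ^+ n * f) n = f 0%N.
Proof.
elim: n => [|n IH]; first by rewrite mul1r.
by rewrite exprS -mulrA tate_var_mulE.
Qed.

Lemma tate_cst_mulE a f n : (tate_cst a * f) n = a * f n.
Proof.
rewrite tateME big_ord_recl subn0 big1 ?addr0// => i _.
by rewrite /= mul0r.
Qed.

Lemma tate_eval0 f : tate_eval f 0 = f 0%N.
Proof.
have := has_usum_eval cpl (lexx (1 : R)) (tends0_1 f); move/(_ 0).
rewrite uabs0 => /(_ ler01) /blim_ucvg h; apply: (blim_uniq UC h).
apply: (blim_unshift (u := fun n => \sum_(i < n) f i * 0 ^+ i)).
apply: (@blim_eq _ _ _ (fun=> f 0%N)); last exact: (blim_cst UC).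
move=> n; rewrite big_ord_recl expr0 mulr1 big1 ?addr0// => i _.
by rewrite expr0n mulr0.
Qed.

(** Turns a convergent Laurent expansion, after scaling, into an element of the Tate algebra. *)
Lemma has_usum_tate_cond (a : nat -> C) x : has_usum a x -> tate_cond a.
Proof.
move=> /ucvgP h; apply/tate_condP => e /h [N hN]; exists N => n nN.
have -> : a n = (\sum_(i < n.+1) a i - x) - (\sum_(i < n) a i - x).
  by rewrite big_ord_recr /=; ring.
by apply: uabsD_lt; rewrite ?uabsN; apply: hN => //; apply: leqW.
Qed.

Lemma has_usum_uniq (a : nat -> C) x y : has_usum a x -> has_usum a y -> x = y.
Proof. by move=> /blim_ucvg h1 /blim_ucvg h2; apply: (blim_uniq UC h1 h2). Qed.

Section Point.
Variables (x0 y0 : C).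
Hypotheses (e0 : on_curve WC x0 y0) (w0 : wdy WC x0 y0 != 0).
Hypothesis small : forall d : R, 0 < d -> exists2 s : C, s != 0 & uabs s < d.
Notation om := (uabs (wdy WC x0 y0) : R).
Let om0 : 0 < om. Proof. by rewrite uabs_gt0. Qed.

(** Two ordinates over x are equal or satisfy y + y' + wlin x = 0; near (x0, y0) that sum is close
    to wdy(x0, y0) != 0. *)
Lemma near_unique x y y' : on_curve WC x y -> on_curve WC x y' ->
  uabs (x - x0) < om -> uabs (y - y0) < om -> uabs (y' - y0) < om -> y = y'.
Proof.
move=> h h' hx hy hy'; apply/eqP; rewrite -subr_eq0.
have : (y - y') * (y + y' + wlin WC x) == 0.
  have -> : (y - y') * (y + y' + wlin WC x) =
     (y ^+ 2 + wlin WC x * y) - (y' ^+ 2 + wlin WC x * y') by ring.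
  by rewrite h h' subrr.
rewrite mulf_eq0 => /orP[//|/eqP h0]; exfalso.
have h1 : y + y' + wlin WC x = wdy WC x0 y0 + ((y - y0) + ((y' - y0) + wa1 WC * (x - x0))).
  by rewrite /wlin /wdy; ring.
have : uabs (y + y' + wlin WC x) = om.
  rewrite h1 uabs_dom//; apply: uabsD_lt => //; apply: uabsD_lt => //.
  by apply: le_lt_trans hx; rewrite uabsM ler_piMl ?uabs_ge0// uabs_iota_le.
by rewrite h0 uabs0 => /eqP; rewrite lt_eqF.
Qed.

Lemma tate_on_curve_eval (X Y : T) t : on_curve WT X Y -> uabs t <= 1 :> R ->
  on_curve WC (tate_eval X t) (tate_eval Y t).
Proof.
move=> h t1; have h1 := @tends0_1 R C.
have D f k := tate_evalD1 cpl f k t1; have M f k := tate_evalM1 cpl f k t1.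
have E c : tate_eval (tate_cst c : T) t = c by exact: tate_eval_cst.
have X2 (f : T) : tate_eval (f ^+ 2) t = tate_eval f t ^+ 2 by rewrite !expr2 M.
have X3 (f : T) : tate_eval (f ^+ 3) t = tate_eval f t ^+ 3 by rewrite exprS M X2 -exprS.
have := congr1 (fun f => tate_eval f t) h.
rewrite /on_curve /wlin /wcub /= !D X2 X3 !(M (tate_cst _)) !(M (_ + _)) X2 !D.
by rewrite !(M (tate_cst _)) !E.
Qed.

(* for Y = y0 + z the Weierstrass equation is quadratic in z, with the unit wdy(x0, y0)
   as linear coefficient up to a small term *)
Lemma local_param (e : R) : 0 < e -> exists s (Y : T),
  [/\ s != 0, uabs s < e /\ uabs s <= 1 :> R, nb 1 (e / 2) (Y - tate_cst y0) &
      on_curve WT (tate_cst x0 + tate_cst s * tate_var) Y].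
Proof.
move=> e0'; pose k : R := Num.min (e / 2) (Num.min (om / 2) (1 / 2)).
have k0 : 0 < k by rewrite !lt_min !divr_gt0.
have ke : k <= e / 2 by rewrite ge_min lexx.
have kom : k <= om / 2 by rewrite !ge_min lexx orbT.
have k2 : k <= 1 / 2 by rewrite !ge_min lexx !orbT.
have k1 : k < 1 by apply: le_lt_trans k2 _; lra.
(* [K] bounds [fac], the cofactor of h in the Weierstrass equation at (x0 + h, y0). Then |s| < k om
   / K puts the constant term of the fixed-point equation in the ball of radius k. *)
pose K : R := 1 + uabs x0 + uabs x0 ^+ 2 + uabs y0.
have [ax ay] : 0 <= uabs x0 :> R /\ 0 <= uabs y0 :> R by rewrite !uabs_ge0.
have ax2 : 0 <= uabs x0 ^+ 2 :> R by rewrite exprn_ge0.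
have K1 : 1 <= K by rewrite /K; lra.
have K0 : 0 < K by lra.
have d0 : 0 < Num.min e (Num.min 1 (k * om / K)) by rewrite !lt_min e0' ltr01 divr_gt0 ?mulr_gt0.
have [s s0] := small d0; rewrite !lt_min => /andP[se /andP[s1 sk]].
pose h : T := tate_cst s * tate_var.
have hb : nb 1 (uabs s) h.
  by have := ballM U1 (nb_cst 1 (lexx (uabs s))) (nb_var C (lexx 1)); rewrite mulr1.
have h1 : nb 1 1 h by apply: (ballW U1) hb; apply: ltW.
pose a1 : T := tate_cst (iota (wa1 W)); pose a2 : T := tate_cst (iota (wa2 W)).
pose a3 : T := tate_cst (iota (wa3 W)); pose a4 : T := tate_cst (iota (wa4 W)).
pose cx : T := tate_cst x0; pose cy : T := tate_cst y0; pose cw : T := tate_cst (wdy WC x0 y0).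
pose ciw : T := tate_cst (wdy WC x0 y0)^-1.
have cwi : cw * ciw = 1 by rewrite -rmorphM divff ?rmorph1.
pose fac := a1 * cy - ((1 + 2) * cx ^+ 2 + (1 + 2) * (cx * h) + h ^+ 2 + a2 * (2 * cx + h) + a4).
have b1 : nb 1 1 (1 : T) := ball1 U1.
have b2 : nb 1 1 (2 : T) by apply: (ballD U1).
have b3 : nb 1 1 (1 + 2 : T) by apply: (ballD U1).
have ba (a : F) : nb 1 1 (tate_cst (iota a) : T) by apply: nb_cst; apply: uabs_iota_le.
have bm (M : R) (f g : T) : nb 1 1 f -> nb 1 M g -> nb 1 M (f * g).
  by move=> hf hg; rewrite -[M]mul1r; apply: (ballM U1).
have bx : nb 1 (uabs x0) cx by exact: nb_cst.
have bxK : nb 1 K cx by apply: (ballW U1) bx; rewrite /K; lra.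
have bK (f : T) : nb 1 1 f -> nb 1 K f by exact: (ballW U1).
have bfac : nb 1 K fac.
  apply: (ballB U1).
    by apply: (bm _ _ _); [exact: ba|apply: nb_cst; rewrite /K; lra].
  apply: (ballD U1); last by apply: (bK _ _); exact: ba.
  apply: (ballD U1); last first.
    by apply: (bm _ _ _); [exact: ba|apply: (ballD U1); [apply: (bm _ _ _) => //|exact: (bK _ _)]].
  apply: (ballD U1); last by apply: (bK _ _); have := ballX U1 2 h1; rewrite expr1n.
  apply: (ballD U1); apply: (bm _ _ _) => //.
    by apply: (ballW U1) (ballX U1 2 bx); rewrite /K; lra.
  by rewrite mulrC; apply: (bm _ _ _).
have bra : cy ^+ 2 + (a1 * (cx + h) + a3) * cy - wcub WT (cx + h) = h * fac.
  have := congr1 (@tate_cst R C) e0; rewrite /wcub /wlin /=.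
  rewrite !(rmorphD, rmorphM, rmorphXn) /= -/a1 -/a2 -/a3 -/a4 -/cx -/cy => E.
  have -> : cy ^+ 2 + (a1 * (cx + h) + a3) * cy = (cy ^+ 2 + (a1 * cx + a3) * cy) + a1 * h * cy.
    by ring.
  by rewrite E /fac; ring.
have oi : uabs (wdy WC x0 y0)^-1 = om^-1 :> R by rewrite uabsV.
have be : nb 1 k (- (ciw * (h * fac))).
  apply: (ballN U1); apply: (ballW U1) (ballM U1 (nb_cst 1 (lexx _)) (ballM U1 hb bfac)).
  rewrite oi mulrC ler_pdivrMr//; move: sk; rewrite ltr_pdivlMr// => sk; exact: ltW.
have bb : nb 1 k (- (ciw * (a1 * h))).
  apply: (ballN U1); apply: (ballW U1) (ballM U1 (nb_cst 1 (lexx _)) (bm _ _ _ (ba _) hb)).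
  rewrite oi mulrC ler_pdivrMr//; apply: le_trans (ltW sk) _.
  by rewrite ler_pdivrMr// ler_peMr// mulr_ge0// ltW.
have bc : nb 1 om^-1 (- ciw) by apply: (ballN U1); apply: nb_cst; rewrite oi.
have mk : om^-1 * k < 1.
  rewrite mulrC ltr_pdivrMr// mul1r; apply: le_lt_trans kom _.
  by rewrite ltr_pdivrMr// ltr_pMr// ltr1n.
have [z bz ze] := ball_quadratic_fixpoint U1 k0 k1 mk be bb bc.
have zE : cw * z = - (h * fac) - a1 * h * z - z ^+ 2.
  rewrite {1}ze.
  have -> : cw * (- (ciw * (h * fac)) + - (ciw * (a1 * h)) * z + - ciw * z ^+ 2) =
    (cw * ciw) * (- (h * fac) - a1 * h * z - z ^+ 2) by ring.
  by rewrite cwi mul1r.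
have cwE : cw = 2 * cy + a1 * cx + a3.
  by rewrite /cw /wdy !rmorphD !rmorphM /= rmorph_nat.
exists s, (cy + z); split => //; first by split => //; apply: ltW.
  by rewrite addrAC subrr add0r; apply: (ballW U1) bz.
rewrite -/h -/cx /on_curve; apply/eqP; rewrite -subr_eq0; apply/eqP.
have -> : (cy + z) ^+ 2 + wlin WT (cx + h) * (cy + z) - wcub WT (cx + h) =
  (cy ^+ 2 + (a1 * (cx + h) + a3) * cy - wcub WT (cx + h)) + (cw * z + a1 * h * z + z ^+ 2).
  by rewrite cwE /wlin /= -/a1 -/a3; ring.
rewrite bra zE; ring.
Qed.

End Point.

End LocalParameter.

Section Residue.
Context (R : realType) (F : finFieldType) (W : weierstrass F)
  (C : ultraFieldType R) (iota : {rmorphism F -> C}).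
Hypothesis cpl : ucomplete C.
Notation T := (tate C).
Notation TY := (tateY W iota).
Notation WC := (map_w iota W).
Implicit Types (x y : C) (f h : T) (g u v w : TY).
Let U1 := nb_ultra cpl (lexx (1 : R)).

Lemma tyaW (r r' : R) u : 1 <= r -> 0 <= r' -> r' <= r ->
  ty_analytic r u -> ty_analytic r' u.
Proof. by move=> r1 r0 rr [h1 h2]; split; apply: (tends0W r1). Qed.

Section Point.
Variables (x0 y0 : C) (g G : TY) (r : R).
Hypotheses (e0 : on_curve WC x0 y0) (w0 : wdy WC x0 y0 != 0).
Hypotheses (x01 : 1 < uabs x0 :> R) (x0r : uabs x0 < r).
Hypotheses (aG : ty_analytic r G) (gG : tlin W iota x0 * g = G).
Notation om := (uabs (wdy WC x0 y0) : R).

Lemma small_elt (d : R) : 0 < d -> exists2 s : C, s != 0 & uabs s < d.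
Proof.
move=> d0; have x00 : 0 < uabs x0 :> R by apply: lt_trans x01.
have k0 : 0 <= (uabs x0)^-1 :> R by rewrite invr_ge0 ltW.
have k1 : (uabs x0)^-1 < 1 :> R by rewrite invf_lt1.
have d2 : 0 < d / 2 by rewrite divr_gt0.
have [N /(_ N (leqnn N))] := geo_small k0 k1 d2 ler01; rewrite mul1r => h.
exists (x0^-1 ^+ N); first by rewrite expf_neq0// invr_eq0 -(uabs_gt0 (R := R)).
rewrite uabsX uabsV; apply: le_lt_trans h _.
by rewrite ltr_pdivrMr// ltr_pMr// ltr1n.
Qed.

Let om0 : 0 < om. Proof. by rewrite uabs_gt0. Qed.
Let r1 : 1 <= r. Proof. exact: le_trans (ltW x01) (ltW x0r). Qed.

Lemma lin_eval s t : uabs t <= 1 :> R ->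
  tate_eval (tate_cst x0 + tate_cst s * tate_var : T) t = x0 + s * t.
Proof.
move=> t1; have h1 := @tends0_1 R C.
rewrite (tate_evalD cpl (lexx 1))// (tate_evalM cpl (lexx 1))//.
by rewrite !(tate_eval_cst cpl)// (tate_eval_var cpl).
Qed.

Definition laurent_coef (c : nat -> C) : Prop :=
  c 0%N = ty_eval G x0 y0 / wdy WC x0 y0 /\
  exists2 e : R, 0 < e & forall x y, on_curve WC x y -> x != x0 ->
    uabs (x - x0) < e -> uabs (y - y0) < e ->
    has_usum (fun n => c n * (x - x0) ^+ n) (ty_eval G x y / wdy WC x y).

(** Pulled back along the local parametrisation T -> (x0 + s T, Y), G / wdy is a Tate series;
    dividing its n-th coefficient by s ^ n gives the expansion in t - x0. *)
Lemma laurent_coef_ex : exists c, laurent_coef c.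
Proof.
have [s [Y [s0 [s_om s1] Yb XY]]] := local_param cpl e0 w0 small_elt om0.
set X := tate_cst x0 + tate_cst s * tate_var in XY.
pose WD : T := 2 * Y + tate_cst (iota (wa1 W)) * X + tate_cst (iota (wa3 W)).
pose cw : T := tate_cst (wdy WC x0 y0); pose ciw : T := tate_cst (wdy WC x0 y0)^-1.
have cwi : cw * ciw = 1 by rewrite -rmorphM divff ?rmorph1.
have h1 := @tends0_1 R C.
have bX : nb 1 (uabs x0) X.
  by apply: nb1_lin => //; apply: le_trans s1 (ltW x01).
have om2 : om / 2 < om by rewrite ltr_pdivrMr// ltr_pMr// ltr1n.
(* [WD] is wdy along the parametrisation; it differs from the constant wdy(x0, y0) by something of
   smaller absolute value, so the geometric series inverts it. *)
have [h hh] : exists h : T, WD * h = 1.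
  pose u := - (ciw * (2 * (Y - tate_cst y0) + tate_cst (iota (wa1 W)) * (tate_cst s * tate_var))).
  pose k : R := Num.max (om / 2) (uabs s) / om.
  have k1 : k < 1 by rewrite ltr_pdivrMr// mul1r gt_max om2.
  have bu : nb 1 k u.
    apply: (ballN U1).
    have bw : nb 1 om^-1 ciw by apply: nb_cst; rewrite uabsV.
    rewrite /k mulrC; apply: (ballM U1) bw _; apply: (ballD U1).
      rewrite -[Num.max _ _]mul1r; apply: (ballM U1).
        by apply: (ballD U1); apply: (ball1 U1).
      by apply: (ballW U1) Yb; rewrite le_max lexx.
    rewrite -[Num.max _ _]mul1r; apply: (ballM U1).
      by apply: nb_cst; apply: uabs_iota_le.
    have := ballM U1 (nb_cst 1 (lexx (uabs s))) (nb_var C (lexx 1)); rewrite mulr1.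
    by apply: (ballW U1); rewrite le_max lexx orbT.
  have [h [hh _]] := ball_geo_inv U1 k1 bu.
  exists (ciw * h); rewrite -hh mulrA; congr (_ * h).
  have cwE : cw = 2 * tate_cst y0 + tate_cst (iota (wa1 W)) * tate_cst x0 + tate_cst (iota (wa3 W)).
    by rewrite /cw /wdy !rmorphD !rmorphM /= rmorph_nat.
  have -> : WD = cw + (2 * (Y - tate_cst y0) + tate_cst (iota (wa1 W)) * (tate_cst s * tate_var)).
    by rewrite cwE /WD /X; ring.
  by rewrite mulrDl cwi /u opprK mulrC [ciw * _]mulrC.
have [aG1 aG2] : ty_analytic (uabs x0) G := tyaW r1 (uabs_ge0 _) (ltW x0r) aG.
have x01' := ltW x01.
pose gt : T := (tcomp (wre G) X + tcomp (wim G) X * Y) * h.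
have evg t : uabs t <= 1 :> R -> tate_eval gt t =
    ty_eval G (x0 + s * t) (tate_eval Y t) / wdy WC (x0 + s * t) (tate_eval Y t).
  move=> t1.
  have D f k := tate_evalD1 cpl f k t1; have M f k := tate_evalM1 cpl f k t1.
  have E c : tate_eval (tate_cst c : T) t = c by exact: tate_eval_cst.
  have wE : tate_eval WD t = wdy WC (x0 + s * t) (tate_eval Y t).
    rewrite /WD !D !M !E lin_eval//; congr (_ * _ + _ + _).
    by have := E 2; rewrite rmorph_nat.
  have he : wdy WC (x0 + s * t) (tate_eval Y t) * tate_eval h t = 1.
    by rewrite -wE -M hh -(rmorph1 (@tate_cst R C)) E.
  have w1 : wdy WC (x0 + s * t) (tate_eval Y t) != 0.
    by apply/eqP => z; move/eqP: he; rewrite z mul0r eq_sym oner_eq0.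
  rewrite /gt M D M !(tate_eval_comp cpl x01')// lin_eval// /ty_eval.
  by apply: (mulIf w1); rewrite divfK// -mulrA [tate_eval h t * _]mulrC he mulr1.
exists (fun n => gt n / s ^+ n); split.
  rewrite expr0 divr1 -(tate_eval0 cpl) evg ?uabs0// mulr0 addr0.
  (* Y is only known to be near y0; [near_unique] pins its value at 0. *)
  have -> : tate_eval Y 0 = y0.
    have := tate_on_curve_eval cpl XY (t := 0); rewrite uabs0 lin_eval ?uabs0// mulr0 addr0.
    move=> /(_ ler01) on0; apply: (near_unique w0 on0 e0); rewrite ?subrr ?uabs0//.
    apply: le_lt_trans om2.
    have -> : tate_eval Y 0 - y0 = tate_eval (Y - tate_cst y0) 0.
      rewrite (tate_evalD cpl (lexx 1)) ?(tate_evalN cpl (lexx 1)) ?tate_eval_cst ?uabs0//.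
    by apply: (tate_eval_bound cpl (lexx 1)) => //; rewrite ?uabs0// divr_gt0.
  by [].
exists (Num.min om (uabs s)); first by rewrite lt_min om0 uabs_gt0.
move=> x y exy xx; rewrite !lt_min => /andP[hx1 hx2] /andP[hy _].
pose t := (x - x0) / s.
have t1 : uabs t <= 1 :> R by rewrite uabsM uabsV ler_pdivrMr ?uabs_gt0// mul1r ltW.
have xE : x = x0 + s * t by rewrite /t mulrC divfK// addrC subrK.
have yE : y = tate_eval Y t.
  have on1 := tate_on_curve_eval cpl XY t1; rewrite lin_eval// -xE in on1.
  apply: (near_unique w0 exy on1) => //; apply: le_lt_trans om2.
  have -> : tate_eval Y t - y0 = tate_eval (Y - tate_cst y0) t.
    by rewrite (tate_evalD cpl (lexx 1)) ?(tate_evalN cpl (lexx 1)) ?tate_eval_cst.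
  by apply: (tate_eval_bound cpl (lexx 1)) => //; rewrite divr_gt0.
have := has_usum_eval cpl (lexx (1 : R)) (h1 gt) t1; rewrite evg// -xE -yE.
congr has_usum; apply/funext => n.
by rewrite /t expr_div_n mulrA mulrAC.
Qed.

Lemma tlin_eval x y : ty_eval (tlin W iota x0) x y = x - x0.
Proof.
have m1 : 1 <= Num.max 1 (uabs x) :> R by rewrite le_max lexx.
have mx : uabs x <= Num.max 1 (uabs x) by rewrite le_max lexx orbT.
rewrite /tlin (ty_evalB cpl m1 _ mx)//; [|exact: tya_t|exact: tya_cst].
by rewrite (ty_eval_t W iota cpl) (ty_eval_cst W iota cpl).
Qed.

Lemma residue_ex c : laurent_coef c -> is_res_lambda g x0 y0 (c 0%N).
Proof.
move=> [_ [e e0' hc]].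
exists r, G, (tlin W iota x0), 1%N, c; split => //.
  split => //.
    by apply: tyaB => //; [exact: tya_t|exact: tya_cst].
  apply/eqP => /(congr1 (fun u : TY => wre u 1%N)) /eqP.
  by rewrite /tlin /tyt /tyc wreD wreN !wre_cst /= subr0 oner_eq0.
exists e => // x y exy xx hx hy; rewrite tlin_eval expr1.
have := hc x y exy xx hx hy; congr has_usum.
by rewrite [RHS]mulrAC divfK ?subr_eq0.
Qed.

(* H' has no zero on the curve close to (x0, y0), except possibly there, because its norm
   to the Tate algebra has isolated zeros *)
Lemma residue_uniq c r' : laurent_coef c -> is_res_lambda g x0 y0 r' -> r' = c 0%N.
Proof.
move=> [_ [e e0' hc]] [rho [G' [H' [N [c' [rho1 x0rho [aG' aH' H0 HG] [e' e1' hc'] rE]]]]]].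
pose d := Num.min (Num.min e e') (rho - uabs x0).
have [d1 [d2 d3]] : d <= e /\ d <= e' /\ d <= rho - uabs x0.
  by rewrite /d !ge_min !lexx ?orbT.
have d0 : 0 < d by rewrite !lt_min e0' e1' subr_gt0.
have [s [Y [s0 [sd s1] Yb XY]]] := local_param cpl e0 w0 small_elt d0.
set X := tate_cst x0 + tate_cst s * tate_var in XY.
have x01' := ltW x01; have h1 := @tends0_1 R C.
have aHx : ty_analytic (uabs x0) H'.
  exact: tyaW rho1 (uabs_ge0 _) (ltW x0rho) aH'.
have aGx : ty_analytic (uabs x0) G.
  exact: tyaW r1 (uabs_ge0 _) (ltW x0r) aG.
have aGx' : ty_analytic (uabs x0) G'.
  exact: tyaW rho1 (uabs_ge0 _) (ltW x0rho) aG'.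
have bX : nb 1 (uabs x0) X.
  by apply: nb1_lin => //; apply: le_trans s1 (ltW x01).
have n0 := wnorm_neq0 cpl x01 aHx H0.
have an : tends0 (uabs x0) (wnorm H').
  have [] := tyaM cpl x01' aHx (tya_conj cpl x01' aHx).
  by rewrite mul_wconj.
have k0 : tcomp (wnorm H') X != 0.
  by apply: contra_neq n0 => z; apply: (recenter_inj cpl x01' s0 s1 an z).
have [b b0 hb] := tate_isolated_zero cpl k0.
(* Both G / (t - x0) and G' / H' continue g. *)
have rel : H' * G = tlin W iota x0 * G' by rewrite -gG -HG; ring.
have pt t : uabs t <= 1 :> R -> exists x y, [/\ x = x0 + s * t, on_curve WC x y,
    uabs (x - x0) < d, uabs (y - y0) < d & uabs x <= uabs x0].
  move=> t1; exists (x0 + s * t), (tate_eval Y t).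
  have st : uabs (s * t) <= uabs s :> R by rewrite uabsM ler_piMr ?uabs_ge0.
  split => //.
  - by have := tate_on_curve_eval cpl XY t1; rewrite lin_eval.
  - by rewrite addrC addrA addNr add0r; apply: le_lt_trans sd.
  - have -> : tate_eval Y t - y0 = tate_eval (Y - tate_cst y0) t.
      by rewrite (tate_evalD cpl (lexx 1)) ?(tate_evalN cpl (lexx 1)) ?tate_eval_cst.
    apply: (@le_lt_trans _ _ (d / 2)); last by rewrite ltr_pdivrMr// ltr_pMr// ltr1n.
    by apply: (tate_eval_bound cpl (lexx 1)) => //; rewrite divr_gt0.
  - by apply: uabsD_le => //; apply: le_trans st (le_trans s1 x01').
have xx t : t != 0 -> x0 + s * t != x0.
  by move=> t0; rewrite -subr_eq0 addrC addrA addNr add0r mulf_neq0.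
have usC (t : C) : t != 0 -> uabs t <= 1 :> R -> exists x y,
    [/\ has_usum (fun n => c n * (s * t) ^+ n) (ty_eval G x y / wdy WC x y),
        has_usum (fun n => c' n * (s * t) ^+ n)
          (ty_eval G' x y / ty_eval H' x y / wdy WC x y * (s * t) ^+ N) &
        x = x0 + s * t /\ on_curve WC x y /\ uabs x <= uabs x0 :> R].
  move=> t0 t1; have [x [y [xE exy hx hy xr]]] := pt t t1; exists x, y.
  have xs : s * t = x - x0 by rewrite xE addrC addrA addNr add0r.
  have xn : x != x0 by rewrite xE xx.
  split; rewrite ?xs //.
    by apply: hc => //; [exact: lt_le_trans hx d1|exact: lt_le_trans hy d1].
    by apply: hc' => //; [exact: lt_le_trans hx d2|exact: lt_le_trans hy d2].
  by split; rewrite -?xs.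
have one0 : (1 : C) != 0 := oner_neq0 C.
have one1 : uabs (1 : C) <= 1 :> R by rewrite uabs1.
have [x1 [y1 [u1 u2 _]]] := usC 1 one0 one1; rewrite mulr1 in u1 u2.
pose SC : T := Tate (has_usum_tate_cond u1).
pose SC' : T := Tate (has_usum_tate_cond u2).
have evS (a : nat -> C) (h : tate_cond (fun n => a n * s ^+ n)) (t v : C) : uabs t <= 1 :> R ->
    has_usum (fun n => a n * (s * t) ^+ n) v -> tate_eval (Tate h) t = v.
  move=> t1 hv; apply: (has_usum_uniq cpl) hv.
  have := has_usum_eval cpl (lexx (1 : R)) (h1 (Tate h)) t1; congr has_usum.
  by apply/funext => n; rewrite /= exprMn mulrA.
(* With t - x0 = s T, the identity (t - x0) G' / H' = G reads s T S' = s ^ N T ^ N S, where S and S'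
   are the expansions of G and of (t - x0) ^ N G' / H', both divided by wdy. Coefficient N compares
   the two residues. *)
pose D : T := tate_cst s * (tate_var * SC') - tate_cst (s ^+ N) * (tate_var ^+ N * SC).
have D0 : D = 0.
  apply/eqP; apply: contraT => /(tate_isolated_zero cpl) [b' b'0 hb'].
  have m0 : 0 < Num.min 1 (Num.min b b') by rewrite !lt_min ltr01 b0.
  have [t t0] := small_elt m0; rewrite !lt_min => /andP[/ltW t1 /andP[tb tb']].
  suff z : tate_eval D t = 0 by have := hb' t t0 tb'; rewrite z eqxx.
  have [x [y [v1 v2 [xE [exy xr]]]]] := usC t t0 t1.
  have De f k := tate_evalD1 cpl f k t1; have Me f k := tate_evalM1 cpl f k t1.
  have Ec a : tate_eval (tate_cst a : T) t = a by exact: tate_eval_cst.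
  have Ev n : tate_eval ((tate_var : T) ^+ n) t = t ^+ n.
    elim: n => [|n IH]; last by rewrite !exprS Me IH tate_eval_var.
    by rewrite expr0 -(rmorph1 (@tate_cst R C)) Ec.
  rewrite De (tate_evalN cpl (lexx 1))// !Me !Ec Ev (tate_eval_var cpl).
  rewrite (evS _ _ _ _ t1 v1) (evS _ _ _ _ t1 v2).
  have Hn : ty_eval H' x y != 0.
    have := hb t t0 tb; rewrite (tate_eval_comp cpl x01')// lin_eval// -xE => nz.
    have := ty_evalM cpl x01' xr exy aHx (tya_conj cpl x01' aHx).
    have -> : ty_eval (H' * wconj H') x y = tate_eval (wnorm H') x.
      by rewrite mul_wconj /ty_eval wre_cst wim_cst -(rmorph0 (@tate_cst R C)) tate_eval_cst// mul0r addr0.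
    by move=> E; apply: contraNneq nz => z; rewrite E z mul0r.
  have := congr1 (fun u => ty_eval u x y) rel.
  have at0 : ty_analytic (uabs x0) (tlin W iota x0).
    by apply: tyaB => //; [exact: tya_t|exact: tya_cst].
  rewrite /= (ty_evalM cpl x01' xr exy)// (ty_evalM cpl x01' xr exy)// tlin_eval => E.
  have xs : x - x0 = s * t by rewrite xE addrC addrA addNr add0r.
  rewrite xs in E.
  have -> : ty_eval G x y = s * t * (ty_eval G' x y / ty_eval H' x y).
    by apply: (mulfI Hn); rewrite E mulrCA [ty_eval H' x y * _]mulrC divfK.
  rewrite exprMn; set q := _ / ty_eval H' x y; set w := (wdy _ _ _)^-1.
  by rewrite -/w; ring.
have := congr1 (fun f : T => f N) D0.
rewrite tate0E /D tateBE !tate_cst_mulE tate_varX_mulE tate_var_mulE /SC /SC' /= mulr1.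
rewrite rE; case: (N) => [|n].
  by rewrite mulr0 mul1r sub0r => /eqP; rewrite oppr_eq0 => /eqP.
rewrite exprS => /eqP; rewrite subr_eq0 [c' n * _]mulrC mulrA => /eqP h.
by apply: (mulfI (mulf_neq0 s0 (expf_neq0 n s0))).
Qed.

Lemma res_lambda_simple_pole :
  res_lambda g x0 y0 = ty_eval G x0 y0 / wdy WC x0 y0.
Proof.
have [c hc] := laurent_coef_ex; rewrite -hc.1; apply: (residue_uniq hc).
by apply: xgetPex; exists (c 0%N); apply: residue_ex.
Qed.

End Point.
End Residue.

(** * Partial sums of the series *)

Section PowerSums.
Context (F : finFieldType) (C : fieldType) (iota : {rmorphism F -> C}).
Notation q := #|F|.

Lemma card_natr0 : (q%:R : C) = 0.
Proof.
have [p pp pF] := finPcharP F.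
have pC : p \in [pchar C] := rmorph_pchar iota pF.
have := pprimeChar_pgroup pF; rewrite /pgroup.pgroup cardsT => pq.
have [n qE] := p_natP pq; apply/eqP; rewrite -(dvdn_pcharf pC) qE.
case: n qE => [|n _]; last by rewrite expnS dvdn_mulr.
by move=> q1; have := finNzRing_gt1 F; rewrite q1.
Qed.

(** For n > 0, X ^ n - 1 has fewer than q - 1 roots, so some nonzero a has a ^ n != 1, and x -> a x
    multiplies the sum by a ^ n. For n = 0 the sum is q = 0, because 0 ^ 0 = 1. *)
Lemma sum_pow_eq0 n : (n < q.-1)%N -> \sum_(x : F) iota x ^+ n = 0.
Proof.
move=> nq; case: n nq => [_|n nq].
  by under eq_bigr => x _ do rewrite expr0; rewrite sumr_const card_natr0.
have [a a0 an] : exists2 a : F, a != 0 & a ^+ n.+1 != 1.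
  apply: contrapT => h; have hr (a : F) : a != 0 -> poly.root ('X^(n.+1) - 1%:P) a.
    move=> a0; rewrite rootE !hornerE subr_eq0; apply/negPn/negP => an.
    by apply: h; exists a.
  have p0 : 'X^(n.+1) - 1%:P != 0 :> {poly F}.
    by rewrite -size_poly_eq0 size_XnsubC.
  have := @max_poly_roots _ _ (enum [pred a : F | a != 0]) p0.
  rewrite size_XnsubC// enum_uniq => /(_ _ isT); rewrite -cardE.
  have -> : #|[pred a : F | a != 0]| = q.-1.
    have := cardC (pred1 (0 : F)); rewrite card1 => <-.
    by rewrite add1n /=; apply: eq_card.
  suff : all (poly.root ('X^(n.+1) - 1%:P)) (enum [pred a : F | a != 0]).
    by move=> -> /(_ isT); rewrite ltnS leqNgt nq.
  by apply/allP => a; rewrite mem_enum inE => /hr.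
apply/eqP; have : (iota a ^+ n.+1 - 1) * (\sum_(x : F) iota x ^+ n.+1) == 0.
  rewrite mulrBl mul1r subr_eq0 mulr_sumr; apply/eqP.
  rewrite [RHS](reindex_inj (mulfI a0)) /=.
  by apply: eq_bigr => x _; rewrite rmorphM exprMn.
rewrite mulf_eq0 => /orP[|//]; rewrite subr_eq0 -rmorphXn -(rmorph1 iota).
by rewrite (inj_eq (fmorph_inj iota)) (negPf an).
Qed.

(* every monomial of the product has degree less than q - 1 in some variable, and the sum
   of the x ^ n over F vanishes for n < q - 1 *)
Lemma sum_linear_forms_eq0 (I : finType) d (b : I -> 'I_d -> C) :
  (#|I| < d * q.-1)%N ->
  \sum_(c : {ffun 'I_d -> F}) \prod_(i : I) (\sum_(l < d) iota (c l) * b i l) = 0.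
Proof.
move=> Id.
under eq_bigr => c _ do rewrite bigA_distr_bigA /=.
rewrite exchange_big /= big1 // => f _.
under eq_bigr => c _ do rewrite big_split /=.
rewrite -mulr_suml; apply/eqP; rewrite mulf_eq0; apply/orP; left; apply/eqP.
have e (c : {ffun 'I_d -> F}) : \prod_i iota (c (f i)) =
    \prod_(l < d) iota (c l) ^+ #|[pred i | f i == l]|.
  rewrite (partition_big f predT)//=; apply: eq_bigr => l _.
  rewrite -prodr_const; apply: eq_big => [i|i /eqP -> //]; by rewrite !inE.
under eq_bigr => c _ do rewrite e.
rewrite -(bigA_distr_bigA (fun l x => iota x ^+ #|[pred i | f i == l]|)) /=.
(* Pigeonhole: the fibres of f over the d variables have total size #|I| < d (q - 1). *)
have [l hl] : exists l : 'I_d, (#|[pred i | f i == l]| < q.-1)%N.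
  apply: contrapT => h; move: Id; rewrite ltnNge => /negP; apply.
  have -> : #|I| = (\sum_(l < d) #|[pred i | f i == l]|)%N.
    rewrite -sum1_card (partition_big f predT)//=; apply: eq_bigr => l _.
    by rewrite -sum1_card; apply: eq_bigl => i; rewrite !inE.
  rewrite -[X in (X * _)%N](card_ord d) -sum_nat_const; apply: leq_sum => l _.
  by rewrite leqNgt; apply/negP => hl; apply: h; exists l.
by rewrite (bigD1 l)//= sum_pow_eq0// mul0r.
Qed.

End PowerSums.

(** * The affine coordinate ring over C *)

Section CoordinateRing.
Context (F : finFieldType) (W : weierstrass F) (C : fieldType) (iota : {rmorphism F -> C}).
Notation WC := (map_w iota W).

Definition coordC := wring (map_w (polyC \o iota) W) ('X : {poly C}).
Implicit Types (h u v : coordC) (x y : C).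

Definition bev h x y : C := (wre h).[x] + (wim h).[x] * y.
Definition bcst x : coordC := wcst x%:P.
Definition blin x : coordC := wcst ('X - x%:P).
Definition bline (th et m : C) : coordC :=
  wgen - wcst et%:P - wcst m%:P * wcst ('X - th%:P).

Notation linP := (linP W iota).
Notation cubP := (cubP W iota).

Lemma bevD u v x y : bev (u + v) x y = bev u x y + bev v x y.
Proof. by rewrite /bev wreD wimD !hornerD; ring. Qed.
Lemma bevN u x y : bev (- u) x y = - bev u x y.
Proof. by rewrite /bev wreN wimN !hornerN; ring. Qed.
Lemma bevM u v x y : on_curve WC x y -> bev (u * v) x y = bev u x y * bev v x y.
Proof.
move=> h; rewrite /bev wreM wimM.
move: (wre u) (wim u) (wre v) (wim v) => a b c d; rewrite -/cubP -/linP.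
move: (cubPE W iota x) (linPE W iota x); generalize cubP linP => cp lp hc hl.
by rewrite !(hornerD, hornerN, hornerM) hc hl -h; ring.
Qed.
Lemma bev_cst p x y : bev (wcst p) x y = p.[x].
Proof. by rewrite /bev wre_cst wim_cst horner0 mul0r addr0. Qed.
Lemma bev_sum (I : Type) (s : seq I) (P : pred I) (g : I -> coordC) x y :
  bev (\sum_(i <- s | P i) g i) x y = \sum_(i <- s | P i) bev (g i) x y.
Proof.
apply: (big_morph (fun u => bev u x y)) => [u v|]; first exact: bevD.
by rewrite /bev wre0 wim0 !horner0 mul0r addr0.
Qed.
Lemma bev_line th et m x y : bev (bline th et m) x y = y - et - m * (x - th).
Proof.
rewrite /bev /bline !(wreD, wimD, wreN, wimN, wreM, wimM) wre_gen wim_gen !wre_cst !wim_cst.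
by rewrite !(mul0r, mulr0, addr0, add0r, subr0) !hornerE; ring.
Qed.
Lemma bev_lin a x y : bev (blin a) x y = x - a.
Proof. by rewrite bev_cst !hornerE. Qed.

Definition wopp_y x y : C := - y - wlin WC x.

Lemma bev_conj h x y : bev (wconj h) x y = bev h x (wopp_y x y).
Proof.
rewrite /bev wre_conj wim_conj; move: (wre h) (wim h) => a b.
rewrite -/linP /wopp_y -(linPE W iota); generalize linP => lp.
by rewrite !(hornerD, hornerN, hornerM); ring.
Qed.

Lemma wopp_on_curve x y : on_curve WC x y -> on_curve WC x (wopp_y x y).
Proof. by rewrite /on_curve /wopp_y => <-; ring. Qed.

Lemma wopp_eq x y : y = wopp_y x y -> wdy WC x y = 0.
Proof.
move=> h; have -> : wdy WC x y = y - wopp_y x y by rewrite /wdy /wopp_y /wlin; ring.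
by rewrite {1}h subrr.
Qed.

Lemma wcst_poly_inj (p : {poly C}) u v : p != 0 -> wcst p * u = wcst p * v -> u = v.
Proof.
move=> p0 e.
have e1 : wre (wcst p * u) = wre (wcst p * v) by rewrite e.
have e2 : wim (wcst p * u) = wim (wcst p * v) by rewrite e.
rewrite !wreM !wre_cst !wim_cst !mul0r !addr0 in e1.
rewrite !wimM !wre_cst !wim_cst !mul0r !addr0 !subr0 in e2.
by apply: wext_eq; apply: (mulfI p0).
Qed.

(* the fibre over x0 consists of two distinct points, where h vanishes *)
Lemma fibre_div h x0 y0 : wdy WC x0 y0 != 0 -> bev h x0 y0 = 0 ->
  bev h x0 (wopp_y x0 y0) = 0 -> exists h', h = blin x0 * h' /\
    (forall n, (size (wre h) <= n.+1 -> size (wre h') <= n)%N /\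
               (size (wim h) <= n.+1 -> size (wim h') <= n)%N).
Proof.
move=> w0 h1 h2.
have i0 : (wim h).[x0] = 0.
  have : (wim h).[x0] * (y0 - wopp_y x0 y0) = 0.
    have -> : (wim h).[x0] * (y0 - wopp_y x0 y0) = bev h x0 y0 - bev h x0 (wopp_y x0 y0).
      by rewrite /bev; ring.
    by rewrite h1 h2 subrr.
  have -> : y0 - wopp_y x0 y0 = wdy WC x0 y0 by rewrite /wdy /wopp_y /wlin; ring.
  by move/eqP; rewrite mulf_eq0 (negPf w0) orbF => /eqP.
have r0 : (wre h).[x0] = 0 by move: h1; rewrite /bev i0 mul0r addr0.
move/rootP/factor_theorem: i0 => [pi piE]; move/rootP/factor_theorem: r0 => [pr prE].
have sz (p p' : {poly C}) n : p = p' * ('X - x0%:P) -> (size p <= n.+1 -> size p' <= n)%N.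
  move=> ->; have [->|p'0] := eqVneq p' 0; first by rewrite size_poly0.
  by rewrite size_Mmonic ?monicXsubC// size_XsubC addn2.
exists (Wext pr pi); split.
  apply: wext_eq; rewrite ?wreM ?wimM wre_cst wim_cst !mul0r ?addr0 ?subr0.
    by rewrite prE mulrC.
  by rewrite piE mulrC.
by move=> n; split; apply: sz.
Qed.

(* the pole order at infinity, max (2 deg u) (2 deg v + 3) for u + v y, is at most n
   (size is degree + 1) *)
Definition bdeg n h : Prop := (2 * size (wre h) <= n + 2)%N /\ (2 * size (wim h) < n)%N.

Lemma wre_bline th et m : wre (bline th et m) = - (et%:P + m%:P * ('X - th%:P)).
Proof.
by rewrite /bline !(wreD, wreN, wreM) wre_gen !wre_cst !wim_cst; ring.
Qed.
Lemma wim_bline th et m : wim (bline th et m) = 1.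
Proof.
by rewrite /bline !(wimD, wimN, wimM) wim_gen !wre_cst !wim_cst; ring.
Qed.

Lemma size_affine (a b c : C) : (size (a%:P + b%:P * ('X - c%:P))%R <= 2)%N.
Proof.
apply: leq_trans (size_polyD _ _) _; rewrite geq_max (leq_trans (size_polyC_leq1 _))//=.
by apply: leq_trans (size_polyMleq _ _) _; rewrite size_XsubC addn2 /= ltnS size_polyC_leq1.
Qed.

Lemma sizeM_le (p p' : {poly C}) a b : (size p <= a)%N -> (size p' <= b.+1)%N ->
  (size (p * p')%R <= a + b)%N.
Proof.
move=> pa pb; have := size_polyMleq p p'; move: pa pb; lia.
Qed.

Lemma sizeD_le (p p' : {poly C}) a : (size p <= a)%N -> (size p' <= a)%N ->
  (size (p + p')%R <= a)%N.
Proof. by move=> pa pb; apply: leq_trans (size_polyD _ _) _; rewrite geq_max pa. Qed.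

Section Step.
Context (th et al be al' be' m : C) (D : chord W iota th et al be al' be' m).

Lemma bline_norm :
  bline th et m * wconj (bline th et m) = - (blin th * blin al * blin al').
Proof.
rewrite mul_wconj /blin -!rmorphM -rmorphN; congr wcst.
have h : cubP - (et%:P + m%:P * ('X - th%:P)) ^+ 2 -
    linP * (et%:P + m%:P * ('X - th%:P)) =
    ('X - th%:P) * ('X - al%:P) * ('X - al'%:P).
  by refine (chord_norm D (@polyC C) 'X).
by rewrite -h /wnorm wre_bline wim_bline -/linP -/cubP; ring.
Qed.

Lemma bline_root x y : on_curve WC x y -> bev (bline th et m) x y = 0 ->
  [\/ x = th, x = al | x = al'].
Proof.
move=> exy h; have := congr1 (fun u => bev u x y) bline_norm.
rewrite /= bevM// h mul0r bevN !bevM// !bev_lin => /esym/eqP.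
rewrite oppr_eq0 !mulf_eq0 !subr_eq0 => /orP[/orP[]|] /eqP ->.
- by constructor 1. - by constructor 2. - by constructor 3.
Qed.

(* h' = - h conj(nu) / ((t - th) (t - al')) for nu the line, since nu conj(nu) =
   - (t - th) (t - al) (t - al') *)
Lemma div_step n h : wdy WC th et != 0 -> wdy WC al' be' != 0 ->
  bdeg n.+1 h -> (0 < n)%N -> bev h th et = 0 -> bev h al' be' = 0 ->
  exists h', h' * bline th et m = h * blin al /\ bdeg n h'.
Proof.
move=> w1 w2 [dr di] n0 z1 z2; have [e1 e2 e3 e4 e5 e6 e7] := D.
set nu := bline th et m.
pose p := h * wconj nu.
have nu1 : bev nu th et = 0 by rewrite bev_line; ring.
have nu2 : bev nu al' be' = 0.
  have -> : bev nu al' be' = m * (th - al') - (et - be') by rewrite bev_line; ring.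
  by rewrite e4 subrr.
have oppK x y : wopp_y x (wopp_y x y) = y by rewrite /wopp_y; ring.
have p1 : bev p th et = 0 by rewrite bevM// z1 mul0r.
(* conj(nu) vanishes at - (th, et) because nu vanishes at (th, et); so p has zeros at both points
   over th, and likewise over al'. *)
have p1' : bev p th (wopp_y th et) = 0.
  by rewrite bevM ?bev_conj ?oppK ?nu1 ?mulr0//; apply: wopp_on_curve.
have p2 : bev p al' be' = 0 by rewrite bevM// z2 mul0r.
have p2' : bev p al' (wopp_y al' be') = 0.
  by rewrite bevM ?bev_conj ?oppK ?nu2 ?mulr0//; apply: wopp_on_curve.
have [g [gE gs]] := fibre_div w1 p1 p1'.
have d0 : al' - th != 0 by rewrite subr_eq0 eq_sym.
have g2 y : on_curve WC al' y -> bev p al' y = 0 -> bev g al' y = 0.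
  move=> ey; rewrite gE bevM// bev_lin => /eqP.
  by rewrite mulf_eq0 (negPf d0) => /eqP.
have [k [kE ks]] := fibre_div w2 (g2 _ e3 p2) (g2 _ (wopp_on_curve e3) p2').
exists (- k); split.
  have X0 : ('X - th%:P) * ('X - al'%:P) != 0 :> {poly C}.
    by rewrite mulf_neq0// polyXsubC_eq0.
  apply: (wcst_poly_inj X0); rewrite rmorphM -/(blin th) -/(blin al').
  have -> : blin th * blin al' * (- k * nu) = - ((blin th * (blin al' * k)) * nu) by ring.
  rewrite -kE -gE /p.
  have -> : h * wconj nu * nu = h * (nu * wconj nu) by ring.
  by rewrite bline_norm; ring.
have sre : (size (wre (wconj nu)) <= 2)%N.
  rewrite wre_conj wre_bline wim_bline mulr1 -/linP -opprD size_polyN.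
  by apply: sizeD_le; [exact: size_affine|exact: size_linP].
have pim : wim (wconj nu) = - 1 by rewrite wim_conj wim_bline.
have spr N : (size (wre h) < N -> size (wim h) + 3 <= N -> size (wre p) <= N)%N.
  move=> hN hN'; rewrite wreM pim mulrN1 mulNr -/cubP; apply: sizeD_le.
    by apply: leq_trans (sizeM_le (b := 1) (leqnn _) sre) _; rewrite addn1.
  by rewrite size_polyN; apply: leq_trans (sizeM_le (b := 3) (leqnn _) (size_cubP W iota)) _.
have spi N : (size (wre h) <= N -> size (wim h) < N -> size (wim p) <= N)%N.
  move=> hN hN'; rewrite wimM pim -/linP !mulrN1 mulNr opprK.
  apply: sizeD_le; [apply: sizeD_le; first by rewrite size_polyN|].
    by apply: leq_trans (sizeM_le (b := 1) (leqnn _) sre) _; rewrite addn1.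
  by apply: leq_trans (sizeM_le (b := 1) (leqnn _) (size_linP W iota)) _; rewrite addn1.
rewrite /bdeg wreN wimN !size_polyN; split.
  (* [A] is at least 2, which keeps the loss of 2 from the two divisions clear of truncated
     subtraction. *)
  pose A := maxn (size (wre h)).+1 (size (wim h) + 3).
  have sA : (size (wre p) <= A)%N.
    by apply: spr; rewrite /A leq_max leqnn ?orbT.
  have A2 : (2 <= A)%N by rewrite /A leq_max addn3 orbT.
  have h3 : (size (wre k) <= A - 2)%N.
    apply: (ks _).1; apply: (gs _).1; move: sA A2; clear; lia.
  have key a b c N : (a <= maxn b.+1 (c + 3) - 2 -> 2 * b <= N.+1 + 2 ->
    2 * c < N.+1 -> 2 * a <= N + 2)%N by clear; lia.
  exact: key h3 dr di.
pose A := maxn (maxn (size (wre h)) (size (wim h)).+1) 2.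
have sA : (size (wim p) <= A)%N.
  by apply: spi; rewrite /A !leq_max leqnn ?orbT.
have A2 : (2 <= A)%N by rewrite /A leq_max leqnn orbT.
have h3 : (size (wim k) <= A - 2)%N.
  apply: (ks _).2; apply: (gs _).2; move: sA A2; clear; lia.
have key a b c N : (a <= maxn (maxn b c.+1) 2 - 2 -> 2 * b <= N.+1 + 2 ->
  2 * c < N.+1 -> 0 < N -> 2 * a < N)%N by clear; lia.
exact: key h3 dr di n0.
Qed.

End Step.
End CoordinateRing.

Section Smooth.
Context (R : realType) (F : finFieldType) (W : weierstrass F)
  (C : ultraFieldType R) (iota : {rmorphism F -> C}).
Notation WC := (map_w iota W).
Hypothesis E_smooth : nonsingular WC.
Hypothesis C_closed : GRing.closed_field_axiom C.

Lemma closed_sqrt (a : C) : exists x, x ^+ 2 = a.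
Proof.
have [x hx] := C_closed (fun i => if i == 0%N then a else 0) (isT : 0 < 2)%N.
by exists x; rewrite hx big_ord_recl big_ord1 /= mulr1 mul0r addr0.
Qed.

(** Outside characteristic 2 the term 2 y dominates. In characteristic 2, wdy = a1 x + a3 can vanish
    for |x| > 1 only if a1 = a3 = 0, and such a curve is singular. *)
Lemma wdy_far x y : 1 < uabs x :> R -> uabs x < uabs y :> R -> wdy WC x y != 0.
Proof.
move=> x1 xy; have y0 : 0 < uabs y :> R by apply: lt_trans xy; apply: lt_trans x1.
have wE : wdy WC x y = 2 * y + wlin WC x by rewrite /wdy /wlin; ring.
have [c2|c2] := eqVneq (2 : F) 0; last first.
  have n2 : uabs (2 : C) = 1 :> R by rewrite -(rmorph_nat iota) uabs_iota.
  rewrite -(uabs_gt0 (R := R)) wE uabs_dom uabsM n2 mul1r//.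
  by apply: le_lt_trans xy; apply: uabs_lin_le; apply: ltW.
have C2 : (2 : C) = 0 by rewrite -(rmorph_nat iota) c2 rmorph0.
rewrite wE C2 mul0r add0r; apply/eqP => l0.
have a10 : wa1 W = 0.
  apply: contrapT => /eqP a1; have h1 := uabs_iota iota a1.
  have : uabs (wlin WC x) = uabs x :> R.
    rewrite /wlin uabs_dom uabsM h1 mul1r//; apply: le_lt_trans x1.
    exact: uabs_iota_le.
  by rewrite l0 uabs0 => e; move: x1; rewrite -e ltNge ler01.
have a30 : iota (wa3 W) = 0.
  by move: l0; rewrite /wlin /= a10 rmorph0 mul0r add0r.
(* Here [wdx] at u is - (u ^ 2 + a4), so the singular point lies over a square root of - a4. *)
have [u hu] := closed_sqrt (- iota (wa4 W)).
have [v hv] := closed_sqrt (wcub WC u).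
apply: (E_smooth (x := u) (y := v)).
  by rewrite /on_curve hv /wlin /= a10 a30 rmorph0 mul0r addr0 mul0r addr0.
rewrite /wdx /wdy /= a10 a30 rmorph0 C2 !mul0r !addr0; split => //.
have -> : (3 : C) = 1 by rewrite -[RHS]addr0 -C2; ring.
by rewrite hu mul1r addNr oppr0 ?addr0 ?add0r.
Qed.

End Smooth.

Section Embedding.
Context (R : realType) (F : finFieldType) (W : weierstrass F)
  (C : ultraFieldType R) (iota : {rmorphism F -> C}).
Notation TY := (tateY W iota).
Notation CB := (coordC W iota).
Implicit Types (u v : CB).

Definition bemb u : TY := Wext (tate_poly (wre u)) (tate_poly (wim u)).

Lemma wre_bemb u : wre (bemb u) = tate_poly (wre u). Proof. by []. Qed.
Lemma wim_bemb u : wim (bemb u) = tate_poly (wim u). Proof. by []. Qed.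

Lemma bembM u v : bemb (u * v) = bemb u * bemb v.
Proof.
apply: wext_eq; [rewrite wre_bemb !wreM|rewrite wim_bemb !wimM]; rewrite !wre_bemb !wim_bemb.
  move: (wre u) (wim u) (wre v) (wim v) => a b c d.
  rewrite -/(cubP W iota) -[wcub _ tate_var]/(cubT W iota) cubT_poly.
  by rewrite rmorphD !rmorphM.
move: (wre u) (wim u) (wre v) (wim v) => a b c d.
rewrite -/(linP W iota) -[wlin _ tate_var]/(linT W iota) linT_poly.
by rewrite rmorphB rmorphD !rmorphM.
Qed.

Lemma bembD u v : bemb (u + v) = bemb u + bemb v.
Proof. by apply: wext_eq; rewrite ?wre_bemb ?wim_bemb ?wreD ?wimD rmorphD. Qed.
Lemma bembN u : bemb (- u) = - bemb u.
Proof. by apply: wext_eq; rewrite ?wre_bemb ?wim_bemb ?wreN ?wimN rmorphN. Qed.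
Lemma bemb_cst p : bemb (wcst p) = wcst (tate_poly p).
Proof. by apply: wext_eq; rewrite // wim_bemb !wim_cst rmorph0. Qed.
Lemma bemb_gen : bemb wgen = tyy W iota.
Proof.
by apply: wext_eq; rewrite ?wre_bemb ?wim_bemb ?wre_gen ?wim_gen ?rmorph0 ?rmorph1.
Qed.
Lemma bemb1 : bemb 1 = 1.
Proof. by rewrite -[1]/(wcst 1) bemb_cst rmorph1. Qed.

Lemma bemb_prod (I : Type) (s : seq I) (P : pred I) (g : I -> CB) :
  bemb (\prod_(i <- s | P i) g i) = \prod_(i <- s | P i) bemb (g i).
Proof. exact: (big_morph bemb bembM bemb1). Qed.

Lemma bemb_sum (I : Type) (s : seq I) (P : pred I) (g : I -> CB) :
  bemb (\sum_(i <- s | P i) g i) = \sum_(i <- s | P i) bemb (g i).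
Proof.
by apply: (big_morph bemb bembD); rewrite -[0]/(wcst 0) bemb_cst rmorph0.
Qed.

Lemma bemb_bcst a : bemb (bcst W iota a) = tyc W iota a.
Proof. by rewrite bemb_cst tate_polyC. Qed.
Lemma bemb_lin a : bemb (blin W iota a) = tlin W iota a.
Proof. by rewrite bemb_cst rmorphB /= tate_polyX tate_polyC rmorphB. Qed.
Lemma bemb_line th et m : bemb (bline W iota th et m) = line_fun W iota th et m.
Proof.
rewrite /bline !bembD !bembN bembM bemb_gen !bemb_cst rmorphB /= tate_polyX !tate_polyC.
by rewrite rmorphB.
Qed.

Lemma bemb_conj u : bemb (wconj u) = wconj (bemb u).
Proof.
apply: wext_eq; last by rewrite wim_bemb !wim_conj wim_bemb rmorphN.
rewrite wre_bemb !wre_conj wre_bemb wim_bemb; move: (wre u) (wim u) => a b.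
by rewrite -/(linP W iota) -[wlin _ tate_var]/(linT W iota) linT_poly rmorphB rmorphM.
Qed.

Lemma ty_eval_bemb (cpl : ucomplete C) u x y : ty_eval (bemb u) x y = bev u x y.
Proof. by rewrite /ty_eval /bemb !(tate_eval_poly cpl). Qed.

End Embedding.

(** * Dividing the partial sums by the shtuka functions *)

Section Descent.
Context (R : realType) (F : finFieldType) (W : weierstrass F)
  (C : ultraFieldType R) (iota : {rmorphism F -> C}).
Context (theta eta alpha beta : C).
Notation WC := (map_w iota W).
Hypothesis E_smooth : nonsingular WC.
Hypothesis C_inf : is_Cinf W iota theta eta.
Hypothesis V_def : is_drinfeld_point W iota theta eta alpha beta.
Notation q := #|F|.
Notation Q := (q%:R : R).
Notation m := (shtuka_slope F theta eta alpha beta).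
Notation CB := (coordC W iota).
Notation fr k x := (x ^+ (q ^ k)).
Let Q1 : 1 < Q := Q_gt1 R F.
Let Q0 : 0 < Q. Proof. exact: lt_trans Q1. Qed.
Let al_abs : uabs alpha = Q ^+ 2. Proof. by have [] := drinfeld_abs C_inf V_def. Qed.
Let be_abs : uabs beta = Q ^+ 3. Proof. by have [] := drinfeld_abs C_inf V_def. Qed.
Let th_abs : uabs theta = Q ^+ 2 := Cinf_theta C_inf.
Let et_abs : uabs eta = Q ^+ 3 := Cinf_eta C_inf.

Definition nuB k : CB := bline W iota (fr k theta) (fr k eta) (fr k m).
Definition delB k : CB := blin W iota (fr k alpha).

Lemma fr_wdy k (x y : C) : uabs x = Q ^+ 2 -> uabs y = Q ^+ 3 -> wdy WC (fr k x) (fr k y) != 0.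
Proof.
move=> hx hy; apply: (wdy_far E_smooth (Cinf_closed C_inf)).
  exact: (fr_abs_gt1 _ _ hx).
rewrite (frob_abs k hx) (frob_abs k hy); apply: QX_lt.
by rewrite ltn_pmul2r// card_expn_gt0.
Qed.

(** The twists are told apart by their absolute values Q ^ (2 q ^ j). *)
Lemma fr_abs_neq j k (x y : C) : (j < k)%N -> uabs x = Q ^+ 2 -> uabs y = Q ^+ 2 ->
  fr j x <> fr k y.
Proof.
move=> jk hx hy e; have := frob_abs j hx; rewrite e (frob_abs k hy) => /eqP.
by rewrite gt_eqF//; apply: QX_lt; rewrite ltn_pmul2l// ltn_exp2l// card_gt1.
Qed.

Let on_th k : on_curve WC (fr k theta) (fr k eta).
Proof. exact: (chord1 (chord_frob C_inf V_def k)). Qed.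
Let on_al k : on_curve WC (fr k alpha) (fr k beta).
Proof. exact: (chord2 (chord_frob C_inf V_def k)). Qed.

Lemma nuB_graph k x y y' : bev (nuB k) x y = 0 -> bev (nuB k) x y' = 0 -> y = y'.
Proof.
rewrite /nuB !bev_line => h h'; apply/eqP; rewrite -subr_eq0; apply/eqP.
by rewrite -[RHS](subrr 0) -{1}h -h'; ring.
Qed.

Lemma nuB_opp_al k : bev (nuB k) (fr k alpha) (wopp_y W iota (fr k alpha) (fr k beta)) = 0.
Proof.
have h := chord5 (chord_frob C_inf V_def k).
rewrite /nuB bev_line /wopp_y -h; ring.
Qed.

Lemma nuB_al_succ k : bev (nuB k) (fr k.+1 alpha) (fr k.+1 beta) = 0.
Proof.
have h := chord4 (chord_frob C_inf V_def k).
rewrite /nuB bev_line.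
have -> : fr k.+1 beta = fr k eta - (fr k eta - fr k.+1 beta) by ring.
rewrite h; ring.
Qed.

(** The line nu_k passes through - V^(k) and is not vertical, so it could contain V^(k) only if
    V^(k) were 2-torsion, which [fr_wdy] excludes. *)
Lemma nuB_al k : bev (nuB k) (fr k alpha) (fr k beta) != 0.
Proof.
apply/eqP => h; have := nuB_graph h (nuB_opp_al k) => /wopp_eq/eqP.
by rewrite (negPf (fr_wdy k al_abs be_abs)).
Qed.

Lemma nuB_th j k : (j < k)%N -> bev (nuB k) (fr j theta) (fr j eta) != 0.
Proof.
move=> jk; apply/eqP => /(bline_root (chord_frob C_inf V_def k) (on_th j)) [].
- exact: fr_abs_neq.
- exact: fr_abs_neq.
- by apply: fr_abs_neq => //; apply: ltnW.
Qed.

Lemma nuB_opp n k : (k < n)%N ->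
  bev (nuB k) (fr n alpha) (wopp_y W iota (fr n alpha) (fr n beta)) != 0.
Proof.
move=> kn; apply/eqP => h.
have [] := bline_root (chord_frob C_inf V_def k) (wopp_on_curve (on_al n)) h.
- by move/esym; apply: fr_abs_neq.
- by move/esym; apply: fr_abs_neq.
(* For n = k + 1 absolute values do not help, but the line meets this fibre in V^(k+1), hence not in
   - V^(k+1). *)
move=> e; have [kn1|kn1] := ltnP k.+1 n; first by move/esym: e; apply: fr_abs_neq.
have nE : n = k.+1 by apply/eqP; rewrite eqn_leq kn1 kn.
rewrite nE in h; have := nuB_graph (nuB_al_succ k) h => /wopp_eq/eqP.
by rewrite (negPf (fr_wdy k.+1 al_abs be_abs)).
Qed.

Section Fixed.
Variables (n : nat) (P : CB).
Hypotheses (n0 : (0 < n)%N) (degP : bdeg n P).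
Hypothesis (zP : forall j, (0 < j < n)%N -> bev P (fr j theta) (fr j eta) = 0).

Lemma size_mulX (p : {poly C}) a : (size (('X - a%:P) * p)%R <= (size p).+1)%N.
Proof.
apply: leq_trans (size_polyMleq _ _) _; by rewrite size_XsubC add2n.
Qed.

(* h = P delta_n \prod_(k <= i < n) delta_i / nu_i: lowering k, the zeros of nu_k at Xi^(k)
   and V^(k+1) cancel against a zero of P and the zero of delta_(k+1) / nu_(k+1). *)
Lemma descent t k : (k + t = n)%N -> (0 < k)%N -> exists h : CB,
  [/\ bdeg (k + 2) h, bev h (fr k alpha) (fr k beta) = 0,
      bev h (fr n alpha) (wopp_y W iota (fr n alpha) (fr n beta)) = 0,
      forall j, (0 < j < k)%N -> bev h (fr j theta) (fr j eta) = 0 &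
      h * \prod_(k <= i < n) nuB i = P * delB n * \prod_(k <= i < n) delB i].
Proof.
elim: t k => [|t IH] k.
  rewrite addn0 => -> _; exists (P * delB n); split.
  - have [d1 d2] := degP; rewrite mulrC /bdeg /delB /blin.
    have -> : wre (wcst ('X - (fr n alpha)%:P) * P) = ('X - (fr n alpha)%:P) * wre P.
      by rewrite wreM wre_cst wim_cst mul0r mul0r addr0.
    have -> : wim (wcst ('X - (fr n alpha)%:P) * P) = ('X - (fr n alpha)%:P) * wim P.
      by rewrite wimM wre_cst wim_cst !mul0r addr0 subr0.
    have s1 := size_mulX (wre P) (fr n alpha); have s2 := size_mulX (wim P) (fr n alpha).
    have key a b c d N : (2 * a <= N + 2 -> 2 * b < N -> c <= a.+1 -> d <= b.+1 ->
      2 * c <= N + 2 + 2 /\ 2 * d < N + 2)%N by clear; lia.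
    exact: key d1 d2 s1 s2.
  - by rewrite bevM ?bev_lin ?subrr ?mulr0.
  - by rewrite bevM ?bev_lin ?subrr ?mulr0//; apply: wopp_on_curve.
  - by move=> j jn; rewrite bevM// zP// mul0r.
  - by rewrite !big_geq.
rewrite addnS -addSn => kn k0.
have [//|h [dh h1 h2 h3 h4]] := IH k.+1 kn.
have kltn : (k < n)%N by rewrite -kn addSn ltnS leq_addr.
have hth : bev h (fr k theta) (fr k eta) = 0 by apply: h3; rewrite k0 ltnS leqnn.
have k2 : (0 < k + 2)%N by rewrite addn2.
have w1 : wdy WC (fr k theta) (fr k eta) != 0 := fr_wdy k th_abs et_abs.
have w2 : wdy WC (fr k.+1 alpha) (fr k.+1 beta) != 0 := fr_wdy k.+1 al_abs be_abs.
have [h' [e' d']] := div_step (chord_frob C_inf V_def k) w1 w2 dh k2 hth h1.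
(* Since h' nu_k = h delta_k, a zero of the right side is a zero of h' wherever nu_k does not
   vanish. *)
have tr x y : on_curve WC x y -> bev (nuB k) x y != 0 -> bev (h * delB k) x y = 0 ->
    bev h' x y = 0.
  move=> exy nz; rewrite -[h * delB k]e' bevM// => /eqP.
  by rewrite mulf_eq0 (negPf nz) orbF => /eqP.
exists h'; split => //.
- by apply: tr (nuB_al k) _ => //; rewrite bevM// bev_lin subrr mulr0.
- apply: tr; [exact: wopp_on_curve|exact: nuB_opp|].
  by rewrite bevM ?h2 ?mul0r//; apply: wopp_on_curve.
- move=> j /andP[j0 jk]; apply: tr (nuB_th jk) _ => //.
  by rewrite bevM// h3 ?mul0r// j0 ltnS ltnW.
rewrite !(big_ltn kltn) mulrA e' -mulrA mulrCA h4 -/(delB k); ring.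
Qed.

(* the slope of the line through V^(1) and - V^(n), on which h vanishes for k = 1 *)
Definition last_slope : C :=
  (wopp_y W iota (fr n alpha) (fr n beta) - fr 1 beta) / (fr n alpha - fr 1 alpha).

(** At k = 1 the pole order is at most 3, so h = u + c y with u affine and c constant; its zeros at
    V^(1) and - V^(n) leave only multiples of the line through them. *)
Lemma descent_end : (1 < n)%N -> exists c : C,
  bemb P * del W iota alpha n * \prod_(1 <= i < n) del W iota alpha i =
  tyc W iota c * line_fun W iota (fr 1 alpha) (fr 1 beta) last_slope *
    \prod_(1 <= i < n) nu W iota theta eta alpha beta i.
Proof.
move=> n1; have [|//|h [[d1 d2] h1 h2 _ h4]] := @descent n.-1 1%N; first by rewrite add1n prednK.
have nal : fr n alpha - fr 1 alpha != 0.
  by rewrite subr_eq0 eq_sym; apply/eqP; apply: fr_abs_neq.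
have /size1_polyC hc : (size (wim h) <= 1)%N.
  have key a : (2 * a < 1 + 2 -> a <= 1)%N by clear; lia.
  exact: key d2.
set c := (wim h)`_0 in hc.
have d0 : wre h + c%:P * ((fr 1 beta)%:P + last_slope%:P * ('X - (fr 1 alpha)%:P)) = 0.
  apply: (@roots_geq_poly_eq0 _ _ [:: fr 1 alpha; fr n alpha]).
  - move: h1 h2; rewrite /bev hc !hornerC => h1 h2.
    rewrite /= !rootE !(hornerD, hornerM, hornerC, hornerX, hornerN) andbT.
    rewrite subrr mulr0 addr0 h1 eqxx /= /last_slope divfK// addrCA subrr addr0.
    by rewrite h2.
  - by rewrite /= inE andbT; apply/eqP; apply: fr_abs_neq.
  rewrite /=; apply: sizeD_le.
    have key a : (2 * a <= 1 + 2 + 2 -> a <= 2)%N by clear; lia.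
    exact: key d1.
  rewrite mulrC; apply: leq_trans (sizeM_le (b := 0) (size_affine _ _ _) (size_polyC_leq1 _)) _.
  by [].
have hE : h = bcst W iota c * bline W iota (fr 1 alpha) (fr 1 beta) last_slope.
  apply: wext_eq; rewrite ?wreM ?wimM wre_cst wim_cst !mul0r ?addr0 ?subr0.
    by rewrite wre_bline mulrN; apply/eqP; rewrite -addr_eq0 d0.
  by rewrite wim_bline mulr1.
exists c; have := congr1 (@bemb R F W C iota) h4.
rewrite hE !bembM !bemb_prod bemb_bcst bemb_line bemb_lin => e.
rewrite /del; under eq_bigr => i _ do rewrite -bemb_lin.
rewrite -e; congr (_ * _); apply: eq_bigr => i _; by rewrite bemb_line.
Qed.

End Fixed.
End Descent.

(** * Coordinates on the elements of A of bounded degree *)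

Section Coefficients.
Context (F : finFieldType) (W : weierstrass F).
Variable k : nat.
Notation d := (k.+1 + k)%N.

Definition ofun n (g : 'I_n -> F) (i : nat) : F := oapp g 0 (insub i).

Lemma ofunE n (g : 'I_n -> F) (i : 'I_n) : ofun g i = g i.
Proof. by rewrite /ofun valK. Qed.

(** These are the elements with pole order at most d = 2 k + 1 at infinity, indexed by F ^ d so that
    power sums over a vector space apply. *)
Definition acoef (c : {ffun 'I_d -> F}) : coordA W :=
  Wext (\poly_(i < k.+1) ofun (fun i => c (lshift k i)) i)
       (\poly_(i < k) ofun (fun i => c (rshift k.+1 i)) i).

Lemma size_re_acoef c : (size (wre (acoef c)) <= k.+1)%N.
Proof. exact: size_poly. Qed.
Lemma size_im_acoef c : (size (wim (acoef c)) <= k)%N.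
Proof. exact: size_poly. Qed.

Lemma acoef_inj : injective acoef.
Proof.
move=> c c' e; apply/ffunP => l; case: (split_ordP l) => j ->.
  have := congr1 (fun a : coordA W => (wre a)`_j) e.
  by rewrite /= !coef_poly ltn_ord !ofunE.
have := congr1 (fun a : coordA W => (wim a)`_j) e.
by rewrite /= !coef_poly ltn_ord !ofunE.
Qed.

Lemma acoef_surj (a : coordA W) : (size (wre a) <= k.+1)%N -> (size (wim a) <= k)%N ->
  exists c, a = acoef c.
Proof.
move=> h1 h2.
exists [ffun l : 'I_d => match fintype.split l with inl i => (wre a)`_i | inr j => (wim a)`_j end].
apply: wext_eq; apply/polyP => i; rewrite /= coef_poly.
  case: ltnP => ik; last by rewrite nth_default// (leq_trans h1).
  by rewrite (ofunE _ (Ordinal ik)) ffunE (unsplitK (inl (Ordinal ik))).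
case: ltnP => ik; last by rewrite nth_default// (leq_trans h2).
by rewrite (ofunE _ (Ordinal ik)) ffunE (unsplitK (inr (Ordinal ik))).
Qed.

Definition cscale (x : F) (c : {ffun 'I_d -> F}) : {ffun 'I_d -> F} := [ffun l => x * c l].

Lemma acoef_scale x c :
  acoef (cscale x c) = Wext (x%:P * wre (acoef c)) (x%:P * wim (acoef c)).
Proof.
apply: wext_eq; apply/polyP => i; rewrite /= coefCM !coef_poly;
  case: ltnP => ik; rewrite ?mulr0//.
  by rewrite !(ofunE _ (Ordinal ik)) ffunE.
by rewrite !(ofunE _ (Ordinal ik)) ffunE.
Qed.

Definition mon (S : comNzRingType) (x y : S) (l : nat) : S :=
  if (l < k.+1)%N then x ^+ l else x ^+ (l - k.+1) * y.

Lemma aev_acoef (S : comNzRingType) (h : {rmorphism F -> S}) x y c :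
  aev h x y (acoef c) = \sum_(l < d) h (c l) * mon x y l.
Proof.
rewrite /aev big_split_ord /= ; congr (_ + _).
  have -> : map_poly h (\poly_(i < k.+1) ofun (fun i => c (lshift k i)) i) =
      \poly_(i < k.+1) h (ofun (fun i => c (lshift k i)) i).
    by apply/polyP => i; rewrite coef_map /= !coef_poly; case: ltnP; rewrite ?rmorph0.
  rewrite horner_poly; apply: eq_bigr => i _.
  by rewrite ofunE /mon ltn_ord.
have -> : map_poly h (\poly_(i < k) ofun (fun i => c (rshift k.+1 i)) i) =
    \poly_(i < k) h (ofun (fun i => c (rshift k.+1 i)) i).
  by apply/polyP => i; rewrite coef_map /= !coef_poly; case: ltnP; rewrite ?rmorph0.
rewrite horner_poly mulr_suml; apply: eq_bigr => i _.
by rewrite ofunE /mon /= ltnNge leq_addr /= addKn mulrA.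
Qed.

End Coefficients.

Section Sign.
Context (F : finFieldType) (W : weierstrass F).
Implicit Types a : coordA W.

Lemma wsgn_scale x a : x != 0 ->
  wsgn (Wext (x%:P * wre a) (x%:P * wim a) : coordA W) = x * wsgn a.
Proof.
move=> x0; rewrite /wsgn /=.
have C0 : x%:P != 0 :> {poly F} by rewrite polyC_eq0.
rewrite mulf_eq0 (negPf C0) /= !size_Cmul//.
by case: ifP => _; rewrite lead_coefM lead_coefC.
Qed.

Lemma wsgn_eq0 a : wsgn a = 0 -> a = 0.
Proof.
rewrite /wsgn; case: ifP => [h /eqP|/negbT].
  rewrite lead_coef_eq0 => /eqP r0; case/orP: h => [/eqP i0|]; first exact: wext_eq.
  by rewrite r0 size_poly0.
rewrite negb_or => /andP[i0 _] /eqP; rewrite lead_coef_eq0 => i0'.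
by rewrite i0' in i0.
Qed.

End Sign.

Section PartialSums.
Context (R : realType) (F : finFieldType) (W : weierstrass F)
  (C : ultraFieldType R) (iota : {rmorphism F -> C}).
Context (theta eta : C).
Hypothesis C_inf : is_Cinf W iota theta eta.
Notation q := #|F|.
Notation Q := (q%:R : R).
Notation CB := (coordC W iota).
Notation TY := (tateY W iota).
Notation A := (aev iota theta eta).
Notation LT := (@Lterm R F W C iota theta eta).
Let cpl : ucomplete C := Cinf_complete C_inf.
Let Q1 : 1 < Q := Q_gt1 R F.
Let Q0 : 0 < Q. Proof. exact: lt_trans Q1. Qed.
Let th_abs : uabs theta = Q ^+ 2 := Cinf_theta C_inf.
Let et_abs : uabs eta = Q ^+ 3 := Cinf_eta C_inf.
Implicit Types a : coordA W.

Lemma horner_abs (p : {poly F}) (x : C) : 1 < uabs x :> R -> p != 0 ->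
  uabs (map_poly iota p).[x] = uabs x ^+ (size p).-1 :> R.
Proof.
move=> x1; elim/poly_ind: p => [|p c IH]; first by rewrite eqxx.
move=> pc0; rewrite rmorphD rmorphM /= map_polyX map_polyC hornerMXaddC size_MXaddC.
have [p0|p0] := eqVneq p 0.
  move: pc0; rewrite p0 mul0r add0r polyC_eq0 => c0.
  by rewrite (negPf c0) rmorph0 horner0 mul0r add0r size_poly0 uabs_iota.
rewrite /= uabs_dom uabsM IH// -?exprSr ?prednK ?size_poly_gt0//.
apply: le_lt_trans (uabs_iota_le iota c) _; rewrite exprn_egt1//.
by rewrite -lt0n size_poly_gt0.
Qed.

Lemma aev_abs_ge a : uabs (map_poly iota (wre a)).[theta] <= uabs (A a) :> R /\
  uabs ((map_poly iota (wim a)).[theta] * eta) <= uabs (A a) :> R.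
Proof.
rewrite /aev; set u := _.[theta]; set v := _ * eta.
have th1 : 1 < uabs theta :> R by rewrite th_abs exprn_egt1.
have [u0|u0] := eqVneq (wre a) 0.
  rewrite /u u0 rmorph0 horner0 add0r uabs0 lexx; split => //; exact: uabs_ge0.
have [v0|v0] := eqVneq (wim a) 0.
  rewrite /v v0 rmorph0 horner0 mul0r addr0 uabs0 lexx; split => //; exact: uabs_ge0.
have uE : uabs u = Q ^+ (2 * (size (wre a)).-1) by rewrite /u horner_abs// th_abs exprM.
have vE : uabs v = Q ^+ (2 * (size (wim a)).-1 + 3).
  by rewrite /v uabsM horner_abs// th_abs et_abs -exprM exprD.
have [h|h] := ltnP (2 * (size (wre a)).-1) (2 * (size (wim a)).-1 + 3).
  have l : uabs u < uabs v :> R by rewrite uE vE ltr_eXn2l.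
  by rewrite addrC uabs_dom// lexx ltW.
have l : uabs v < uabs u :> R.
  rewrite uE vE ltr_eXn2l//; move: h; move: (size _).-1 (size _).-1 => i j; clear; lia.
by rewrite uabs_dom// lexx ltW.
Qed.

Lemma aev_ge1 a : a != 0 -> 1 <= uabs (A a) :> R.
Proof.
move=> a0; have th1 : 1 < uabs theta :> R by rewrite th_abs exprn_egt1.
have [h1 h2] := aev_abs_ge a.
have [u0|u0] := eqVneq (wre a) 0; last first.
  by apply: le_trans h1; rewrite horner_abs// exprn_ege1// ltW.
have [v0|v0] := eqVneq (wim a) 0.
  by move/eqP: a0; case; apply: wext_eq.
apply: le_trans h2; rewrite uabsM horner_abs// et_abs th_abs -exprM -exprD.
by rewrite exprn_ege1// ltW.
Qed.

Lemma aev_neq0 a : a != 0 -> A a != 0.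
Proof.
by move=> /aev_ge1 h; rewrite -(uabs_gt0 (R := R)); apply: lt_le_trans ltr01 h.
Qed.

Lemma aev0 : A (0 : coordA W) = 0.
Proof. by rewrite /aev /= !rmorph0 !horner0 mul0r addr0. Qed.

Lemma aev_abs_large a k : (k.+1 < size (wre a))%N \/ (k < size (wim a))%N ->
  Q ^+ k <= uabs (A a).
Proof.
move=> h; have th1 : 1 < uabs theta :> R by rewrite th_abs exprn_egt1.
have [h1 h2] := aev_abs_ge a.
case: h => h.
  have u0 : wre a != 0 by rewrite -size_poly_gt0; apply: leq_ltn_trans h.
  apply: le_trans h1; rewrite horner_abs// th_abs -exprM ler_eXn2l//.
  by move: h; move: (size (wre a)) => i; clear; lia.
have v0 : wim a != 0 by rewrite -size_poly_gt0; apply: leq_ltn_trans h.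
apply: le_trans h2; rewrite uabsM horner_abs// th_abs et_abs -exprM -exprD ler_eXn2l//.
by move: h; move: (size (wim a)) => i; clear; lia.
Qed.

Definition bpoly a : CB := Wext (map_poly iota (wre a)) (map_poly iota (wim a)).

Lemma bev_bpoly a x y : bev (bpoly a) x y = aev iota x y a. Proof. by []. Qed.

Lemma horner_tyt (p : {poly F}) :
  (map_poly (fun x => tyc W iota (iota x)) p).[tyt W iota] =
  wcst (tate_poly (map_poly iota p)) :> TY.
Proof.
rewrite !map_polyE; have e (S : nzRingType) (g : F -> S) :
    Poly (map g p) = \poly_(i < size p) g p`_i.
  apply/polyP => i; rewrite coef_Poly coef_poly; case: ltnP => ip.
    by rewrite (nth_map 0).
  by rewrite nth_default// size_map.
rewrite !e horner_poly poly_def !rmorph_sum; apply: eq_bigr => i _.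
rewrite -mul_polyC rmorphM /= tate_polyC rmorphXn /= tate_polyX rmorphM /= rmorphXn.
by [].
Qed.

Lemma LtermE a : LT a = bemb (bpoly a) * tyc W iota (A a)^-1.
Proof.
rewrite /Lterm; congr (_ * _); rewrite /aev !horner_tyt.
by rewrite [RHS]wextP wre_bemb wim_bemb.
Qed.

Lemma Lterm0 : LT (0 : coordA W) = 0.
Proof. by rewrite LtermE aev0 invr0 /tyc !rmorph0 mulr0. Qed.

(** This invariance lets the sum over A_+ be replaced by a sum over a whole vector space. *)
Lemma Lterm_scale x a : x != 0 ->
  LT (Wext (x%:P * wre a) (x%:P * wim a) : coordA W) = LT a.
Proof.
move=> x0; set xa : coordA W := Wext _ _.
have ix0 : iota x != 0 by rewrite fmorph_eq0.
have e1 : bpoly xa = bcst W iota (iota x) * bpoly a.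
  rewrite /bcst; apply: wext_eq.
    by rewrite wreM wre_cst wim_cst !mul0r addr0 /= rmorphM /= map_polyC.
  by rewrite wimM wre_cst wim_cst !mul0r addr0 subr0 /= rmorphM /= map_polyC.
have e2 : A xa = iota x * A a.
  by rewrite /aev /= !rmorphM /= !map_polyC !hornerM !hornerC mulrDr mulrA.
rewrite !LtermE e1 e2 bembM bemb_bcst invfM tycM.
have -> : tyc W iota (iota x) * bemb (bpoly a) *
   (tyc W iota (iota x)^-1 * tyc W iota (A a)^-1) =
   (tyc W iota (iota x) * tyc W iota (iota x)^-1) * (bemb (bpoly a) * tyc W iota (A a)^-1).
  by ring.
by rewrite tyc_mulV// mul1r.
Qed.

Lemma Lterm_bound a M : (uabs (A a))^-1 <= M -> nbY 1 1 M (LT a).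
Proof.
move=> h; have U1 := nbY1_ultra W iota cpl.
rewrite LtermE -[M]mul1r; apply: (ballM U1); last first.
  by apply: (nbY_cst W iota cpl (lexx 1) ltr01); rewrite uabsV.
split=> n; rewrite expr1n !mulr1 /= coef_map; exact: uabs_iota_le.
Qed.

Section Fixed.
Variable k : nat.
Notation d := (k.+1 + k)%N.
Notation ac := (@acoef F W k).

(* On elements of A with coordinates indexed by 'I_d, the sum of a(t, y) / a(theta, eta)
   over A_+ is minus the sum over all nonzero a, as q - 1 = - 1 in C. *)
Definition psum : CB := - \sum_(c : {ffun 'I_d -> F}) bpoly (ac c) * bcst W iota (A (ac c))^-1.

Lemma bemb_psum : bemb psum = - \sum_(c : {ffun 'I_d -> F}) LT (ac c).
Proof.
rewrite /psum bembN bemb_sum; congr (- _); apply: eq_bigr => c _.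
by rewrite LtermE bembM bemb_bcst.
Qed.

Lemma bdeg_psum : bdeg d psum.
Proof.
suff [h1 h2] : (size (wre psum) <= k.+1)%N /\ (size (wim psum) <= k)%N.
  have key (u v K : nat) : (u <= K.+1 -> v <= K -> 2 * u <= K.+1 + K + 2 /\ 2 * v < K.+1 + K)%N.
    by clear; lia.
  exact: key h1 h2.
rewrite /psum wreN wimN !size_polyN.
elim/big_ind: _ => [|u v [u1 u2] [v1 v2]|c _].
- by rewrite wre0 wim0 size_poly0.
- by rewrite wreD wimD; split; apply: sizeD_le.
have sC (p : {poly C}) x n : (size p <= n -> size (p * x%:P)%R <= n)%N.
  by move=> h; rewrite -[n]addn0; apply: sizeM_le => //; apply: size_polyC_leq1.
rewrite /bcst; split.
  rewrite wreM wre_cst wim_cst mulr0 mul0r addr0; apply: (sC _ _ _ _).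
  by rewrite size_map_poly; apply: size_re_acoef.
rewrite wimM wre_cst wim_cst !mulr0 mul0r add0r subr0; apply: (sC _ _ _ _).
by rewrite size_map_poly; apply: size_im_acoef.
Qed.

(* a(Xi^(j)) / a(Xi) = a(Xi) ^ (q ^ j - 1) is a product of j (q - 1) linear forms in the
   coefficients of a *)
Lemma psum_frob j : (0 < j < d)%N ->
  bev psum (theta ^+ (q ^ j)) (eta ^+ (q ^ j)) = 0.
Proof.
move=> /andP[j0 jd]; rewrite /psum bevN bev_sum; apply/eqP; rewrite oppr_eq0; apply/eqP.
have cq := card_gt1 F.
have small : (#|{: 'I_j * 'I_q.-1}| < d * q.-1)%N.
  by rewrite card_prod !card_ord ltn_pmul2r//; move: cq; clear; case: #|F| => [|[]].
apply: etrans (sum_linear_forms_eq0 iota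
  (fun (i : 'I_j * 'I_q.-1) (l : 'I_d) => mon k theta eta l ^+ (q ^ i.1)) small).
apply: eq_bigr => c _.
set X := \sum_(l < d) iota (c l) * mon k theta eta l.
have AE : A (ac c) = X by rewrite aev_acoef.
have fE i : \sum_(l < d) iota (c l) * mon k theta eta l ^+ (q ^ i) = X ^+ (q ^ i).
  rewrite /X (frob_sum iota); apply: eq_bigr => l _.
  by rewrite exprMn frob_iota.
(* q ^ j - 1 is the sum of (q - 1) q ^ i over i < j. *)
have -> : \prod_(i : 'I_j * 'I_q.-1) \sum_(l < d) iota (c l) * mon k theta eta l ^+ (q ^ i.1) =
    X ^+ (q ^ j).-1.
  under eq_bigr => i _ do rewrite fE.
  rewrite -(pair_big xpredT xpredT (fun (i : 'I_j) (_ : 'I_q.-1) => X ^+ (q ^ i))) /=.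
  under eq_bigr => i _ do rewrite prodr_const card_ord -exprM.
  elim: j {j0 jd small} => [|j IH]; first by rewrite big_ord0.
  rewrite big_ord_recr /= IH -exprD; congr (_ ^+ _).
  by have := card_expn_gt0 F j; rewrite expnS; move: cq; move: (q ^ j)%N #|F| => a b; clear; nia.
rewrite bevM; last exact: frob_on_curve (Cinf_curve C_inf).
rewrite bev_cst hornerC bev_bpoly AE.
have -> : aev iota (theta ^+ (q ^ j)) (eta ^+ (q ^ j)) (ac c) = X ^+ (q ^ j).
  rewrite aev_acoef /X (frob_sum iota); apply: eq_bigr => l _.
  rewrite exprMn frob_iota /mon; case: ifP => _; first by rewrite exprAC.
  by rewrite exprMn exprAC.
have qj : (1 < q ^ j)%N by rewrite -[1%N](expn0 q) ltn_exp2l.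
(* For X = 0 both sides are 0: the inverse of 0 is 0 by convention, and q ^ j - 1 > 0. *)
have [X0|X0] := eqVneq X 0.
  rewrite X0 invr0 mulr0 expr0n; move: qj; move: (q ^ j)%N; clear; by case => [|[]].
by apply: (mulIf X0); rewrite divfK// -exprSr prednK// ltnW.
Qed.

(** Every nonzero a contributes 1 at Xi, and there are q ^ d - 1 of them, which is - 1 in C. *)
Lemma psum_one : bev psum theta eta = 1.
Proof.
rewrite /psum bevN bev_sum.
under eq_bigr => c _.
  rewrite (bevM _ _ (Cinf_curve C_inf)) bev_cst hornerC bev_bpoly.
  over.
have e (c : {ffun 'I_d -> F}) : A (ac c) / A (ac c) = (ac c != 0)%:R.
  have [->|h] := eqVneq (ac c) 0; first by rewrite aev0 mul0r.
  by rewrite divff// aev_neq0.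
under eq_bigr => c _ do rewrite e.
have a0 : ac [ffun=> 0] = 0.
  apply: wext_eq; apply/polyP => i; rewrite /= coef_poly coef0; case: ltnP => // ik.
    by rewrite (ofunE _ (Ordinal ik)) ffunE.
  by rewrite (ofunE _ (Ordinal ik)) ffunE.
rewrite (bigD1 [ffun=> 0])//= a0 eqxx add0r.
rewrite (eq_bigr (fun=> 1)); last first.
  move=> c c0; suff -> : ac c != 0 by [].
  by apply: contraNneq c0 => h; apply/eqP/(@acoef_inj F W k); rewrite h a0.
rewrite sumr_const.
have -> : #|[pred c : {ffun 'I_d -> F} | c != [ffun=> 0]]| = (q ^ d).-1.
  have := cardC (pred1 ([ffun=> 0] : {ffun 'I_d -> F})); rewrite card1.
  rewrite card_ffun card_ord => <-; by rewrite add1n /=; apply: eq_card.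
have qd := card_expn_gt0 F d.
apply/eqP; rewrite -subr_eq0 -opprD oppr_eq0 -mulrSr prednK//.
by rewrite addSn expnS natrM (card_natr0 iota) mul0r.
Qed.

(** Scaling by x carries the part of sign 1 to the part of sign x, so the q - 1 parts are equal. *)
Lemma sum_signed : \sum_(c : {ffun 'I_d -> F} | wsgn (ac c) == 1) LT (ac c) = bemb psum.
Proof.
rewrite bemb_psum; set S := \sum_(c | _) _.
rewrite (partition_big (fun c => wsgn (ac c)) predT)//= (bigD1 0)//=.
rewrite big1 ?add0r; last by move=> c /eqP /wsgn_eq0 ->; apply: Lterm0.
have inner (x : F) : x != 0 -> \sum_(c | wsgn (ac c) == x) LT (ac c) = S.
  move=> x0; rewrite (reindex (cscale (k := k) x)) /=; last first.
    exists (cscale (k := k) x^-1) => c _; apply/ffunP => l; rewrite !ffunE mulrA.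
      by rewrite mulVf// mul1r.
    by rewrite divff// mul1r.
  apply: eq_big => [c|c _]; rewrite acoef_scale; last exact: Lterm_scale.
  by rewrite wsgn_scale// -{2}[x]mulr1 (inj_eq (mulfI x0)).
rewrite (eq_bigr (fun=> S) inner) sumr_const.
have -> : #|[pred x : F | x != 0]| = q.-1.
  have := cardC (pred1 (0 : F)); rewrite card1 => <-.
  by rewrite add1n /=; apply: eq_card.
apply/eqP; rewrite -addr_eq0 -mulrS prednK; last by apply: ltnW; apply: card_gt1.
rewrite -mulr_natl; have -> : (q%:R : TY) = tyc W iota q%:R by rewrite /tyc !rmorph_nat.
by rewrite (card_natr0 iota) /tyc !rmorph0 mul0r.
Qed.

Definition Aplus_low : {fset coordA W} :=
  [fset ac c | c in [pred c : {ffun 'I_d -> F} | wsgn (ac c) == 1]]%fset.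

Lemma sum_Aplus_low : \sum_(a <- Aplus_low) LT a = bemb psum.
Proof.
rewrite -sum_signed /Aplus_low big_imfset /=; last by move=> c c' _ _; apply: acoef_inj.
by rewrite big_enum_cond; apply: eq_bigl => c; rewrite andbT.
Qed.

Lemma Aplus_low_sub : ([set` Aplus_low] `<=` @Aplus F W)%classic.
Proof. by move=> a /= /imfsetP [c /= /eqP h ->]. Qed.

Lemma notin_Aplus_low a : Aplus a -> a \notin Aplus_low -> Q ^+ k <= uabs (A a).
Proof.
move=> ap nJ; apply: aev_abs_large.
have [h1|h1] := leqP (size (wre a)) k.+1; last by left.
have [h2|h2] := leqP (size (wim a)) k; last by right.
exfalso; have [c cE] := acoef_surj h1 h2; move/negP: nJ; apply.
by apply/imfsetP; exists c => //=; rewrite unfold_in /= -cE; apply/eqP.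
Qed.

End Fixed.

(** Terms outside [Aplus_low k] have norm at most Q ^ (- k), so adding any finite number of them
    keeps the ultrametric error small. *)
Lemma has_tysum_of_blim (g : TY) : blim (nbY 1 1) (fun k => bemb (psum k)) g ->
  has_tysum (@Aplus F W) LT g.
Proof.
move=> hg e e0; have e2 : 0 < e / 2 by rewrite divr_gt0.
have U1 := nbY1_ultra W iota cpl.
have [N hN] := hg _ e2.
have k0 : 0 <= Q^-1 by rewrite invr_ge0 ltW.
have k1 : Q^-1 < 1 by rewrite invf_lt1.
have [N' hN'] := geo_small k0 k1 e2 ler01.
pose k := maxn N N'.
exists (Aplus_low k); split; first exact: Aplus_low_sub.
move=> J' JJ' J'A; apply: (@le_lt_trans _ _ (e / 2)); last first.
  by rewrite ltr_pdivrMr// ltr_pMr// ltr1n.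
apply/tynormP; first exact: ltW.
rewrite (big_fsetID _ (mem (Aplus_low k)))/=.
have -> : [fset x in J' | x \in Aplus_low k]%fset = Aplus_low k.
  apply/fsetP => a; rewrite !inE /=; apply/andP/idP => [[]//|aJ]; split => //.
  exact: JJ'.
rewrite sum_Aplus_low addrAC; apply: (ballD U1); first by apply: hN; apply: leq_maxl.
rewrite big_seq; apply: (ball_sum U1); first exact: ltW.
move=> a; rewrite !inE /= => /andP[aJ' anJ].
apply: Lterm_bound; have h := notin_Aplus_low (J'A a aJ') anJ.
apply: le_trans (hN' k (leq_maxr _ _)); rewrite mul1r exprVn lef_pV2// posrE ?exprn_gt0//.
by apply: lt_le_trans h; rewrite exprn_gt0.
Qed.

Lemma has_tysum_uniq (g g' : TY) : has_tysum (@Aplus F W) LT g ->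
  has_tysum (@Aplus F W) LT g' -> g = g'.
Proof.
move=> hg hg'; have U1 := nbY1_ultra W iota cpl.
apply/eqP; rewrite -subr_eq0; apply/eqP/(ball_sep U1) => e e0.
have [J [JA hJ]] := hg e e0; have [J' [JA' hJ']] := hg' e e0.
pose K := (J `|` J')%fset.
have KA : ([set` K] `<=` @Aplus F W)%classic.
  by move=> a /=; rewrite inE => /orP[/JA|/JA'].
have JK : ([set` J] `<=` [set` K])%classic by move=> a /= aJ; rewrite inE aJ.
have JK' : ([set` J'] `<=` [set` K])%classic by move=> a /= aJ; rewrite inE aJ orbT.
have h1 := hJ K JK KA; have h2 := hJ' K JK' KA.
have -> : g - g' = (\sum_(i <- K) LT i - g') - (\sum_(i <- K) LT i - g) by ring.
by apply: (ballB U1); apply/tynormP; rewrite ?(ltW e0)//; apply: ltW.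
Qed.

End PartialSums.

(** * Passage to the limit *)

Section Main.
Context (R : realType) (F : finFieldType) (W : weierstrass F)
  (C : ultraFieldType R) (iota : {rmorphism F -> C}).
Context (theta eta alpha beta : C).
Notation WC := (map_w iota W).
Hypothesis E_smooth : nonsingular WC.
Hypothesis C_inf : is_Cinf W iota theta eta.
Hypothesis V_def : is_drinfeld_point W iota theta eta alpha beta.
Notation q := #|F|.
Notation Q := (q%:R : R).
Notation xi := (shtuka_xi F theta eta alpha beta).
Notation TY := (tateY W iota).
Notation tyc := (tyc W iota).
Notation tyt := (tyt W iota).
Notation tyy := (tyy W iota).
Notation fr k x := (x ^+ (q ^ k)).
Notation r := (Q ^+ 3).
Notation s := (Q ^- 5).
Notation f := (shtuka_f W iota theta eta alpha beta).
Notation factor k := (tyc (xi ^+ (q ^ k)) / twist k f).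
Notation evX u := (ty_eval u theta eta).
Let cpl : ucomplete C := Cinf_complete C_inf.
Let Q1 : 1 < Q := Q_gt1 R F.
Let Q0 : 0 < Q. Proof. exact: lt_trans Q1. Qed.
Let al_abs : uabs alpha = Q ^+ 2. Proof. by have [] := drinfeld_abs C_inf V_def. Qed.
Let be_abs : uabs beta = Q ^+ 3. Proof. by have [] := drinfeld_abs C_inf V_def. Qed.
Let th_abs : uabs theta = Q ^+ 2 := Cinf_theta C_inf.
Let et_abs : uabs eta = Q ^+ 3 := Cinf_eta C_inf.
Let UB : ultra_ball (nbY r s) := nbY_rs_ultra C_inf.
Let U1 : ultra_ball (nbY 1 1) := nbY1_ultra W iota cpl.
Let on_Xi : on_curve WC theta eta := Cinf_curve C_inf.
Let r1 : 1 <= r := r_ge1 R F.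
Let s0 : 0 < s := s_gt0 R F.
Let q21 : 1 <= Q ^+ 2. Proof. by rewrite exprn_ege1// ltW. Qed.
Let thq2 : uabs theta <= Q ^+ 2. Proof. by rewrite th_abs. Qed.

Lemma nbY_radius M (u : TY) : nbY r s M u -> nbY (Q ^+ 2) s M u.
Proof.
have q2r : Q ^+ 2 <= r by apply: QX_le.
by move=> [h1 h2]; split; apply: (nb_le r1) => //; rewrite exprn_ge0// ltW.
Qed.

(** The closed disc of radius Q ^ 2 = |theta| lies strictly inside the one of radius r, on which
    only boundedness is known. *)
Lemma nbY_analytic2 M (u : TY) : nbY r s M u -> ty_analytic (Q ^+ 2) u.
Proof.
move=> h; apply: (nbY_analytic cpl r1 _ _ h); last exact: QX_lt.
by rewrite exprn_ge0// ltW.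
Qed.

Lemma evX_blim (u : nat -> TY) g : (forall n, exists M, nbY r s M (u n)) ->
  (exists M, nbY r s M g) -> blim (nbY r s) u g ->
  blim (@uball R C) (fun n => evX (u n)) (evX g).
Proof.
move=> bu [M bg] ug; apply: (ty_eval_blim cpl q21 _ thq2 s0).
- by move=> n; have [M' h] := bu n; apply: nbY_analytic2 h.
- exact: nbY_analytic2 bg.
- by move=> e /ug [N hN]; exists N => n /hN /nbY_radius.
Qed.

Lemma tyc_blim (u : nat -> C) x : blim (@uball R C) u x ->
  blim (nbY 1 1) (fun n => tyc (u n)) (tyc x).
Proof.
move=> h e /h [N hN]; exists N => n /hN hn.
have -> : tyc (u n) - tyc x = tyc (u n - x) by rewrite tycD tycN.
exact: (nbY_cst W iota cpl (lexx 1) ltr01).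
Qed.

Section Level.
Variable k : nat.
(** The dimension that belongs to [psum] at k + 1; level 0 is skipped because [descent_end] wants n
    > 1. *)
Let n := (k.+2 + k.+1)%N.
Notation mu := (last_slope W iota alpha beta n).

(* up to constants, the line of descent_end and delta_n \prod_(0 < i < n) xi_i / f_i *)
Definition lambda : TY :=
  tlin W iota (fr 1 alpha) - (tyy - tyc (fr 1 beta)) * tyc mu^-1.
Definition Wn : TY := (1 - tyt * tyc (fr n alpha)^-1) * \prod_(i < n.-1) factor i.+1.

Let n_gt k' : (k' <= k)%N -> (k' + 2 < n)%N.
Proof. by rewrite /n; clear; lia. Qed.

(** The exact value is Q ^ (q ^ n), as - V^(n) is far beyond V^(1): the line becomes vertical in the
    limit, and [lambda] tends to delta^(1). *)
Lemma mu_abs : Q ^+ k <= uabs mu.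
Proof.
have cq := card_gt1 F.
have qn : (n < q ^ n)%N by apply: ltn_expl.
have an : uabs (fr n alpha) = Q ^+ (2 * q ^ n) := frob_abs n al_abs.
have bn : uabs (fr n beta) = Q ^+ (3 * q ^ n) := frob_abs n be_abs.
have a1 : uabs (fr 1 alpha) = Q ^+ (2 * q ^ 1) := frob_abs 1 al_abs.
have b1 : uabs (fr 1 beta) = Q ^+ (3 * q ^ 1) := frob_abs 1 be_abs.
have qn1 : (q ^ 1 < q ^ n)%N by rewrite ltn_exp2l.
have wo : uabs (wopp_y W iota (fr n alpha) (fr n beta)) = Q ^+ (3 * q ^ n).
  rewrite /wopp_y uabs_dom ?uabsN ?bn//.
  apply: (@le_lt_trans _ _ (uabs (fr n alpha))).
    by apply: uabs_lin_le; rewrite an exprn_ege1// ltW.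
  by rewrite an; apply: QX_lt; rewrite ltn_pmul2r// (leq_ltn_trans _ qn).
have den : uabs (fr n alpha - fr 1 alpha) = Q ^+ (2 * q ^ n).
  by rewrite uabs_dom ?an// uabsN a1; apply: QX_lt; rewrite ltn_pmul2l.
have num : uabs (wopp_y W iota (fr n alpha) (fr n beta) - fr 1 beta) = Q ^+ (3 * q ^ n).
  by rewrite uabs_dom ?wo// uabsN b1; apply: QX_lt; rewrite ltn_pmul2l.
rewrite /last_slope uabsM uabsV den num ler_pdivlMr ?exprn_gt0// -exprD.
apply: QX_le; have := n_gt (leqnn k); move: qn; move: (q ^ n)%N => a; move: n => b; clear; lia.
Qed.

Lemma mu_neq0 : mu != 0.
Proof. by rewrite -(uabs_gt0 (R := R)); apply: lt_le_trans mu_abs; rewrite exprn_gt0. Qed.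

Lemma alpha_fr_neq0 j : fr j alpha != 0.
Proof. by rewrite expf_neq0// -(uabs_gt0 (R := R)) al_abs exprn_gt0. Qed.

Lemma t_div_bound : nbY r s (r * Q^-1 ^+ k) (tyt * tyc (fr n alpha)^-1) /\
  nbY r s 1 (tyt * tyc (fr n alpha)^-1).
Proof.
have an : uabs (fr n alpha) = Q ^+ (2 * q ^ n) := frob_abs n al_abs.
have fg := frob_card_ge F n; have nk := n_gt (leqnn k).
split; apply: (nbY_t_div W iota cpl r1 s0 (sr_le1 R F) (ssr_le1 R F)); rewrite ?alpha_fr_neq0//.
  rewrite -mulrA ler_peMr ?exprn_ge0 ?(ltW Q0)// exprVn an mulrC ler_pdivlMr ?exprn_gt0// mul1r.
  apply: QX_le; move: fg nk; move: (q ^ n)%N => a; move: n => b; clear; lia.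
rewrite mul1r an; apply: QX_le; move: fg nk; move: (q ^ n)%N => a; move: n => b; clear; lia.
Qed.

Lemma lambda_bound : nbY r s (Num.max s^-1 (uabs (fr 1 beta)) * Q^-1 ^+ k)
  (lambda - tlin W iota (fr 1 alpha)).
Proof.
have -> : lambda - tlin W iota (fr 1 alpha) =
   - ((tyy - tyc (fr 1 beta)) * tyc mu^-1) by rewrite /lambda; ring.
apply: (ballN UB); apply: (ballM UB).
  apply: (ballB UB); first by apply: (ballW UB) (nbY_y W iota cpl r1 s0); rewrite le_max lexx.
  by apply: (nbY_cst W iota cpl r1 s0); rewrite le_max lexx orbT.
apply: (nbY_cst W iota cpl r1 s0); rewrite uabsV exprVn lef_pV2 ?mu_abs// posrE ?exprn_gt0//.
by rewrite uabs_gt0 mu_neq0.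
Qed.

Lemma partial_sum_product : exists kap : C, bemb (psum W iota theta eta k.+1) * Wn = tyc kap * lambda.
Proof.
have n1 : (1 < n)%N by have := n_gt (leq0n k); rewrite add0n => h; apply: ltnW.
have [c hc] := descent_end E_smooth C_inf V_def (ltnW n1) (bdeg_psum W iota theta eta k.+1)
  (fun j jn => psum_frob (k := k.+1) C_inf jn) n1.
pose X := \prod_(i < n.-1) xi ^+ (q ^ i.+1).
have facE i : factor i * nu W iota theta eta alpha beta i = tyc (xi ^+ (q ^ i)) * del W iota alpha i.
  rewrite (f_twist C_inf V_def) invrM ?unitrV ?(del_unit C_inf V_def) ?(nu_unit C_inf V_def)// invrK.
  by rewrite mulrA divrK ?(nu_unit C_inf V_def).
have prodE (g : nat -> TY) : \prod_(1 <= i < n) g i = \prod_(i < n.-1) g i.+1.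
  by rewrite big_add1 big_mkord.
have Xc : \prod_(i < n.-1) tyc (xi ^+ (q ^ i.+1)) = tyc X.
  by rewrite /X /Defs.tyc !rmorph_prod; apply: eq_bigr => i _.
have fp : \prod_(i < n.-1) factor i.+1 * \prod_(i < n.-1) nu W iota theta eta alpha beta i.+1 =
    tyc X * \prod_(i < n.-1) del W iota alpha i.+1.
  by rewrite -Xc -!big_split; apply: eq_bigr => i _; apply: facE.
have nuU : \prod_(i < n.-1) nu W iota theta eta alpha beta i.+1 \is a GRing.unit.
  by apply: rpred_prod => i _; apply: nu_unit C_inf V_def _.
rewrite !prodE in hc.
have delE : del W iota alpha n = - tyc (fr n alpha) * (1 - tyt * tyc (fr n alpha)^-1).
  have -> : - tyc (fr n alpha) * (1 - tyt * tyc (fr n alpha)^-1) =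
    tyt * (tyc (fr n alpha) * tyc (fr n alpha)^-1) - tyc (fr n alpha) by ring.
  by rewrite tyc_mulV ?alpha_fr_neq0// mulr1.
have lfE : line_fun W iota (fr 1 alpha) (fr 1 beta) mu = - tyc mu * lambda.
  have -> : - tyc mu * lambda = (tyy - tyc (fr 1 beta)) * (tyc mu * tyc mu^-1)
      - tyc mu * tlin W iota (fr 1 alpha) by rewrite /lambda; ring.
  by rewrite tyc_mulV ?mu_neq0// mulr1.
(* delta_n = - alpha^(n) (1 - t / alpha^(n)), the line is - mu [lambda], and X collects the scalars
   xi^(i); the two signs cancel. *)
exists (c * X * mu / fr n alpha).
apply: (mulIr nuU); apply: (mulrI (tyc_unit W iota (alpha_fr_neq0 n))).
have -> : tyc (fr n alpha) * (bemb (psum W iota theta eta k.+1) * Wn *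
      \prod_(i < n.-1) nu W iota theta eta alpha beta i.+1) =
   - (bemb (psum W iota theta eta k.+1) * del W iota alpha n *
      \prod_(i < n.-1) del W iota alpha i.+1) * tyc X.
  have -> : - (bemb (psum W iota theta eta k.+1) * del W iota alpha n *
      \prod_(i < n.-1) del W iota alpha i.+1) * tyc X =
     - (bemb (psum W iota theta eta k.+1) * del W iota alpha n *
      (tyc X * \prod_(i < n.-1) del W iota alpha i.+1)) by ring.
  by rewrite -fp delE /Wn; ring.
have kapE : tyc (c * X * mu / fr n alpha) = tyc c * tyc X * tyc mu * tyc (fr n alpha)^-1.
  by rewrite (tycM _ _ (c * X * mu)) (tycM _ _ (c * X)) (tycM _ _ c).
rewrite hc lfE kapE; set P := \prod_(i < _) _.
have -> : tyc (fr n alpha) * (tyc c * tyc X * tyc mu * tyc (fr n alpha)^-1 * lambda * P) =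
   (tyc (fr n alpha) * tyc (fr n alpha)^-1) * (tyc c * tyc X * tyc mu * lambda * P) by ring.
by rewrite tyc_mulV ?alpha_fr_neq0//; ring.
Qed.

End Level.

(** The a(t, y) have coefficients in F, hence Gauss norm at most 1, and |a(theta, eta)| >= 1 for a
    != 0. *)
Lemma bemb_psum_bound k : nbY 1 1 1 (bemb (psum W iota theta eta k)).
Proof.
rewrite bemb_psum; apply: (ballN U1); apply: (ball_sum U1) => // c _.
apply: (Lterm_bound C_inf); have [->|h] := eqVneq (acoef W c) 0.
  by rewrite aev0 uabs0 invr0.
have h1 := aev_ge1 C_inf h; rewrite invf_le1//; exact: lt_le_trans ltr01 h1.
Qed.

Lemma bemb_analytic (u : coordC W iota) (rho : R) : 1 <= rho -> ty_analytic rho (bemb u).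
Proof. by move=> h; split; apply: (tends0_poly cpl h). Qed.

Lemma lambda_analytic k : ty_analytic (Q ^+ 2) (lambda k).
Proof.
apply: (tyaB cpl q21).
  by apply: (tyaB cpl q21); [exact: (tya_t W iota cpl q21)|exact: (tya_cst W iota cpl q21)].
apply: (tyaM cpl q21); last exact: (tya_cst W iota cpl q21).
by apply: (tyaB cpl q21); [exact: (tya_y W iota cpl q21)|exact: (tya_cst W iota cpl q21)].
Qed.

Section Limit.
Variables (Pi Pi' : TY).
Hypotheses (bPi : nbY r s 1 Pi) (bPi' : nbY r s 1 Pi') (PiPi' : Pi * Pi' = 1).
Hypothesis lPi : blim (nbY r s) (fun n => \prod_(i < n) factor i.+1) Pi.
Hypothesis bP : forall n, nbY r s 1 (\prod_(i < n) factor i.+1).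
Notation d1 := (tlin W iota (fr 1 alpha)).

Let k0 : 0 <= Q^-1. Proof. by rewrite invr_ge0 ltW. Qed.
Let k1 : Q^-1 < 1. Proof. by rewrite invf_lt1. Qed.

Lemma Wn_bound k : nbY r s 1 (Wn k).
Proof.
have h : nbY r s 1 (1 - tyt * tyc (fr (k.+2 + k.+1) alpha)^-1).
  by apply: (ballB UB); [exact: (ball1 UB)|exact: (t_div_bound k).2].
by have := ballM UB h (bP _); rewrite mulr1; apply.
Qed.

Lemma Wn_lim : blim (nbY r s) Wn Pi.
Proof.
have -> : Pi = 1 * Pi by rewrite mul1r.
apply: (blimM UB).
- by exists 1 => k; apply: (ballB UB); [exact: (ball1 UB)|exact: (t_div_bound k).2].
- by exists 1.
- move=> e e0; have [N hN] := geo_small k0 k1 e0 (le_trans ler01 r1).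
  exists N => k /hN h; rewrite addrAC subrr add0r; apply: (ballN UB).
  by apply: (ballW UB) (t_div_bound k).1.
move=> e /lPi [N hN]; exists N => k Nk; apply: hN.
by apply: (leq_trans Nk); clear; lia.
Qed.

Lemma d1_bound : exists M, nbY r s M d1.
Proof.
exists (Num.max r (uabs (fr 1 alpha))); apply: (ballB UB).
  by apply: (ballW UB) (nbY_t W iota cpl r1 s0); rewrite le_max lexx.
by apply: (nbY_cst W iota cpl r1 s0); rewrite le_max lexx orbT.
Qed.

Lemma lambda_lim : blim (nbY r s) lambda d1.
Proof.
have K0 : 0 <= Num.max s^-1 (uabs (fr 1 beta)) by rewrite le_max uabs_ge0 orbT.
move=> e e0; have [N hN] := geo_small k0 k1 e0 K0.
by exists N => k /hN h; apply: (ballW UB) (lambda_bound k).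
Qed.

Lemma lambda_bounded k : exists M, nbY r s M (lambda k).
Proof.
have [M hM] := d1_bound; set K := Num.max s^-1 (uabs (fr 1 beta)) * Q^-1 ^+ k.
exists (Num.max M K); rewrite -(subrK d1 (lambda k)); apply: (ballD UB).
  by apply: (ballW UB) (lambda_bound k); rewrite le_max lexx orbT.
by apply: (ballW UB) hM; rewrite le_max lexx.
Qed.

Lemma d1_Xi : evX d1 = theta - alpha ^+ q.
Proof. by rewrite (tlin_eval W iota cpl) expn1. Qed.

Lemma d1_Xi_neq0 : theta - alpha ^+ q != 0.
Proof.
have := chord7 (chord_frob C_inf V_def 0); rewrite expn1 expn0 expr1 => h.
by rewrite subr_eq0.
Qed.

(* the constant of partial_sum_product is eliminated by evaluating at Xi, where the
   partial sum is 1 *)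
Lemma partial_sum_cross k :
  tyc (evX (lambda k)) * (bemb (psum W iota theta eta k.+1) * Wn k) = tyc (evX (Wn k)) * lambda k.
Proof.
have [kap hk] := partial_sum_product k.
have aW : ty_analytic (Q ^+ 2) (Wn k) := nbY_analytic2 (Wn_bound k).
have aP := bemb_analytic (psum W iota theta eta k.+1) q21.
have e : evX (Wn k) = kap * evX (lambda k).
  have aL := lambda_analytic k; have ac := tya_cst W iota cpl q21 kap.
  have := congr1 (fun u : TY => evX u) hk; rewrite /=.
  rewrite [LHS](ty_evalM cpl q21 thq2 on_Xi)// [RHS](ty_evalM cpl q21 thq2 on_Xi)//.
  by rewrite (ty_eval_bemb cpl) (psum_one C_inf) mul1r (ty_eval_cst W iota cpl).
by rewrite e hk tycM; ring.
Qed.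

Lemma partial_sum_lim : blim (nbY 1 1) (fun k => bemb (psum W iota theta eta k))
  (tyc (evX Pi / (theta - alpha ^+ q)) * d1 * Pi').
Proof.
apply: blim_unshift.
pose P k := bemb (psum W iota theta eta k.+1).
have G (u : nat -> TY) g  (h : blim (nbY r s) u g) : blim (nbY 1 1) u g := blim_gauss C_inf h.
have ex1 (g : TY) : exists M, nbY 1 1 M g := nbY1_ex g.
have gb (g : TY) M : nbY r s M g -> nbY 1 1 M g.
  exact: (nbY_gauss cpl r1 (s_le1 R F)).
have bW : bbounded (nbY 1 1) Wn by exists 1 => k; apply: gb; apply: Wn_bound.
have lW := evX_blim (fun n => ex_intro _ 1 (Wn_bound n)) (ex_intro _ 1 bPi) Wn_lim.
have lL := evX_blim lambda_bounded d1_bound lambda_lim.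
(* Convergence gives a uniform bound only from some index on; [limM] shifts by it. *)
have bounded_lim (u : nat -> TY) g : blim (nbY 1 1) u g -> exists N, bbounded (nbY 1 1) (fun k => u (k + N)%N).
  move=> /(_ 1 ltr01) [N hN]; have [M bM] := ex1 g; exists N, (Num.max 1 M) => k.
  rewrite -(subrK g (u _)); apply: (ballD U1).
    by apply: (ballW U1) (hN _ (leq_addl _ _)); rewrite le_max lexx.
  by apply: (ballW U1) bM; rewrite le_max lexx orbT.
have limM (u v : nat -> TY) g h : blim (nbY 1 1) u g -> blim (nbY 1 1) v h ->
    blim (nbY 1 1) (fun k => u k * v k) (g * h).
  move=> hu hv; have [N bu] := bounded_lim _ _ hu.
  have := blimM U1 bu (ex1 h) (blim_shift N hu) (blim_shift N hv).
  move=> H e /H [N' hN']; exists (N' + N)%N => k Nk.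
  have kE : k = (k - N + N)%N by rewrite subnK//; apply: leq_trans Nk; apply: leq_addl.
  by rewrite kE; apply: hN'; rewrite leq_subRL ?[(N + _)%N]addnC//; apply: leq_trans Nk; apply: leq_addl.
have lA : blim (nbY 1 1) (fun k => tyc (evX (lambda k)) * Wn k) (tyc (evX d1) * Pi).
  by apply: limM; [exact: tyc_blim|exact: G Wn_lim].
have lB : blim (nbY 1 1) (fun k => tyc (evX (Wn k)) * lambda k) (tyc (evX Pi) * d1).
  by apply: limM; [exact: tyc_blim|exact: G lambda_lim].
have bPk : bbounded (nbY 1 1) P by exists 1 => k; apply: bemb_psum_bound.
(* As P is bounded, its coefficient [tyc (evX (lambda k)) * Wn k] may be replaced by the limit
   without knowing yet that P converges. *)
have z1 : blim (nbY 1 1) (fun k => (tyc (evX d1) * Pi - tyc (evX (lambda k)) * Wn k) * P k) 0.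
  apply: (blim_bnd0 U1) => //.
  by have := blimB U1 (blim_cst U1 (tyc (evX d1) * Pi)) lA; rewrite subrr.
have z2 : blim (nbY 1 1) (fun k => tyc (evX d1) * Pi * P k) (tyc (evX Pi) * d1).
  have := blimD U1 z1 lB; rewrite add0r; apply: blim_eq => k.
  by rewrite -partial_sum_cross -/(P k); ring.
(* The limit coefficient is invertible, as delta^(1)(Xi) != 0 and Pi Pi' = 1; dividing by it shows
   that P converges. *)
have := limM _ _ _ _ (blim_cst U1 (tyc (evX d1)^-1 * Pi')) z2.
rewrite d1_Xi.
have -> : tyc (theta - alpha ^+ q)^-1 * Pi' * (tyc (evX Pi) * d1) =
    tyc (evX Pi / (theta - alpha ^+ q)) * d1 * Pi' by rewrite tycM; ring.
apply: blim_eq => k.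
have -> : tyc (theta - alpha ^+ q)^-1 * Pi' * (tyc (theta - alpha ^+ q) * Pi * P k) =
  (tyc (theta - alpha ^+ q) * tyc (theta - alpha ^+ q)^-1) * (Pi * Pi') * P k by ring.
by rewrite tyc_mulV ?d1_Xi_neq0// PiPi' !mul1r.
Qed.

Variable zeta : C.

(* (t - theta) omega = - zeta xi conj(nu) Pi / delta^(1) is regular at Xi *)
Lemma residue_omega :
  res_lambda (tyc zeta * (factor 0 * Pi)) theta eta =
  zeta * xi * evX Pi / (theta - alpha ^+ q).
Proof.
have th1 : 1 < uabs theta :> R by rewrite th_abs exprn_egt1.
have w0 : wdy WC theta eta != 0.
  apply: (wdy_far E_smooth (Cinf_closed C_inf)) => //.
  by rewrite th_abs et_abs; apply: QX_lt.
have cq := card_gt1 F.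
(* |alpha ^ q| = Q ^ (2 q) >= Q ^ 4, so delta^(1) is invertible on the disc of radius r. *)
have ra : r < uabs (fr 1 alpha).
  by rewrite expn1 uabsX al_abs -exprM; apply: QX_lt; move: cq; clear; lia.
have [v [hv [M bv]]] := tlin_inv W iota cpl r1 s0 (sr_le1 R F) (ssr_le1 R F) ra.
(* Strictly between |theta| and r: functions bounded on the larger disc converge on this one, and Xi
   is interior to it. *)
pose rho : R := (Q ^+ 2 + r) / 2.
have q2r : Q ^+ 2 < r by apply: QX_lt.
have rho1 : Q ^+ 2 < rho by rewrite /rho; lra.
have rho2 : rho < r by rewrite /rho; lra.
have rho11 : 1 <= rho by apply: le_trans q21 (ltW rho1).
have rho0 : 0 <= rho by apply: le_trans rho11.
set nu0 := nu W iota theta eta alpha beta 0.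
pose G := - tyc (zeta * xi) * wconj nu0 * v * Pi.
have an (g : TY) M' : nbY r s M' g -> ty_analytic rho g.
  exact: (nbY_analytic cpl r1 rho0 rho2).
have nuE : wconj nu0 = bemb (wconj (bline W iota theta eta (shtuka_slope F theta eta alpha beta))).
  by rewrite bemb_conj bemb_line /nu0 /nu expn0 !expr1.
have ac : ty_analytic rho (wconj nu0) by rewrite nuE; apply: bemb_analytic.
have aG : ty_analytic rho G.
  apply: (tyaM cpl rho11); last exact: an bPi.
  apply: (tyaM cpl rho11); last exact: an bv.
  apply: (tyaM cpl rho11) => //.
  by apply: (tyaN rho11); exact: (tya_cst W iota cpl rho11).
have norm0 := line_fun_norm (chord_frob C_inf V_def 0).
(* After multiplication by nu, the norm formula trades nu conj(nu) for three linear functions, and v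
   is 1 / delta^(1). *)
have gG : tlin W iota theta * (tyc zeta * (factor 0 * Pi)) = G.
  have nuU := nu_unit C_inf V_def 0; have dU := del_unit C_inf V_def 0.
  apply: (mulIr nuU).
  have facE : factor 0 * nu0 = tyc xi * del W iota alpha 0.
    rewrite (f_twist C_inf V_def) invrM ?unitrV// invrK.
    by rewrite mulrA divrK.
  have -> : tlin W iota theta * (tyc zeta * (factor 0 * Pi)) * nu0 =
    tlin W iota theta * tyc zeta * (factor 0 * nu0) * Pi by ring.
  rewrite facE -/nu0.
  have -> : G * nu0 = - tyc (zeta * xi) * (nu0 * wconj nu0) * v * Pi by rewrite /G; ring.
  rewrite /nu0 /nu norm0 tycM.
  have -> : - (tyc zeta * tyc xi) * - (tlin W iota (fr 0 theta) * tlin W iota (fr 0 alpha) *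
      tlin W iota (fr 1 alpha)) * v * Pi =
    tyc zeta * tyc xi * tlin W iota (fr 0 theta) * tlin W iota (fr 0 alpha) *
      (tlin W iota (fr 1 alpha) * v) * Pi by ring.
  by rewrite hv mulr1 /del expn0 !expr1; ring.
have th_rho : uabs theta < rho by rewrite th_abs.
rewrite (res_lambda_simple_pole cpl on_Xi w0 th1 th_rho aG gG).
have thr : uabs theta <= rho by apply: ltW.
have aX : ty_analytic rho v := an _ _ bv.
have aP : ty_analytic rho Pi := an _ _ bPi.
have at_ := tya_cst W iota cpl rho11 (zeta * xi).
have evv : evX v = (theta - alpha ^+ q)^-1.
  have := congr1 (fun u : TY => evX u) hv; rewrite /= (ty_evalM cpl rho11 thr on_Xi)//; last first.
    by apply: (tyaB cpl rho11); [exact: (tya_t W iota cpl rho11)|exact: (tya_cst W iota cpl rho11)].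
  rewrite (d1_Xi) -tyc1 (ty_eval_cst W iota cpl) => h.
  by apply: (mulfI d1_Xi_neq0); rewrite h divff// d1_Xi_neq0.
(* conj(nu) at Xi is nu at - Xi, and nu(Xi) = 0; the value cancels the denominator of the invariant
   differential. *)
have evn : evX (wconj nu0) = - wdy WC theta eta.
  by rewrite nuE (ty_eval_bemb cpl) bev_conj bev_line /wopp_y /wlin /wdy; ring.
rewrite /G; rewrite (ty_evalM cpl rho11 thr on_Xi)//; last first.
  by apply: (tyaM cpl rho11) => //; apply: (tyaM cpl rho11) => //; apply: (tyaN rho11).
rewrite (ty_evalM cpl rho11 thr on_Xi)//; last first.
  by apply: (tyaM cpl rho11) => //; apply: (tyaN rho11).
rewrite (ty_evalM cpl rho11 thr on_Xi)//; last by apply: (tyaN rho11).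
rewrite (ty_evalN cpl rho11 _ thr)// (ty_eval_cst W iota cpl) evv evn mulrNN.
set w := wdy _ _ _ in w0 *; set a := evX Pi; set b := (_ - _)^-1.
have -> : zeta * xi * w * b * a / w = zeta * xi * a * b * (w / w) by ring.
by rewrite divff// mulr1.
Qed.

End Limit.
End Main.

Theorem theorem7p1 (R : realType) (F : finFieldType) (W : weierstrass F)
    (C : ultraFieldType R) (iota : {rmorphism F -> C})
    (theta eta alpha beta zeta : C)
    (E_smooth : nonsingular (map_w iota W))
    (C_inf : is_Cinf W iota theta eta)
    (V_def : is_drinfeld_point W iota theta eta alpha beta)
    (zeta_root : zeta ^+ (#|F|.-1) = shtuka_xi F theta eta alpha beta) :
  let delta1 := tyt W iota - tyc W iota (alpha ^+ #|F|) in
  let f := shtuka_f W iota theta eta alpha beta in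
  let omega := omega_rho W iota theta eta alpha beta zeta in
  let pi := pi_rho W iota theta eta alpha beta zeta in
  let L := LA1 W iota theta eta in
  has_tysum (@Aplus F W) (Lterm (W := W) iota theta eta) L /\
  L = - (delta1 * tyc W iota pi / (f * omega)).
Proof.
move=> delta1 f omega pi L.
have [Pi [Pi' [bPi bPi' PiPi' [lPi bP] omE]]] := omega_product C_inf V_def.
have lim := partial_sum_lim E_smooth C_inf V_def bPi PiPi' lPi bP.
have hL := has_tysum_of_blim C_inf lim.
(* [LA1] defaults to 0 on a family without a sum; the existence just shown makes it a genuine
   sum. *)
have hL' : has_tysum (@Aplus F W) (Lterm (W := W) iota theta eta) L.
  by apply: xgetPex; eexists; exact: hL.
split => //; rewrite (has_tysum_uniq C_inf hL' hL).
set xi := shtuka_xi F theta eta alpha beta in zeta_root omE.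
have xi0 : xi != 0 := xi_neq0 C_inf V_def.
have q1 := card_gt1 F.
have z0 : zeta != 0.
  apply/eqP => z; move/eqP: xi0; apply; rewrite -zeta_root z expr0n.
  by move: q1; clear; case: #|F| => [|[]].
have zx0 : zeta * xi != 0 by rewrite mulf_neq0.
have fU : f \is a GRing.unit.
  by rewrite /f /shtuka_f unitrM unitrV (nu_unit C_inf V_def 0) (del_unit C_inf V_def 0).
have twf : twist 0 f = f.
  rewrite (f_twist C_inf V_def) /f /shtuka_f /nu /del /line_fun /tlin expn0 !expr1.
  by [].
have fo : f * omega = tyc W iota (zeta * xi) * Pi.
  rewrite /omega omE twf expn0 expr1.
  have -> : f * (tyc W iota zeta * (tyc W iota xi / f * Pi)) =
    tyc W iota zeta * (tyc W iota xi / f * f) * Pi by ring.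
  by rewrite divrK// tycM.
(* Inverses in [wext] are chosen by [xget], so this one is identified through an explicit inverse
   built from Pi'. *)
have foV : (f * omega)^-1 = tyc W iota (zeta * xi)^-1 * Pi'.
  apply: wext_invI; rewrite fo mulrACA tyc_mulV// PiPi' mulr1//.
have piE : pi = - (zeta * xi * ty_eval Pi theta eta / (theta - alpha ^+ #|F|)).
  by rewrite /pi /pi_rho omE (residue_omega E_smooth C_inf V_def bPi).
rewrite foV piE tycN mulrN mulNr opprK /delta1 /tlin expn1.
set e := ty_eval Pi theta eta; set b := (theta - alpha ^+ #|F|)^-1.
have -> : tyc W iota (zeta * xi * e * b) = tyc W iota (zeta * xi) * tyc W iota (e * b).
  by rewrite -tycM mulrA.
set d := tyt W iota - _.
have -> : d * (tyc W iota (zeta * xi) * tyc W iota (e * b)) * (tyc W iota (zeta * xi)^-1 * Pi') =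
  (tyc W iota (zeta * xi) * tyc W iota (zeta * xi)^-1) * (tyc W iota (e * b) * d * Pi') by ring.
by rewrite tyc_mulV// mul1r.
Qed.
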